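(* For $\mathbb{P}$-almost every $\underline{\tau}$, the velocity field $u_{\underline{\tau}}$ is an ideal dynamo, i.e. $$\gamma(0)=\sup_{B_0}\ \limsup_{t\to\infty}\frac1t\log\|B(t)\|_{L^2(\mathbb{T}^3)}>0,$$ where the supremum is over initial magnetic fields $B_0\in L^2(\mathbb{T}^3)$ and $B(t)$ is the solution with initial datum $B_0$ of the magnetic induction equation with zero diffusivity driven by $u=u_{\underline{\tau}}$.
   Context: Let $\mathbb{S}^1=\mathbb{R}/(2\pi\mathbb{Z})$ and $\mathbb{T}^3=\mathbb{R}^3/(2\pi\mathbb{Z})^3$. Let $f_1,f_2,f_3\in C^\omega(\mathbb{S}^1,\mathbb{R})$ be non-constant real-analytic functions. For $g:\mathbb{S}^1\to\mathbb{R}$ write $C_g=\{x\in\mathbb{S}^1: g(x)=0\}$. Standing assumption (H1): for $i=1,2,3$, $C_{f_i}\cap C_{f_i'}=\emptyset$ and $C_{f_i'}\cap C_{f_i''}=\emptyset$. For $x=(x_1,x_2,x_3)\in\mathbb{T}^3$ define $X_1(x)=(f_1(x_3),f_1'(x_3),0)$, $X_2(x)=(0,f_2(x_1),f_2'(x_1))$, $X_3(x)=(f_3'(x_2),0,f_3(x_2))$. Fix $h>0$ and let $\tau_1,\tau_2,\dots$ be i.i.d. exponential random variables with mean $h$, $\underline{\tau}=(\tau_1,\tau_2,\dots)$. The random velocity field is $$u_{\underline{\tau}}(t,x)=\sum_{n=0}^\infty\Big(\tau_{3n+1}X_1(x)\chi_{(3n,3n+1]}(t)+\tau_{3n+2}X_2(x)\chi_{(3n+1,3n+2]}(t)+\tau_{3n+3}X_3(x)\chi_{(3n+2,3n+3]}(t)\Big),$$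 with $\chi$ denoting indicator functions. The magnetic induction equation with zero diffusivity is $\partial_tB+(u\cdot\nabla)B-(B\cdot\nabla)u=0$, $\nabla\cdot B=0$ in $(0,\infty)\times\mathbb{T}^3$, $B(0,\cdot)=B_0$ (so the initial data are divergence-free vector fields). If $\psi^t_{\underline{\tau}}$ is the flow of $\dot x=u_{\underline{\tau}}(t,x)$ started at time $0$, its solution is $B(t,x)=D_{y}\psi^t_{\underline{\tau}}\,B_0(y)$ with $y=(\psi^t_{\underline{\tau}})^{-1}(x)$. *)

(* Defs.v *)
From HB Require Import structures.
From mathcomp Require Import all_boot all_order all_algebra.
From mathcomp Require Import all_classical all_reals all_analysis.

Set Implicit Arguments.
Unset Strict Implicit.
Unset Printing Implicit Defensive.

Import Order.TTheory GRing.Theory Num.Theory.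
Import numFieldNormedType.Exports.

Local Open Scope ring_scope.
Local Open Scope classical_set_scope.

(* Functions and vector fields on the circle and on the 3-torus are
   represented by 2pi-periodic functions on R and on R^3 = R * R * R.
   The point (x_1, x_2, x_3) is ((x_1, x_2), x_3). *)

Section circle.
Context {R : realType}.
Implicit Type f : R -> R.

Definition real_analytic f := forall x0 : R, exists a : nat -> R, exists2 r : R,
  0 < r & forall x : R, `|x - x0| < r ->
    series (fun n => a n * (x - x0) ^+ n) @ \oo --> f x.

Definition analytic_on_circle f := real_analytic f /\ periodic f (pi *+ 2).

Definition nonconstant f := forall c : R, f <> cst c.

Definition zeros f : set R := [set x | f x = 0].

Definition H1 f :=
  zeros f `&` zeros f^`() = set0 /\ zeros f^`() `&` zeros f^`(2) = set0.

End circle.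

Section velocity_field.
Context {R : realType}.
Local Notation R3 := (R * R * R)%type.

Definition X1 (f1 : R -> R) (x : R3) : R3 := (f1 x.2, f1^`() x.2, 0).
Definition X2 (f2 : R -> R) (x : R3) : R3 := (0, f2 x.1.1, f2^`() x.1.1).
Definition X3 (f3 : R -> R) (x : R3) : R3 := (f3^`() x.1.2, 0, f3 x.1.2).

(* The sequence of random times is indexed from 0: [tau n] is the mathematical
   tau_{n+1}.  For every t at most one term of the series is nonzero, so that
   the finitely supported sum is its value. *)
Definition velocity (f1 f2 f3 : R -> R) (tau : nat -> R) (t : R) (x : R3) : R3 :=
  \sum_(n \in [set: nat])
    ((tau (3 * n)%N * \1_(`](3 * n)%:R, (3 * n + 1)%:R]) t) *: X1 f1 x
   + (tau (3 * n + 1)%N * \1_(`](3 * n + 1)%:R, (3 * n + 2)%:R]) t) *: X2 f2 x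
   + (tau (3 * n + 2)%N * \1_(`](3 * n + 2)%:R, (3 * n + 3)%:R]) t) *: X3 f3 x).

End velocity_field.

Section ideal_dynamo.
Context {R : realType}.
Local Notation R3 := (R * R * R)%type.
Local Notation mu := (@lebesgue_measure R).

Definition component (i : 'I_3) (x : R3) : R := nth 0 [:: x.1.1; x.1.2; x.2] i.

(* Velocity fields may be discontinuous in time, so that integral curves
   are understood in the sense of Caratheodory. *)
Definition integral_curve (u : R -> R3 -> R3) (y : R3) (X : R -> R3) :=
  forall (i : 'I_3) (t : R), 0 <= t ->
    mu.-integrable `[0, t] (EFin \o (fun s => component i (u s (X s)))) /\
    component i (X t) = component i y + \int[mu]_(s in `[0, t]) component i (u s (X s)).

(* For t >= 0, the position at time t of the (unique) integral curve from y. *)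
Definition flow (u : R -> R3 -> R3) (t : R) (y : R3) : R3 :=
  xget 0 [set X t | X in integral_curve u y].

(* [measurableTypeR R] is R, with the Borel sigma-algebra that [lebesgue_measure]
   lives on. *)
Local Notation borelR := (measurableTypeR R).
Local Notation borelR3 := (borelR * borelR * borelR)%type.

Definition volume := ((mu \x mu) \x mu)%E.
HB.instance Definition _ := Measure.on volume.

(* A fundamental domain of the torus. *)
Definition torus : set R3 :=
  `[0, pi *+ 2[ `*` `[0, pi *+ 2[ `*` `[0, pi *+ 2[.

Definition periodic3 (V : zmodType) (g : R3 -> V) :=
  [/\ periodic g (pi *+ 2, 0, 0), periodic g (0, pi *+ 2, 0)
    & periodic g (0, 0, pi *+ 2)].

(* C^oo: all the iterated directional derivatives are differentiable. *)
Definition smooth (phi : R3 -> R) := forall (vs : seq R3) (x : R3),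
  differentiable (foldr (fun v g => 'D_v g) phi vs) x.

Definition L2norm (B : R3 -> R3) : \bar R :=
  sqrte (\int[volume]_(x in torus) (\sum_(i < 3) component i (B x) ^+ 2)%:E)%E.

Definition square_integrable (B : R3 -> R3) :=
  (forall i : 'I_3, @measurable_fun _ _ borelR3 R setT (component i \o B)) /\
  (L2norm B < +oo)%E.

(* Divergence-free in the sense of distributions; ['d phi x (B x)] is the inner
   product of B(x) with the gradient of phi at x. *)
Definition divergence_free (B : R3 -> R3) := forall phi : R3 -> R,
  smooth phi -> periodic3 phi ->
  (\int[volume]_(x in torus) ('d phi x (B x))%:E = 0)%E.

Definition initial_field (B0 : R3 -> R3) :=
  [/\ periodic3 B0, square_integrable B0 & divergence_free B0].

(* The solution of the induction equation without diffusion: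
   B(t,x) = D_y psi^t B_0(y) with y = (psi^t)^{-1}(x), psi being the flow. *)
Definition induction_solution (u : R -> R3 -> R3) (B0 : R3 -> R3)
    (t : R) (x : R3) : R3 :=
  let y := 'pinv_(fun=> 0) setT (flow u t) x in 'd (flow u t) y (B0 y).

(* [lne 0 = -oo], hence the field B0 = 0 has growth rate -oo. *)
Definition growth_rate (u : R -> R3 -> R3) (B0 : R3 -> R3) : \bar R :=
  limf_esup
    (fun t : R => (t^-1)%:E * lne (L2norm (induction_solution u B0 t)))%E
    (pinfty_nbhs R).

Definition gamma0 (u : R -> R3 -> R3) : \bar R :=
  ereal_sup [set growth_rate u B0 | B0 in initial_field].

Definition ideal_dynamo (u : R -> R3 -> R3) := (0 < gamma0 u)%E.

End ideal_dynamo.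

Section random_times.
Context d (Omega : measurableType d) {R : realType} (P : probability Omega R).
Implicit Type X : nat -> {RV P >-> R}.

Definition mutually_independent X := forall (J : seq nat) (A : nat -> set R),
  uniq J -> (forall j, measurable (A j)) ->
  P (\bigcap_(j in [set` J]) (X j @^-1` A j)) =
  (\prod_(j <- J) P (X j @^-1` A j))%E.

Definition iid_exponential (h : R) X :=
  mutually_independent X /\
  (forall n (A : set R), measurable A ->
     distribution P (X n) A = exponential_prob h^-1 A).

End random_times.

(* Main.v *)
(* Lift the three shears to maps of (position, vector) pairs, acting on vectors
   by the differential; they preserve Lebesgue measure on T^3 x R^3 and commute
   with the lattice.  By (H1) some constant c > 0 is at most |f_i'| or |f_i''|
   at each point, so that along the orbit of a pair under the i-th lifted shear
   the vector is in the cone where its transverse component dominates for at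
   most one of the times 0, 3/c, 6/c, ...  As the three cones cover the nonzero
   vectors, averaging a function successively over the three shears with
   exponential times contracts its squared L^2 norm by a factor q < 1.

   Applied to the indicator of the vectors of size at most rho^n, with rho > 1
   close to 1, whose squared norm is of order rho^(3n), this shows that a vector
   of the unit box is still shorter than rho^n after n cycles with exponentially
   small probability, on average over positions.  By Tonelli, almost surely some
   constant vector v is such that the volumes of {y : |D psi^(3n)(y) v| <= rho^n}
   are summable in n.  The constant field v is an admissible initial datum, and
   since psi^(3n) preserves volume, |B(3n)|_2^2 is the integral of
   |D psi^(3n)(y) v|^2 over y, hence at least of order rho^(2n) for infinitely
   many n. *)

From HB Require Import structures.
Require Import Defs.
From mathcomp Require Import all_boot all_order all_algebra.
From mathcomp Require Import all_classical all_reals all_analysis.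
From mathcomp Require Import measurable_realfun ring lra zify.

Set Implicit Arguments.
Unset Strict Implicit.
Unset Printing Implicit Defensive.

Import Order.TTheory GRing.Theory Num.Theory.
Import numFieldNormedType.Exports.

Local Open Scope ring_scope.
Local Open Scope classical_set_scope.

(** * Averages along measure-preserving flows *)

(** The contraction rests on a variance identity. Since the flows preserve the measure, the squared
    norm lost by averaging [G] over a random time is the integral of the variance of [G] along the
    orbit. A small loss thus makes [G] almost invariant, and an almost invariant function has little
    mass on a cone that each orbit visits at most once among many times. Exponential times live on a
    half-line, so their law is not translation invariant; the substitute is that its shift by a
    bounded time is dominated by a multiple of it. Nonzero constants would be invariant, but phase
    space has infinite measure and they are not square integrable. Zero vectors are fixed by all the
    flows and lie in no cone, so test functions have to vanish there. The contraction gives no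
    information at a single point of phase space: positions must be averaged, and the vector is
    selected in a box after the random times are known. As a limsup is bounded below along any
    sequence, only the times 3n matter, where the flow map is an explicit composition of shears. *)

Section nonneg_integral.
Context d (T : measurableType d) {R : realType} (mu : {measure set T -> \bar R}).
Implicit Types f g : T -> R.

Lemma ge0_le_integral_EFin f g : measurable_fun setT f -> measurable_fun setT g ->
  (forall x, 0 <= f x) -> (forall x, f x <= g x) ->
  (\int[mu]_x (f x)%:E <= \int[mu]_x (g x)%:E)%E.
Proof.
move=> mf mg f0 fg; apply: ge0_le_integral => //.
- by move=> x _; rewrite lee_fin.
- exact/measurable_EFinP.
- exact/measurable_EFinP.
- by move=> x _; rewrite lee_fin.
Qed.

Lemma ge0_integralD_EFin f g : measurable_fun setT f -> measurable_fun setT g ->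
  (forall x, 0 <= f x) -> (forall x, 0 <= g x) ->
  (\int[mu]_x (f x + g x)%:E = \int[mu]_x (f x)%:E + \int[mu]_x (g x)%:E)%E.
Proof.
move=> mf mg f0 g0; under eq_integral do rewrite EFinD.
rewrite ge0_integralD//.
- by move=> x _; rewrite lee_fin.
- exact/measurable_EFinP.
- by move=> x _; rewrite lee_fin.
- exact/measurable_EFinP.
Qed.

Lemma ge0_integralM_EFin (k : R) f : measurable_fun setT f -> 0 <= k ->
  (forall x, 0 <= f x) ->
  (\int[mu]_x (k * f x)%:E = k%:E * \int[mu]_x (f x)%:E)%E.
Proof.
move=> mf k0 f0; under eq_integral do rewrite EFinM.
rewrite ge0_integralZl_EFin//; last exact/measurable_EFinP.
by move=> x _; rewrite lee_fin.
Qed.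

Lemma integral_EFin_ge0 f : (forall x, 0 <= f x) -> (0 <= \int[mu]_x (f x)%:E)%E.
Proof. by move=> f0; apply: integral_ge0 => x _; rewrite lee_fin. Qed.

End nonneg_integral.

Lemma geometric_sum_le (R : realFieldType) (b : R) n : 0 <= b < 1 ->
  \sum_(0 <= i < n) b ^+ i <= (1 - b)^-1.
Proof.
move=> /andP[b0 b1]; rewrite -[leRHS]mul1r ler_pdivlMr ?subr_gt0// mulrC big_mkord.
have := subrX1 b n => /(congr1 -%R); rewrite opprB -mulNr opprB => <-.
by rewrite gerBl exprn_ge0.
Qed.

Lemma sqr_le_double (R : realType) (a b : R) : a ^+ 2 <= 2 * b ^+ 2 + 2 * (a - b) ^+ 2.
Proof. by have := sqr_ge0 (a - 2 * b); nra. Qed.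

Lemma integral_probability_cst d (T : measurableType d) (R : realType)
    (m : probability T R) (x : \bar R) : (\int[m]_s x = x)%E.
Proof. by rewrite integral_cst// [X in (_ * X)%E]probability_setT mule1. Qed.

Section bounded_mean.
Context d (T : measurableType d) {R : realType} (m : probability T R).
Variable a : T -> R.
Hypotheses (ma : measurable_fun setT a) (a01 : forall s, 0 <= a s <= 1).

Lemma unit_integrable : m.-integrable setT (EFin \o a).
Proof.
apply: measurable_bounded_integrable => //.
  by rewrite [ltLHS]probability_setT ltry.
exists 1; split => // x x1 s _ /=.
by have /andP[a0 a1] := a01 s; rewrite ger0_norm// (le_trans a1)// ltW.
Qed.

Lemma unit_mean01 : 0 <= Rintegral m setT a <= 1.
Proof.
apply/andP; split.
  by apply: Rintegral_ge0 => s _; have /andP[] := a01 s.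
have <- : Rintegral m setT (fun=> 1) = 1.
  by rewrite Rintegral_cst// mul1r [X in fine X]probability_setT.
apply: le_Rintegral => //; first exact: unit_integrable.
- apply: (@finite_measure_integrable_cst _ _ _ m setT 1) => //.
- by move=> s _; have /andP[] := a01 s.
Qed.

Lemma mean_EFin : ((Rintegral m setT a)%:E = \int[m]_s (a s)%:E)%E.
Proof.
rewrite /Rintegral fineK//.
exact: (integrable_fin_num _ unit_integrable).
Qed.

End bounded_mean.

Section variance.
Context d (T : measurableType d) {R : realType} (m : probability T R).
Variable a : T -> R.
Hypotheses (ma : measurable_fun setT a) (a01 : forall s, 0 <= a s <= 1).

(** Expanding the square, the cross term averages to [- 2 * M ^+ 2]. The bounds on [a] make every
    term integrable, so that the computation takes place in the real numbers and is transferred to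
    [\bar R] at the end. *)
Lemma variance_pythagoras (M := Rintegral m setT a) :
  (\int[m]_s ((a s - M) ^+ 2)%:E + (M ^+ 2)%:E = \int[m]_s (a s ^+ 2)%:E)%E.
Proof.
have sq01 (b : T -> R) : (forall s, 0 <= b s <= 1) -> forall s, 0 <= b s ^+ 2 <= 1.
  by move=> b01 s; have /andP[b0 b1] := b01 s; nra.
have M01 : 0 <= M <= 1 by exact: unit_mean01.
have ma2 : measurable_fun setT (fun s => a s ^+ 2) by exact: measurable_funX.
have maM : measurable_fun setT (fun s => (a s - M) ^+ 2).
  by apply: measurable_funX; exact: measurable_funB.
have e2 : Rintegral m setT (fun s => (a s - M) ^+ 2) + M ^+ 2 =
          Rintegral m setT (fun s => a s ^+ 2).
  have -> : Rintegral m setT (fun s => (a s - M) ^+ 2) =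
      Rintegral m setT (fun s => (a s ^+ 2 - (2 * M) * a s) + M ^+ 2).
    by apply: eq_Rintegral => s _; ring.
  have ia2 : m.-integrable setT (EFin \o (fun s => a s ^+ 2)).
    exact: (unit_integrable m ma2 (sq01 _ a01)).
  have ia : m.-integrable setT (EFin \o (fun s => 2 * M * a s)).
    have := integrableZl measurableT (2 * M) (unit_integrable m ma a01).
    by apply: eq_integrable.
  have ic : m.-integrable setT (EFin \o (fun _ : T => M ^+ 2)).
    exact: (@finite_measure_integrable_cst _ _ _ m setT).
  rewrite RintegralD//; last first.
    have := integrableB measurableT ia2 ia.
    by apply: eq_integrable.
  rewrite RintegralB// RintegralZl//; last exact: unit_integrable.
  rewrite Rintegral_cst// [fine _](_ : _ = 1); last by rewrite [X in fine X]probability_setT.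
  by rewrite -/M; ring.
have am s : 0 <= (a s - M) ^+ 2 <= 1.
  have /andP[a0 a1] := a01 s; move: M01 => /andP[M0 M1].
  rewrite sqr_ge0/= -subr_ge0.
  rewrite (_ : 1 - _ = (1 - (a s - M)) * (1 + (a s - M))); last by ring.
  by apply: mulr_ge0; lra.
rewrite -(mean_EFin m ma2 (sq01 _ a01)) -(mean_EFin m maM am).
by rewrite -EFinD e2.
Qed.

End variance.

Section averaged_shear.
Local Open Scope ereal_scope.
Context d d' (E : measurableType d) (T : measurableType d') {R : realType}.
Variable lam : {sigma_finite_measure set E -> \bar R}.
Variable m : probability (R) R.
Variables (K : Type) (tr : K -> E -> E).

Definition invariant_fun (V : Type) (G : E -> V) := forall k z, G (tr k z) = G z.

(** Values in [0, 1] make all averages against a probability finite, and this class is stable under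
    [averaged]. *)
Definition unit_fun (G : E -> R) :=
  [/\ measurable_fun setT G, (forall z, 0 <= G z <= 1)%R & invariant_fun G].

Definition sqnorm (G : E -> R) : \bar R := \int[lam]_z (G z ^+ 2)%:E.

Lemma sqnorm_ge0 G : 0 <= sqnorm G.
Proof. by apply: integral_EFin_ge0 => z; exact: sqr_ge0. Qed.

(** In the application the measure is carried by a fundamental domain of the lattice, which a shear
    of the covering space does not preserve. Invariance of integrals is therefore asked only for
    functions invariant under the translations [tr]. *)
Record measure_preserving_flow := MeasurePreservingFlow {
  flow_fun :> R -> E -> E ;
  measurable_flow : measurable_fun setT (fun p : E * R => flow_fun p.2 p.1) ;
  flowD : forall s t z, flow_fun (s + t) z = flow_fun s (flow_fun t z) ;
  flow_translation : forall s k z, flow_fun s (tr k z) = tr k (flow_fun s z) ;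
  flow_preserves : forall s (g : E -> R), measurable_fun setT g ->
    (forall z, 0 <= g z)%R -> invariant_fun g ->
    \int[lam]_z (g (flow_fun s z))%:E = \int[lam]_z (g z)%:E }.

Definition averaged (Phi : measure_preserving_flow) (G : E -> R) (z : E) : R :=
  Rintegral m setT (fun s => G (Phi s z)).

Section one_flow.
Variable Phi : measure_preserving_flow.

Lemma measurable_flow1 s : measurable_fun setT (Phi s).
Proof. exact: measurableT_comp (measurable_flow Phi) (pair2_measurable s). Qed.

Lemma measurable_flow2 z : measurable_fun setT (fun s : R => Phi s z).
Proof. exact: measurableT_comp (measurable_flow Phi) (pair1_measurable z). Qed.

Lemma sqnorm_flow s (G : E -> R) : unit_fun G ->
  sqnorm (fun z => G (Phi s z)) = sqnorm G.
Proof.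
move=> [mG G01 iG]; apply: (@flow_preserves Phi s (fun z => G z ^+ 2)%R).
- exact: measurable_funX.
- by move=> z; exact: sqr_ge0.
- by move=> k z; rewrite iG.
Qed.

Section one_function.
Variable G : E -> R.
Hypothesis uG : unit_fun G.

Let mG : measurable_fun setT G. Proof. by have [] := uG. Qed.
Let G01 z : (0 <= G z <= 1)%R. Proof. by have [] := uG. Qed.
Let iG : invariant_fun G. Proof. by have [] := uG. Qed.

Let mGPhi : measurable_fun setT (fun p : E * R => G (Phi p.2 p.1)).
Proof. exact: measurableT_comp mG (measurable_flow Phi). Qed.

Let mGPhi1 s : measurable_fun setT (fun z => G (Phi s z)).
Proof. exact: measurableT_comp mG (measurable_flow1 s). Qed.

Let mGPhi2 z : measurable_fun setT (fun s : R => G (Phi s z)).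
Proof. exact: measurableT_comp mG (measurable_flow2 z). Qed.

Lemma averaged_unit : unit_fun (averaged Phi G).
Proof.
split.
- apply/measurable_EFinP.
  rewrite (_ : _ \o _ = fubini_F m (fun p => (G (Phi p.2 p.1))%:E)).
    apply: measurable_fun_fubini_tonelli_F; first exact/measurable_EFinP.
    by move=> p; rewrite lee_fin; have /andP[] := G01 (Phi p.2 p.1).
  apply/funext => z; rewrite /fubini_F/= /averaged mean_EFin//.
- by move=> z; exact: unit_mean01.
- by move=> k z; apply: eq_Rintegral => s _; rewrite flow_translation iG.
Qed.

Let Q := averaged Phi G.
Let mQ : measurable_fun setT Q. Proof. by have [] := averaged_unit. Qed.
Let iQ : invariant_fun Q. Proof. by have [] := averaged_unit. Qed.

Definition variance_loss :=
  \int[lam]_z \int[m]_s ((G (Phi s z) - averaged Phi G z) ^+ 2)%:E.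

Let mdev : measurable_fun setT
  (fun p : E * R => (G (Phi p.2 p.1) - Q p.1) ^+ 2)%R.
Proof.
apply: measurable_funX; apply: measurable_funB => //.
exact: measurableT_comp mQ measurable_fst.
Qed.

Lemma variance_loss_ge0 : 0 <= variance_loss.
Proof.
by apply: integral_ge0 => z _; apply: integral_EFin_ge0 => s; exact: sqr_ge0.
Qed.

Lemma variance_lossE : variance_loss =
  \int[m]_s \int[lam]_z ((G (Phi s z) - averaged Phi G z) ^+ 2)%:E.
Proof.
rewrite /variance_loss.
apply: (fubini_tonelli (m1 := lam) (m2 := m) (fun p => ((G (Phi p.2 p.1) - Q p.1) ^+ 2)%:E)).
- exact/measurable_EFinP.
- by move=> p; rewrite lee_fin sqr_ge0.
Qed.

(** Pythagoras on each orbit, integrated over its starting point: by Tonelli and the invariance of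
    the measure, the mean of [G ^+ 2] over the random time integrates to [sqnorm G]. *)
Lemma sqnorm_averagedD : variance_loss + sqnorm Q = sqnorm G.
Proof.
rewrite /variance_loss /sqnorm -ge0_integralD//; last 4 first.
- by move=> z _; apply: integral_EFin_ge0 => s; exact: sqr_ge0.
- apply: (measurable_fun_fubini_tonelli_F (m2 := m)
    (fun p => ((G (Phi p.2 p.1) - Q p.1) ^+ 2)%:E)).
  + exact/measurable_EFinP.
  + by move=> p; rewrite lee_fin sqr_ge0.
- by move=> z _; rewrite lee_fin sqr_ge0.
- by apply/measurable_EFinP; exact: measurable_funX.
under eq_integral => z _ do rewrite variance_pythagoras//.
rewrite (fubini_tonelli (m1 := lam) (m2 := m) (fun p => (G (Phi p.2 p.1) ^+ 2)%:E)) /=; last 2 first.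
- by apply/measurable_EFinP; exact: measurable_funX.
- by move=> p; rewrite lee_fin sqr_ge0.
transitivity (\int[m]_s (fun=> sqnorm G) s).
  by apply: eq_integral => s _; exact: (sqnorm_flow s uG).
exact: integral_probability_cst.
Qed.

Let dev r := \int[lam]_z ((G (Phi r z) - Q z) ^+ 2)%:E.

Let mdevr : measurable_fun setT dev.
Proof.
apply: (measurable_fun_fubini_tonelli_G (m1 := lam)
  (fun p => ((G (Phi p.2 p.1) - Q p.1) ^+ 2)%:E)).
- exact/measurable_EFinP.
- by move=> p; rewrite lee_fin sqr_ge0.
Qed.

Let dev_ge0 r : 0 <= dev r.
Proof. by apply: integral_EFin_ge0 => z; exact: sqr_ge0. Qed.

Variables (b Kb : R).
Hypothesis Kb0 : (0 <= Kb)%R.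
Hypothesis shift_bound : forall s (f : R -> \bar R), (0 <= s <= b)%R ->
  measurable_fun setT f -> (forall r, 0 <= f r) ->
  \int[m]_r f (s + r)%R <= Kb%:E * \int[m]_r f r.

(** Replacing [z] by [Phi r z] leaves the left side unchanged and compares [G] at the times s + r
    and r. For random r both values are close to the mean [Q]; the time s + r has the wrong law,
    which [shift_bound] corrects at the cost of a factor [Kb]. *)
Lemma sqdist_flow_le s : (0 <= s <= b)%R ->
  \int[lam]_z ((G (Phi s z) - G z) ^+ 2)%:E <= (2 * Kb + 2)%:E * variance_loss.
Proof.
move=> sb.
have step r : \int[lam]_z ((G (Phi s z) - G z) ^+ 2)%:E <=
    2%:E * dev (s + r) + 2%:E * dev r.
  rewrite -(@flow_preserves Phi r (fun z => (G (Phi s z) - G z) ^+ 2)%R); last 3 first.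
  - by apply: measurable_funX; exact: measurable_funB.
  - by move=> z; exact: sqr_ge0.
  - by move=> k z; rewrite flow_translation !iG.
  rewrite /dev -!ge0_integralM_EFin//; last 4 first.
  - by apply: measurable_funX; exact: measurable_funB.
  - by move=> z; exact: sqr_ge0.
  - by apply: measurable_funX; exact: measurable_funB.
  - by move=> z; exact: sqr_ge0.
  rewrite -ge0_integralD_EFin//; last 4 first.
  - by apply: measurable_funM => //; apply: measurable_funX; exact: measurable_funB.
  - by apply: measurable_funM => //; apply: measurable_funX; exact: measurable_funB.
  - by move=> z; rewrite mulr_ge0 ?sqr_ge0.
  - by move=> z; rewrite mulr_ge0 ?sqr_ge0.
  apply: ge0_le_integral_EFin.
  - apply: measurable_funX; apply: measurable_funB => //.
    exact: measurableT_comp (mGPhi1 s) (measurable_flow1 r).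
  - apply: measurable_funD; apply: measurable_funM => //;
    by apply: measurable_funX; exact: measurable_funB.
  - by move=> z; exact: sqr_ge0.
  - move=> z; rewrite -flowD.
    have := sqr_ge0 ((G (Phi (s + r) z) - Q z) + (G (Phi r z) - Q z))%R.
    by nra.
have cst_int (x : \bar R) : \int[m]_r (fun=> x) r = x.
  exact: integral_probability_cst.
rewrite -[leLHS]cst_int.
have mds : measurable_fun setT (fun r : R => dev (s + r)).
  by apply: measurableT_comp mdevr _; exact: measurable_funD.
apply: (@le_trans _ _ (\int[m]_r (2%:E * dev (s + r) + 2%:E * dev r))).
  apply: ge0_le_integral => //.
  - by move=> r _; apply: integral_EFin_ge0 => z; exact: sqr_ge0.
  - apply: emeasurable_funD; exact: measurable_funeM.
rewrite ge0_integralD//; last 4 first.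
- by move=> r _; exact: mule_ge0.
- exact: measurable_funeM.
- by move=> r _; exact: mule_ge0.
- exact: measurable_funeM.
rewrite !ge0_integralZl_EFin// variance_lossE -/dev.
have := shift_bound sb mdevr dev_ge0.
have : 0 <= \int[m]_r dev r by exact: integral_ge0.
(* The loss may be infinite at this generality, and then so is the right side. *)
case: (\int[m]_r dev r) => [L|_ _|//].
- rewrite lee_fin => L0.
  have : 0 <= \int[m]_r dev (s + r) by exact: integral_ge0.
  case: (\int[m]_r dev (s + r)) => [L'|//|//].
  rewrite -!EFinM -EFinD !lee_fin => _ h.
  rewrite (_ : (2 * Kb + 2) * L = 2 * (Kb * L) + 2 * L)%R; last by ring.
  by lra.
- have K0 : (0 < 2 * Kb + 2)%R by rewrite ltr_wpDl ?mulr_ge0.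
  by rewrite [X in _ <= X]gt0_muley ?leey// lte_fin.
Qed.

Variables (p : R).
Hypothesis pb : p%:E <= m `[0%R, b].

(** For r in [0, b], [G] and [Q] are compared through the value of [G] at [Phi r z]: one distance is
    small on average over r, the other by [sqdist_flow_le]. Integrating over these r, which have
    probability at least [p], gives the constant 2 + 2 (2 Kb + 2). *)
Lemma sqdist_averaged_le :
  p%:E * \int[lam]_z ((G z - Q z) ^+ 2)%:E <= (4 * Kb + 6)%:E * variance_loss.
Proof.
set I := \int[lam]_z _.
have I0 : 0 <= I by apply: integral_EFin_ge0 => z; exact: sqr_ge0.
have step r : (0 <= r <= b)%R -> I <= 2%:E * dev r + (4 * Kb + 4)%:E * variance_loss.
  move=> rb; apply: (@le_trans _ _
      (2%:E * dev r + 2%:E * \int[lam]_z ((G (Phi r z) - G z) ^+ 2)%:E)).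
    rewrite /dev -!ge0_integralM_EFin//; last 4 first.
    - by apply: measurable_funX; exact: measurable_funB.
    - by move=> z; exact: sqr_ge0.
    - by apply: measurable_funX; exact: measurable_funB.
    - by move=> z; exact: sqr_ge0.
    rewrite -ge0_integralD_EFin//; last 4 first.
    - by apply: measurable_funM => //; apply: measurable_funX; exact: measurable_funB.
    - by apply: measurable_funM => //; apply: measurable_funX; exact: measurable_funB.
    - by move=> z; rewrite mulr_ge0 ?sqr_ge0.
    - by move=> z; rewrite mulr_ge0 ?sqr_ge0.
    apply: ge0_le_integral_EFin.
    - by apply: measurable_funX; exact: measurable_funB.
    - apply: measurable_funD; apply: measurable_funM => //;
      by apply: measurable_funX; exact: measurable_funB.
    - by move=> z; exact: sqr_ge0.
    - move=> z.
      have := sqr_ge0 ((G (Phi r z) - Q z) + (G (Phi r z) - G z))%R.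
      by nra.
  apply: leeD => //.
  rewrite (_ : (4 * Kb + 4)%R = (2 * (2 * Kb + 2))%R); last by ring.
  by rewrite EFinM -muleA lee_pmul2l// sqdist_flow_le.
have C0 : (0 <= 4 * Kb + 4)%R by rewrite addr_ge0 ?mulr_ge0.
have l0 := variance_loss_ge0.
apply: (@le_trans _ _ (\int[m]_(r in `[0%R, b]) (fun=> I) r)).
  by rewrite integral_cst// muleC lee_wpmul2l.
have mrhs : measurable_fun setT (fun r : R =>
    2%:E * dev r + (4 * Kb + 4)%:E * variance_loss).
  by apply: emeasurable_funD => //; exact: measurable_funeM.
apply: (@le_trans _ _ (\int[m]_(r in `[0%R, b])
    (2%:E * dev r + (4 * Kb + 4)%:E * variance_loss))).
  apply: ge0_le_integral => //; first exact: measurable_funTS.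
apply: (@le_trans _ _ (\int[m]_r
    (2%:E * dev r + (4 * Kb + 4)%:E * variance_loss))).
  apply: ge0_subset_integral => // r _.
  by rewrite adde_ge0// mule_ge0// lee_fin.
rewrite ge0_integralD//; last 3 first.
- by move=> r _; rewrite mule_ge0.
- exact: measurable_funeM.
- by move=> r _; rewrite mule_ge0// lee_fin.
rewrite ge0_integralZl_EFin// -variance_lossE integral_probability_cst.
rewrite -ge0_muleDl//.
by rewrite -EFinD (_ : (2 + (4 * Kb + 4) = 4 * Kb + 6)%R)//; ring.
Qed.

End one_function.

Section one_set.
Variables (A : set E) (a : R).
Hypotheses (mA : measurable A) (trA : forall k z, A (tr k z) = A z).
Hypothesis visit : forall (i j : nat) z, A (Phi (i%:R * a)%R z) ->
  A (Phi (j%:R * a)%R z) -> i = j.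
Hypothesis a0 : (0 <= a)%R.
Variables (n : nat) (Kb : R).
Hypothesis Kb0 : (0 <= Kb)%R.
Hypothesis shift_bound : forall s (f : R -> \bar R), (0 <= s <= n%:R * a)%R ->
  measurable_fun setT f -> (forall r, 0 <= f r) ->
  \int[m]_r f (s + r)%R <= Kb%:E * \int[m]_r f r.

(* The points [Phi (k a) z], k < n, visit [A] at most once, so that [n] times
   the mass of [G ^+ 2] on [A] is at most the total mass, up to the defect of
   invariance of [G]. *)
Lemma mass_visited_once (G : E -> R) : unit_fun G ->
  n%:R%:E * \int[lam]_z (\1_A z * G z ^+ 2)%:E <=
  2%:E * sqnorm G + (n%:R * (4 * Kb + 4))%:E * variance_loss G.
Proof.
move=> uG; have [mG G01 iG] := uG.
have m1A : measurable_fun setT (\1_A : E -> R) by exact: measurable_indic.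
have indic01 z : (0 <= (\1_A z : R) <= 1)%R.
  by rewrite indicE; case: (_ \in _); rewrite ler01 lexx.
have mphi (g : E -> R) s : measurable_fun setT g -> measurable_fun setT (fun z => g (Phi s z)).
  by move=> mg; exact: measurableT_comp mg (measurable_flow1 s).
pose I := \int[lam]_z (\1_A z * G z ^+ 2)%:E.
pose J (k : nat) := \int[lam]_z (\1_A (Phi (k%:R * a)%R z) * G z ^+ 2)%:E.
have mJ k : measurable_fun setT (fun z => \1_A (Phi (k%:R * a)%R z) * G z ^+ 2)%R.
  apply: measurable_funM; last exact: measurable_funX.
  exact: mphi.
have step k : (k < n)%N -> I <= 2%:E * J k + (4 * Kb + 4)%:E * variance_loss G.
  move=> kn; pose s := (k%:R * a)%R.
  have sb : (0 <= s <= n%:R * a)%R.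
    by rewrite mulr_ge0//= ler_wpM2r// ler_nat ltnW.
  apply: (@le_trans _ _ (2%:E * J k +
      2%:E * \int[lam]_z ((G (Phi s z) - G z) ^+ 2)%:E)); last first.
    apply: leeD => //.
    rewrite (_ : (4 * Kb + 4)%R = (2 * (2 * Kb + 2))%R); last by ring.
    by rewrite EFinM -muleA lee_pmul2l// (@sqdist_flow_le _ uG (n%:R * a)%R).
  rewrite /I -(@flow_preserves Phi s (fun z => \1_A z * G z ^+ 2)%R); last 3 first.
  - by apply: measurable_funM => //; exact: measurable_funX.
  - by move=> z; have /andP[? _] := indic01 z; rewrite mulr_ge0 ?sqr_ge0.
  - move=> t z; rewrite iG !indicE.
    by have -> : (tr t z \in A) = (z \in A) by apply/idP/idP; rewrite !inE trA.
  have mD : measurable_fun setT (fun z => (G (Phi s z) - G z) ^+ 2)%R.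
    by apply: measurable_funX; apply: measurable_funB => //; exact: mphi.
  rewrite /J -!ge0_integralM_EFin//; last 2 first.
  - by move=> z; exact: sqr_ge0.
  - by move=> z; have /andP[? _] := indic01 (Phi s z); rewrite mulr_ge0 ?sqr_ge0.
  rewrite -ge0_integralD_EFin//; last 4 first.
  - exact: measurable_funM.
  - exact: measurable_funM.
  - move=> z; have /andP[h _] := indic01 (Phi s z).
    by apply: mulr_ge0 => //; apply: mulr_ge0 => //; exact: sqr_ge0.
  - by move=> z; apply: mulr_ge0 => //; exact: sqr_ge0.
  apply: ge0_le_integral_EFin.
  - by apply: measurable_funM; [exact: mphi|apply: measurable_funX; exact: mphi].
  - by apply: measurable_funD; exact: measurable_funM.
  - by move=> z; have /andP[? _] := indic01 (Phi s z); rewrite mulr_ge0 ?sqr_ge0.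
  - move=> z; rewrite indicE; case: (_ \in _); rewrite /= ?mul0r ?mulr0 ?mul1r.
      exact: sqr_le_double.
    by rewrite add0r mulr_ge0 ?sqr_ge0.
have sumJ : \sum_(k < n) J k <= sqnorm G.
  rewrite /J -ge0_integral_sum//; last 2 first.
  - by move=> k; apply/measurable_EFinP; exact: mJ.
  - move=> k z _; have /andP[? _] := indic01 (Phi (k%:R * a)%R z).
    by rewrite lee_fin mulr_ge0 ?sqr_ge0.
  under eq_integral do rewrite sumEFin.
  apply: ge0_le_integral_EFin.
  - by apply: measurable_sum => k; exact: mJ.
  - exact: measurable_funX.
  - move=> z; apply: sumr_ge0 => k _; have /andP[? _] := indic01 (Phi (k%:R * a)%R z).
    by rewrite mulr_ge0 ?sqr_ge0.
  - move=> z; rewrite -mulr_suml ler_piMl ?sqr_ge0//.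
    have [/existsP[k0 /asboolP k0A]|/existsPn noA] :=
        boolP [exists k : 'I_n, `[< A (Phi (k%:R * a)%R z) >]].
      rewrite (bigD1 k0)//= big1 ?addr0; first by have /andP[] := indic01 (Phi (k0%:R * a)%R z).
      move=> k kk0; rewrite indicE memNset// => kA.
      by move: kk0; rewrite -val_eqE/= (visit kA k0A) eqxx.
    rewrite big1// => k _; rewrite indicE memNset//.
    by have /asboolPn := noA k.
have C0 : (0 <= 4 * Kb + 4)%R by rewrite addr_ge0 ?mulr_ge0.
have l0 := variance_loss_ge0 G.
have J0 k : 0 <= J k.
  apply: integral_EFin_ge0 => z; have /andP[? _] := indic01 (Phi (k%:R * a)%R z).
  by rewrite mulr_ge0 ?sqr_ge0.
have nsum (x : \bar R) : 0 <= x -> n%:R%:E * x = \sum_(k < n) x.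
  move=> x0; elim: {+}n => [|k IHk]; first by rewrite mul0e big_ord0.
  by rewrite big_ord_recr/= -IHk -natr1 EFinD ge0_muleDl ?lee_fin ?mul1e.
have I0 : 0 <= I.
  by apply: integral_EFin_ge0 => z; have /andP[? _] := indic01 z; rewrite mulr_ge0 ?sqr_ge0.
rewrite -/I nsum//.
apply: (@le_trans _ _ (\sum_(k < n) (2%:E * J k + (4 * Kb + 4)%:E * variance_loss G))).
  by apply: lee_sum => k _; exact: step.
rewrite big_split/= -ge0_sume_distrr//.
apply: leeD; first by rewrite lee_pmul2l.
by rewrite -nsum ?mule_ge0// EFinM muleA.
Qed.

End one_set.
End one_flow.
End averaged_shear.

(** * Contraction of the squared norm by three successive averages *)

Local Notation o0 := (@Ordinal 3 0 isT).
Local Notation o1 := (@Ordinal 3 1 isT).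
Local Notation o2 := (@Ordinal 3 2 isT).

Section three_flows.
Local Open Scope ereal_scope.
Context d (E : measurableType d) {R : realType}.
Variable lam : {sigma_finite_measure set E -> \bar R}.
Variable m : probability (R) R.
Variables (K : Type) (tr : K -> E -> E).
Variables (Phi : 'I_3 -> measure_preserving_flow lam tr) (A : 'I_3 -> set E).
Variables (a Kb p : R).
Hypotheses (a0 : (0 <= a)%R) (mA : forall i, measurable (A i)).
Hypothesis trA : forall i k z, A i (tr k z) = A i z.
Hypothesis visit : forall i (j k : nat) z, A i (Phi i (j%:R * a)%R z) ->
  A i (Phi i (k%:R * a)%R z) -> j = k.
Hypothesis Kb0 : (0 <= Kb)%R.
Hypothesis shift_bound : forall s (f : R -> \bar R), (0 <= s <= 20%:R * a)%R ->
  measurable_fun setT f -> (forall r, 0 <= f r) ->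
  \int[m]_r f (s + r)%R <= Kb%:E * \int[m]_r f r.
Hypotheses (p0 : (0 < p)%R) (pb : p%:E <= m `[0%R, (20%:R * a)%R]).

Definition supported (G : E -> R) := forall z, (forall i, ~ A i z) -> G z = 0%R.

Hypothesis cover_flow : forall i s z, (forall j, ~ A j z) -> forall j, ~ A j (Phi i s z).

Lemma averaged_supported i G : supported G -> supported (averaged m (Phi i) G).
Proof.
move=> sG z nA; rewrite /averaged.
have -> : (fun s => G (Phi i s z)) = cst 0%R.
  by apply/funext => s; rewrite sG// => j; exact: cover_flow.
by rewrite Rintegral_cst// mul0r.
Qed.

(** The flow applied last is averaged first: this is the conditional expectation of [G] after one
    cycle, given the starting point. *)
Definition cycle_average (G : E -> R) : E -> R :=
  averaged m (Phi o0) (averaged m (Phi o1) (averaged m (Phi o2) G)).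

(* If the three averages lose little norm, then [G] is nearly invariant under
   the three flows; by [mass_visited_once] with 20 visiting times each [A i]
   then carries a small fraction of the mass of [G], although they cover its
   support. *)
Lemma sqnorm_averaged3_le : exists2 q : R, (0 <= q < 1)%R &
  forall G, unit_fun tr G -> supported G -> sqnorm lam G < +oo ->
  sqnorm lam (cycle_average G) <= q%:E * sqnorm lam G.
Proof.
(* With 20 visiting times each cone mass is at most a tenth of a squared norm plus a multiple of a
   loss. With the weights 1, 2, 2 of [total] below, these tenths add up to half of [N0], so that
   [N0 / 2] is at most [M] times the total loss. Hence the factor [1 - (2 * M)^-1]. *)
pose M : R := (2 * (4 * Kb + 4) + 6 * (4 * Kb + 6) / p)%R.
have M1 : (1 < M)%R.
  have : (0 <= 6 * (4 * Kb + 6) / p)%R.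
    by rewrite divr_ge0 ?(ltW p0)// mulr_ge0// addr_ge0// mulr_ge0.
  by rewrite /M; move: Kb0; lra.
exists (1 - (2 * M)^-1)%R.
  have M0 : (0 < 2 * M)%R by move: M1; lra.
  have i0 : (0 < (2 * M)^-1)%R by rewrite invr_gt0.
  have : ((2 * M)^-1 <= 1)%R by rewrite invf_le1//; move: M1; lra.
  by move: i0; lra.
move=> G uG sG Gfin.
set G3 := averaged m (Phi o2) G.
have uG3 : unit_fun tr G3 by exact: averaged_unit.
set G2 := averaged m (Phi o1) G3.
have uG2 : unit_fun tr G2 by exact: averaged_unit.
set G1 := averaged m (Phi o0) G2.
have eq3 := sqnorm_averagedD m (Phi o2) uG; rewrite -/G3 in eq3.
have eq2 := sqnorm_averagedD m (Phi o1) uG3; rewrite -/G2 in eq2.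
have eq1 := sqnorm_averagedD m (Phi o0) uG2; rewrite -/G1 in eq1.
have mass3 := mass_visited_once (mA o2) (@trA o2) (@visit o2) a0 Kb0 shift_bound uG.
have mass2 := mass_visited_once (mA o1) (@trA o1) (@visit o1) a0 Kb0 shift_bound uG3.
have mass1 := mass_visited_once (mA o0) (@trA o0) (@visit o0) a0 Kb0 shift_bound uG2.
have dist3 := sqdist_averaged_le (Phi o2) uG Kb0 shift_bound pb.
have dist2 := sqdist_averaged_le (Phi o1) uG3 Kb0 shift_bound pb.
have {Gfin} [N0 N0E] : exists r : R, sqnorm lam G = r%:E.
  by exists (fine (sqnorm lam G)); rewrite fineK// ge0_fin_numE// sqnorm_ge0.
rewrite N0E in eq3 mass3 *.
have fin2 (x y : \bar R) (r : R) : 0 <= x -> 0 <= y -> x + y = r%:E ->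
    exists x' y' : R, [/\ x = x'%:E, y = y'%:E & (x' + y' = r)%R].
  case: x => [x| |]//; case: y => [y| |]// _ _ [<-].
  by exists x, y.
have [l3 [N3 [l3E N3E e3E]]] := fin2 _ _ _ (variance_loss_ge0 _ _ _) (sqnorm_ge0 _ _) eq3.
rewrite N3E in eq2 mass2.
have [l2 [N2 [l2E N2E e2E]]] := fin2 _ _ _ (variance_loss_ge0 _ _ _) (sqnorm_ge0 _ _) eq2.
rewrite N2E in eq1 mass1.
have [l1 [N1 [l1E N1E e1E]]] := fin2 _ _ _ (variance_loss_ge0 _ _ _) (sqnorm_ge0 _ _) eq1.
have l3_0 : (0 <= l3)%R by rewrite -lee_fin -l3E variance_loss_ge0.
have l2_0 : (0 <= l2)%R by rewrite -lee_fin -l2E variance_loss_ge0.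
have l1_0 : (0 <= l1)%R by rewrite -lee_fin -l1E variance_loss_ge0.
have N1_0 : (0 <= N1)%R by rewrite -lee_fin -N1E sqnorm_ge0.
rewrite l3E in mass3 dist3; rewrite l2E in mass2 dist2; rewrite l1E in mass1.
have fin1 (x : \bar R) (k r : R) : (0 < k)%R -> 0 <= x -> k%:E * x <= r%:E ->
    exists2 x' : R, x = x'%:E & (k * x' <= r)%R.
  move=> k0; case: x => [x| |]//.
    by rewrite -EFinM !lee_fin => _ h; exists x.
  by rewrite gt0_muley ?lte_fin.
have pos20 : (0 < 20%:R :> R)%R by [].
have mass_ge0 i (H : E -> R) : 0 <= \int[lam]_z (\1_(A i) z * H z ^+ 2)%:E.
  apply: integral_EFin_ge0 => z; apply: mulr_ge0; last exact: sqr_ge0.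
  by rewrite indicE.
have dist_ge0 (H H' : E -> R) : 0 <= \int[lam]_z ((H z - H' z) ^+ 2)%:E.
  by apply: integral_EFin_ge0 => z; exact: sqr_ge0.
rewrite -!EFinM -EFinD in mass3 mass2 mass1.
rewrite -!EFinM in dist3 dist2.
have [m3 m3E {}mass3] := fin1 _ _ _ pos20 (mass_ge0 _ _) mass3.
have [m2 m2E {}mass2] := fin1 _ _ _ pos20 (mass_ge0 _ _) mass2.
have [m1 m1E {}mass1] := fin1 _ _ _ pos20 (mass_ge0 _ _) mass1.
have [e3 e3E' {}dist3] := fin1 _ _ _ p0 (dist_ge0 _ _) dist3.
have [e2 e2E' {}dist2] := fin1 _ _ _ p0 (dist_ge0 _ _) dist2.
have [[mG G01 _] [mG3 _ _] [mG2 _ _]] := And3 uG uG3 uG2.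
(* The inequality holds pointwise before integration. On [A o2] the function [G] is kept, on [A o1]
   it is replaced by [G3], and on [A o0] by [G2], where the error [G - G2] is split into [G - G3]
   and [G3 - G2]. Off the three sets [G] vanishes. *)
have total : (N0 <= m3 + (2 * m2 + (2 * m1 + (6 * e3 + 4 * e2))))%R.
  rewrite -lee_fin -N0E !EFinD !EFinM -m3E -m2E -m1E -e3E' -e2E'.
  have mi (i : 'I_3) (H : E -> R) : measurable_fun setT H ->
      measurable_fun setT (fun z => \1_(A i) z * H z ^+ 2)%R.
    by move=> mH; apply: measurable_funM; [exact: measurable_indic|exact: measurable_funX].
  have md (H H' : E -> R) : measurable_fun setT H -> measurable_fun setT H' ->
      measurable_fun setT (fun z => (H z - H' z) ^+ 2)%R.
    by move=> mH mH'; apply: measurable_funX; exact: measurable_funB.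
  have mi0 (i : 'I_3) (H : E -> R) z : (0 <= \1_(A i) z * H z ^+ 2)%R.
    by apply: mulr_ge0; [rewrite indicE|exact: sqr_ge0].
  have [mm3 mm2 mm1] := And3 (mi o2 _ mG) (mi o1 _ mG3) (mi o0 _ mG2).
  have [md3 md2] := conj (md _ _ mG mG3) (md _ _ mG3 mG2).
  have mZ (k : R) (H : E -> R) : measurable_fun setT H ->
      measurable_fun setT (fun z => k * H z)%R.
    by move=> mH; exact: measurable_funM.
  rewrite -!ge0_integralM_EFin//; try by move=> z; exact: sqr_ge0.
  have i0 i z : (0 <= (\1_(A i) z : R))%R by rewrite indicE.
  do 4! [rewrite -ge0_integralD_EFin//;
    try by [exact: mZ | do !apply: measurable_funD => //; exact: mZ
      | move=> z; do ![exact: i0 | exact: sqr_ge0 | apply: addr_ge0 | apply: mulr_ge0]]].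
  apply: ge0_le_integral_EFin.
  - exact: measurable_funX.
  - by do !apply: measurable_funD => //; exact: mZ.
  - by move=> z; exact: sqr_ge0.
  move=> z.
  rewrite -/G3 -/G2.
  have s1 := sqr_ge0 (G z - G3 z)%R; have s2 := sqr_ge0 (G3 z - G2 z)%R.
  have t3 := mi0 o2 G z; have t2 := mi0 o1 G3 z; have t1 := mi0 o0 G2 z.
  have [A2z|nA2] := pselect (A o2 z).
    by move: t2 t1 s1 s2; rewrite [in X in (_ <= X + _)%R]indicE mem_set//=; lra.
  have [A1z|nA1] := pselect (A o1 z).
    have := sqr_le_double (G z) (G3 z).
    by move: t3 t1 s1 s2; rewrite [in X in (_ <= _ + (2 * X + _))%R]indicE mem_set//=; lra.
  have [A0z|nA0] := pselect (A o0 z).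
    have := sqr_le_double (G z) (G2 z).
    have := sqr_ge0 ((G z - G3 z) - (G3 z - G2 z))%R.
    move: t3 t2 s1 s2; rewrite [in X in (_ <= _ + (_ + (2 * X + _)))%R]indicE mem_set//=.
    by nra.
  rewrite [in leLHS]sG; last first.
    by case; case=> [|[|[|//]]] i3; [rewrite (_ : Ordinal _ = o0)|
      rewrite (_ : Ordinal _ = o1)|rewrite (_ : Ordinal _ = o2)] => //; exact: val_inj.
  by move: t3 t2 t1 s1 s2; lra.
rewrite N1E -EFinM lee_fin.
have {}dist3 : (e3 <= (4 * Kb + 6) / p * l3)%R.
  by rewrite mulrAC ler_pdivlMr// mulrC.
have {}dist2 : (e2 <= (4 * Kb + 6) / p * l2)%R.
  by rewrite mulrAC ler_pdivlMr// mulrC.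
have M0 : (0 < 2 * M)%R by move: M1; lra.
rewrite mulrBl mul1r lerBrDr -lerBrDl mulrC ler_pdivrMr//.
have C0 : (0 <= (4 * Kb + 6) / p)%R.
  by rewrite divr_ge0 ?(ltW p0)// addr_ge0// mulr_ge0.
move: total mass3 mass2 mass1 dist3 dist2 C0 e1E e2E e3E; rewrite /M.
rewrite -[(6 * _ / p)%R]mulrA.
set C := ((4 * Kb + 6) / p)%R.
move=> total mass3 mass2 mass1 dist3 dist2 C0 e1E e2E e3E.
have C1 := mulr_ge0 C0 l1_0; have C2 := mulr_ge0 C0 l2_0.
have K1 := mulr_ge0 Kb0 l1_0; have K2 := mulr_ge0 Kb0 l2_0; have K3 := mulr_ge0 Kb0 l3_0.
have -> : N1 = (N0 - l3 - l2 - l1)%R by lra.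
rewrite (_ : N0 - (N0 - l3 - l2 - l1) = l1 + l2 + l3)%R; last by ring.
have {}e2E : (N2 = N0 - l3 - l2)%R by lra.
have {}e3E : (N3 = N0 - l3)%R by lra.
rewrite e2E in mass1; rewrite e3E in mass2.
by nra.
Qed.

Lemma cycle_average_unit G : unit_fun tr G -> unit_fun tr (cycle_average G).
Proof. by move=> uG; do 3 apply: averaged_unit. Qed.

Lemma cycle_average_supported G : supported G -> supported (cycle_average G).
Proof. by move=> sG; do 3 apply: averaged_supported. Qed.

Lemma iter_cycle_average (q : R) n G : (0 <= q < 1)%R ->
  (forall H, unit_fun tr H -> supported H -> sqnorm lam H < +oo ->
    sqnorm lam (cycle_average H) <= q%:E * sqnorm lam H) ->
  unit_fun tr G -> supported G -> sqnorm lam G < +oo ->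
  [/\ unit_fun tr (iter n cycle_average G), supported (iter n cycle_average G) &
      sqnorm lam (iter n cycle_average G) <= (q ^+ n)%:E * sqnorm lam G].
Proof.
move=> /andP[q0 q1] contraction uG sG fG.
elim: n => [|n [uGn sGn IHn]] /=; first by rewrite expr0 mul1e.
split; [exact: cycle_average_unit|exact: cycle_average_supported|].
apply: (@le_trans _ _ (q%:E * sqnorm lam (iter n cycle_average G))).
  apply: contraction => //; apply: le_lt_trans IHn _.
  by rewrite lte_mul_pinfty ?lee_fin ?exprn_ge0.
by rewrite exprS EFinM -muleA lee_wpmul2l ?lee_fin.
Qed.

End three_flows.

(** * Integration over the torus *)

Section translation_invariance.
Local Open Scope ereal_scope.
Context {R : realType}.
Local Notation mu := (@lebesgue_measure R).
Local Notation borelR := (measurableTypeR R).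

Lemma measurable_shift (c : R) : measurable_fun setT (fun t : borelR => (t + c)%R : borelR).
Proof. exact: measurable_funD. Qed.

Lemma lebesgue_measure_translation (c : R) (A : set R) : measurable A ->
  pushforward mu (fun t : borelR => (t + c)%R : borelR) A = mu A.
Proof.
move=> mA.
suff ocitvE X : ocitv X -> mu X = pushforward mu (fun t : borelR => (t + c)%R : borelR) X.
  apply/esym; apply: lebesgue_measure_unique ocitvE _ mA.
  exact: measurable_shift.
move=> [[x y]] _ <-.
rewrite /pushforward [X in _ = mu X](_ : _ = `](x - c)%R, (y - c)%R]%classic); last first.
  by apply/seteqP; split => t /=; rewrite !in_itv/= ltrBlDr lerBrDr.
rewrite !lebesgue_measure_itv/= !lte_fin ltrD2r.
by case: ifPn => // _; rewrite -!EFinD; congr (_%:E); ring.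
Qed.

Lemma ge0_integral_translation (c : R) (D : set R) (g : R -> \bar R) :
  measurable D -> measurable_fun setT g -> (forall t, 0 <= g t) ->
  \int[mu]_(t in [set t | D (t + c)%R]) g (t + c)%R = \int[mu]_(t in D) g t.
Proof.
move=> mD mg g0.
rewrite -[LHS](ge0_integral_pushforward (measurable_shift c) mu mD (f := g)) //.
- apply: eq_measure_integral; first exact: measurable_shift.
  by move=> ? A mA _; exact: lebesgue_measure_translation.
- exact: measurable_funTS.
Qed.

Lemma ge0_integral_translationT (c : R) (g : R -> \bar R) :
  measurable_fun setT g -> (forall t, 0 <= g t) ->
  \int[mu]_t g (t + c)%R = \int[mu]_t g t.
Proof. by move=> mg g0; rewrite -(ge0_integral_translation c measurableT mg g0). Qed.

Section mrestr_integral.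
Context d (T : measurableType d) (nu : {measure set T -> \bar R}).
Variables (D : set T) (mD : measurable D).

Lemma ge0_integral_mrestr (g : T -> \bar R) : measurable_fun setT g -> (forall t, 0 <= g t) ->
  \int[mrestr nu mD]_t g t = \int[nu]_(t in D) g t.
Proof.
move=> mg g0.
rewrite [LHS](ge0_negligible_integral (N := ~` D))//; last 2 first.
- exact: measurableC.
- by rewrite /= /mrestr setICl measure0.
rewrite setTD setCK; apply: eq_measure_integral => A mA AD.
by rewrite /= /mrestr setIidl.
Qed.

End mrestr_integral.

Variable p : R.
Hypothesis p_gt0 : (0 < p)%R.

Lemma periodic_int (V : Type) (g : R -> V) : (forall t, g (t + p)%R = g t) ->
  forall (k : int) t, g (t + k%:~R * p)%R = g t.
Proof.
move=> gp; have gn (n : nat) t : g (t + n%:R * p)%R = g t.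
  elim: n t => [|n IHn] t; first by rewrite mul0r addr0.
  by rewrite -natr1 mulrDl mul1r addrA gp IHn.
case=> n t; first exact: gn.
rewrite NegzE -[LHS](gn n.+1) mulrNz mulNr.
by rewrite (_ : n.+1%:~R = n.+1%:R)%R// addrNK.
Qed.

(** Modulo the period, [c] becomes some [b] in [0, p[. Cutting [0, p[ at [p - b], the translation
    exchanges the two pieces, one of them up to a period. *)
Lemma integral_period_translation (c : R) (g : R -> \bar R) :
  measurable_fun setT g -> (forall t, 0 <= g t) -> (forall t, g (t + p)%R = g t) ->
  \int[mu]_(t in `[0%R, p[) g (t + c)%R = \int[mu]_(t in `[0%R, p[) g t.
Proof.
move=> mg g0 gp.
pose k := Num.floor (c / p); pose b := (c - k%:~R * p)%R.
have [b0 bp] : (0 <= b)%R /\ (b < p)%R.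
  have /andP[] := floor_itv (c / p)%R; rewrite -/k ler_pdivlMr// ltr_pdivrMr//.
  by rewrite /b intrD mulrDl mul1r => ? ?; split; lra.
have -> : \int[mu]_(t in `[0%R, p[) g (t + c)%R = \int[mu]_(t in `[0%R, p[) g (t + b)%R.
  have gcb t : g (t + c)%R = g (t + b)%R.
    by rewrite -(periodic_int gp k (t + b)%R) /b; congr g; ring.
  by apply: eq_integral => t _; rewrite gcb.
have mgb : measurable_fun setT (fun t : R => g (t + b)%R).
  exact: measurableT_comp mg (measurable_shift b).
have split_at x : (0 <= x <= p)%R -> forall f : R -> \bar R,
    measurable_fun setT f -> (forall t, 0 <= f t) ->
    \int[mu]_(t in `[0%R, p[) f t =
    \int[mu]_(t in `[0%R, x[) f t + \int[mu]_(t in `[x, p[) f t.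
  move=> /andP[x0 xp] f mf f0.
  rewrite -ge0_integral_setU//.
  - by rewrite -itv_bndbnd_setU.
  - exact: measurable_funTS.
  - apply/disj_set2P; rewrite -subset0 => t [] /=; rewrite !in_itv/=.
    by move=> /andP[_ tx] /andP[xt _]; move: tx; rewrite ltNge xt.
rewrite (split_at (p - b)%R _ (fun t : R => g (t + b)%R))//; last first.
  by rewrite subr_ge0 (ltW bp) lerBlDr lerDl b0.
rewrite (split_at b _ g)//; last by rewrite b0 ltW.
rewrite addeC; congr (_ + _).
- rewrite -(ge0_integral_translation (b - p)%R (D := `[0%R, b[%classic) _ mg g0)//.
  rewrite [in RHS](_ : [set t | _] = `[(p - b)%R, p[%classic); last first.
    by apply/seteqP; split => t /=; rewrite !in_itv/= => /andP[? ?]; apply/andP; split; lra.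
  have gbp t : g (t + b)%R = g (t + (b - p))%R by rewrite -[RHS]gp; congr g; ring.
  by apply: eq_integral => t _; rewrite gbp.
- rewrite -(ge0_integral_translation b (D := `[b, p[%classic) _ mg g0)//.
  rewrite [in RHS](_ : [set t | _] = `[0%R, (p - b)%R[%classic)//.
  by apply/seteqP; split => t /=; rewrite !in_itv/= => /andP[? ?]; apply/andP; split; lra.
Qed.

End translation_invariance.

Section period_measure.
Local Open Scope ereal_scope.
Context {R : realType} (p : R).
Local Notation mu := (@lebesgue_measure R).

(** Stands for the length measure of the circle. As a finite measure on the whole line it can be
    multiplied and used in Tonelli without carrying domains of integration. *)
Definition period_measure := mrestr mu (measurable_itv `[0, p[%R).
HB.instance Definition _ := Measure.on period_measure.

Let period_finite : fin_num_fun period_measure.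
Proof.
move=> A mA; rewrite ge0_fin_numE//; apply: (@le_lt_trans _ _ (mu `[0%R, p[)).
  by rewrite /period_measure/mrestr; apply: le_measure; rewrite ?inE//=; exact: measurableI.
by rewrite /= lebesgue_measure_itv/=; case: ifPn => // _; rewrite -EFinD ltry.
Qed.
HB.instance Definition _ := @Measure_isFinite.Build _ _ _ period_measure period_finite.

End period_measure.

(* MathComp-Analysis loses the canonical sigma-finite structure of [m1 \x m2]
   (it is shadowed by that of products of probabilities), hence this alias. *)
Section sigma_finite_product.
Local Open Scope ereal_scope.
Context d1 d2 (T1 : measurableType d1) (T2 : measurableType d2) (R : realType).
Variable m1 : {sigma_finite_measure set T1 -> \bar R}.
Variable m2 : {sigma_finite_measure set T2 -> \bar R}.

Definition sfprod : set (T1 * T2) -> \bar R := m1 \x m2.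
HB.instance Definition _ := Measure.on sfprod.

Let sfprod_sigma_finite : sigma_finite setT sfprod.
Proof.
by have [] :=
  lebesgue_integral_fubini.measure_function_Measure_isSigmaFinite__to__measure_function_isSigmaFinite
    m1 m2.
Qed.

HB.instance Definition _ := Measure_isSigmaFinite.Build _ _ _ sfprod sfprod_sigma_finite.

Variable f : T1 * T2 -> \bar R.
Hypotheses (mf : measurable_fun setT f) (f0 : forall x, 0 <= f x).

Lemma sfprod_tonelli1 : \int[sfprod]_z f z = \int[m1]_x \int[m2]_y f (x, y).
Proof. exact: (fubini_tonelli1 (m1 := m1) (m2 := m2)). Qed.

Lemma sfprod_tonelli2 : \int[sfprod]_z f z = \int[m2]_y \int[m1]_x f (x, y).
Proof. exact: (fubini_tonelli2 (m1 := m1) (m2 := m2)). Qed.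

Lemma measurable_integral_fst : measurable_fun setT (fun x => \int[m2]_y f (x, y)).
Proof. exact: (measurable_fun_fubini_tonelli_F (m2 := m2)). Qed.

Lemma measurable_integral_snd : measurable_fun setT (fun y => \int[m1]_x f (x, y)).
Proof. exact: (measurable_fun_fubini_tonelli_G (m1 := m1)). Qed.

End sigma_finite_product.

(** * Preservation of volume by shears *)

Section shear_invariance.
Local Open Scope ereal_scope.
Context {R : realType}.
Local Notation borelR := (measurableTypeR R).
Local Notation borelR3 := (borelR * borelR * borelR)%type.
Variable m : {sigma_finite_measure set borelR -> \bar R}.

Definition cube_measure : {sigma_finite_measure set borelR3 -> \bar R} :=
  sfprod (sfprod m m) m.

(** The three shears are conjugate under this cyclic permutation, so that only the one driven by the
    third coordinate is studied. *)
Definition rot (V : Type) (x : V * V * V) : V * V * V := (x.2, x.1.1, x.1.2).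

Lemma measurable_rot : measurable_fun setT (@rot borelR).
Proof.
apply: measurable_fun_pair; first apply: measurable_fun_pair.
- exact: measurable_snd.
- exact: measurableT_comp measurable_fst measurable_fst.
- exact: measurableT_comp measurable_snd measurable_fst.
Qed.

Lemma ge0_integral_cube (g : borelR3 -> \bar R) :
  measurable_fun setT g -> (forall x, 0 <= g x) ->
  \int[cube_measure]_x g x =
  \int[m]_x1 \int[m]_x2 \int[m]_x3 g (x1, x2, x3).
Proof.
move=> mg g0.
rewrite sfprod_tonelli1// sfprod_tonelli1//.
- exact: measurable_integral_fst.
- by move=> x; exact: integral_ge0.
Qed.

Lemma ge0_integral_cube_swap (g : borelR3 -> \bar R) :
  measurable_fun setT g -> (forall x, 0 <= g x) ->
  \int[cube_measure]_x g x =
  \int[m]_x3 \int[m]_x1 \int[m]_x2 g (x1, x2, x3).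
Proof.
move=> mg g0.
rewrite sfprod_tonelli2//.
apply: eq_integral => x3 _.
rewrite (@sfprod_tonelli1 _ _ _ _ _ m m (fun x12 => g (x12, x3)))//.
exact: measurableT_comp mg (pair2_measurable x3).
Qed.

Lemma ge0_integral_rot (g : borelR3 -> \bar R) :
  measurable_fun setT g -> (forall x, 0 <= g x) ->
  \int[cube_measure]_x g (rot x) = \int[cube_measure]_x g x.
Proof.
move=> mg g0; rewrite ge0_integral_cube_swap//; last exact: measurableT_comp mg measurable_rot.
by rewrite ge0_integral_cube.
Qed.

(** This depends on the function as well as on the measure: it holds for nonnegative measurable
    functions under Lebesgue measure, and for the periodic ones under [period_measure]. One shear
    lemma can then serve both positions and vectors. *)
Definition translation_invariant (f : R -> \bar R) :=
  forall c : R, \int[m]_t f (t + c)%R = \int[m]_t f t.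

(** For fixed third coordinate a shear is a translation of the first two; Tonelli is applied with
    the third variable outermost. *)
Lemma ge0_integral_shear (a b : R -> R) (g : borelR3 -> \bar R) :
  measurable_fun setT a -> measurable_fun setT b ->
  measurable_fun setT g -> (forall x, 0 <= g x) ->
  (forall x2 x3, translation_invariant (fun t => g (t, x2, x3))) ->
  (forall x1 x3, translation_invariant (fun t => g (x1, t, x3))) ->
  \int[cube_measure]_x g (x.1.1 + a x.2, x.1.2 + b x.2, x.2)%R = \int[cube_measure]_x g x.
Proof.
move=> ma mb mg g0 tr1 tr2.
have mcomp (h1 h2 h3 : borelR * borelR -> borelR) : measurable_fun setT h1 ->
    measurable_fun setT h2 -> measurable_fun setT h3 ->
    measurable_fun setT (fun y => g (h1 y, h2 y, h3 y)).
  move=> mh1 mh2 mh3; apply: measurableT_comp mg _.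
  by apply: measurable_fun_pair => //; exact: measurable_fun_pair.
rewrite ge0_integral_cube_swap//=; last first.
  apply: measurableT_comp mg _; apply: measurable_fun_pair; first apply: measurable_fun_pair.
  - apply: measurable_funD; first exact: measurableT_comp measurable_fst measurable_fst.
    exact: measurableT_comp ma measurable_snd.
  - apply: measurable_funD; first exact: measurableT_comp measurable_snd measurable_fst.
    exact: measurableT_comp mb measurable_snd.
  - exact: measurable_snd.
rewrite [RHS](ge0_integral_cube_swap mg g0).
apply: eq_integral => x3 _.
under eq_integral => x1 _ do rewrite (tr2 _ _ (b x3)).
rewrite (fubini_tonelli (m1 := m) (m2 := m) (fun y => g (y.1 + a x3, y.2, x3)%R))//=; last first.
  by apply: mcomp => //; exact: measurable_funD.
under eq_integral => x2 _ do rewrite (tr1 _ _ (a x3)).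
rewrite (fubini_tonelli (m1 := m) (m2 := m) (fun y => g (y.1, y.2, x3)%R))//=.
exact: mcomp.
Qed.

End shear_invariance.

Lemma period_translation_invariant (R : realType) (p : R) (g : R -> \bar R) : (0 < p)%R ->
  measurable_fun setT g -> (forall t, (0 <= g t)%E) -> (forall t, g (t + p)%R = g t) ->
  translation_invariant (period_measure p) g.
Proof.
move=> p0 mg g0 gp c.
have mgc : measurable_fun setT (fun t : R => g (t + c)%R).
  exact: measurableT_comp mg (measurable_shift c).
apply: (etrans (ge0_integral_mrestr lebesgue_measure (measurable_itv `[0, p[%R) mgc
  (fun t => g0 (t + c)%R))).
apply: (etrans (integral_period_translation p0 c mg g0 gp)); apply/esym.
exact: (ge0_integral_mrestr lebesgue_measure (measurable_itv `[0, p[%R) mg g0).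
Qed.

(** * Lifted shears *)

Section lifted_shear.
Context {R : realType}.
Local Notation borelR := (measurableTypeR R).
Local Notation borelR3 := (borelR * borelR * borelR)%type.
Local Notation E := (borelR3 * borelR3)%type.
Local Notation mu := (@lebesgue_measure R).
Implicit Types (x v : R * R * R) (z : (R * R * R) * (R * R * R)).
Variable p : R.
Hypothesis p_gt0 : 0 < p.

Definition phase_measure : {sigma_finite_measure set E -> \bar R} :=
  sfprod (cube_measure (period_measure p)) (cube_measure mu).

(** Each coordinate moves by no period or by one. These shifts include generators of the lattice, so
    that invariance under them is periodicity. *)
Definition lattice_shift (k : bool * bool * bool) x : R * R * R :=
  (x.1.1 + p *+ k.1.1, x.1.2 + p *+ k.1.2, x.2 + p *+ k.2).

Definition phase_shift (k : bool * bool * bool) z := (lattice_shift k z.1, z.2).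

Definition rotz z := (rot z.1, rot z.2).

Definition shear (f g : R -> R) (t : R) x : R * R * R :=
  (x.1.1 + t * f x.2, x.1.2 + t * g x.2, x.2).

Definition dshear (f g : R -> R) (t : R) x v : R * R * R :=
  (v.1.1 + t * f x.2 * v.2, v.1.2 + t * g x.2 * v.2, v.2).

(** For g = f' and h = f'' the vector component is transported by the differential of the shear of
    positions. Preservation of measure does not use this relation, and the three functions are kept
    independent. *)
Definition lshear (f g h : R -> R) (t : R) z :=
  (shear f g t z.1, dshear g h t z.1 z.2).

Lemma rot3 V (x : V * V * V) : rot (rot (rot x)) = x.
Proof. by case: x => -[x1 x2] x3. Qed.

Lemma rotz3 z : rotz (rotz (rotz z)) = z.
Proof. by rewrite /rotz /= !rot3; case: z. Qed.

Lemma rotz_shift k z : rotz (phase_shift k z) = phase_shift (rot k) (rotz z).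
Proof. by []. Qed.

Lemma measurable_rotz : measurable_fun setT (rotz : E -> E).
Proof.
apply: measurable_fun_pair.
- exact: measurableT_comp (@measurable_rot R) measurable_fst.
- exact: measurableT_comp (@measurable_rot R) measurable_snd.
Qed.

Lemma phase_integral (g : E -> \bar R) : measurable_fun setT g ->
  (forall z, 0 <= g z)%E ->
  (\int[phase_measure]_z g z =
   \int[cube_measure (period_measure p)]_x \int[cube_measure mu]_v g (x, v))%E.
Proof. by move=> mg g0; exact: sfprod_tonelli1. Qed.

Lemma integral_rotz (g : E -> \bar R) : measurable_fun setT g ->
  (forall z, 0 <= g z)%E ->
  (\int[phase_measure]_z g (rotz z) = \int[phase_measure]_z g z)%E.
Proof.
move=> mg g0.
apply: (etrans (phase_integral (measurableT_comp mg measurable_rotz) (fun z => g0 (rotz z)))).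
apply/esym; apply: (etrans (phase_integral mg g0)); apply/esym.
have mgx (x : borelR3) : measurable_fun setT (fun v : borelR3 => g (x, v)).
  exact: measurableT_comp mg (pair1_measurable x).
transitivity (\int[cube_measure (period_measure p)]_x
    \int[cube_measure mu]_v g (rot x, v))%E.
  apply: eq_integral => x _.
  exact: (@ge0_integral_rot _ mu (fun v => g (rot x, v))).
apply: (ge0_integral_rot (period_measure p)
  (g := fun x => (\int[cube_measure mu]_v g (x, v))%E)).
- exact: measurable_integral_fst.
- by move=> x; exact: integral_ge0.
Qed.

Section one_shear.
Variables f g h : R -> R.
Hypotheses (mf : measurable_fun setT f) (mg : measurable_fun setT g)
  (mh : measurable_fun setT h).
Hypotheses (pf : periodic f p) (pg : periodic g p) (ph : periodic h p).

Let proj1 : measurable_fun setT (fun y : borelR3 => y.1.1).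
Proof. exact: measurableT_comp measurable_fst measurable_fst. Qed.
Let proj2 : measurable_fun setT (fun y : borelR3 => y.1.2).
Proof. exact: measurableT_comp measurable_snd measurable_fst. Qed.
Let proj3 : measurable_fun setT (fun y : borelR3 => y.2).
Proof. exact: measurable_snd. Qed.

Lemma measurable_lshear :
  measurable_fun setT (fun q : E * R => lshear f g h q.2 q.1 : E).
Proof.
have mx : measurable_fun setT (fun q : E * R => q.1.1).
  exact: measurableT_comp measurable_fst measurable_fst.
have mv : measurable_fun setT (fun q : E * R => q.1.2).
  exact: measurableT_comp measurable_snd measurable_fst.
have mt : measurable_fun setT (fun q : E * R => q.2) by exact: measurable_snd.
have mx3 (k : R -> R) : measurable_fun setT k ->
    measurable_fun setT (fun q : E * R => k q.1.1.2).
  by move=> mk; apply: measurableT_comp mk _; exact: measurableT_comp proj3 mx.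
apply: measurable_fun_pair; apply: measurable_fun_pair.
- apply: measurable_fun_pair; apply: measurable_funD.
  + exact: measurableT_comp proj1 mx.
  + by apply: measurable_funM => //; exact: mx3.
  + exact: measurableT_comp proj2 mx.
  + by apply: measurable_funM => //; exact: mx3.
- exact: measurableT_comp proj3 mx.
- apply: measurable_fun_pair; apply: measurable_funD.
  + exact: measurableT_comp proj1 mv.
  + by do 2?apply: measurable_funM => //; [exact: mx3|exact: measurableT_comp proj3 mv].
  + exact: measurableT_comp proj2 mv.
  + by do 2?apply: measurable_funM => //; [exact: mx3|exact: measurableT_comp proj3 mv].
- exact: measurableT_comp proj3 mv.
Qed.

Lemma shearD f' g' s t x : shear f' g' (s + t) x = shear f' g' s (shear f' g' t x).
Proof. by rewrite /shear/=; congr (_, _, _); ring. Qed.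

Lemma lshearD s t z : lshear f g h (s + t) z = lshear f g h s (lshear f g h t z).
Proof. by rewrite /lshear/= shearD /dshear/=; congr (_, (_, _, _)); ring. Qed.

Lemma periodic_shift (k : R -> R) (b : bool) t : periodic k p -> k (t + p *+ b) = k t.
Proof. by move=> pk; case: b; rewrite ?addr0//=. Qed.

Lemma lshear_shift s k z :
  lshear f g h s (phase_shift k z) = phase_shift k (lshear f g h s z).
Proof.
rewrite /lshear /phase_shift /lattice_shift /shear /dshear/= !periodic_shift//.
by congr ((_, _, _), _); ring.
Qed.

Lemma integral_shear s (H : borelR3 -> \bar R) : measurable_fun setT H ->
  (forall x, (0 <= H x)%E) -> invariant_fun lattice_shift H ->
  (\int[cube_measure (period_measure p)]_x H (shear f g s x) =
   \int[cube_measure (period_measure p)]_x H x)%E.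
Proof.
move=> mH H0 Hshift.
have ma : measurable_fun setT (fun x3 : borelR => s * f x3) by exact: measurable_funM.
have mb : measurable_fun setT (fun x3 : borelR => s * g x3) by exact: measurable_funM.
have t1 : forall x2 x3 : R, translation_invariant (period_measure p) (fun t : R => H (t, x2, x3)).
  move=> x2 x3.
  have mH1 : measurable_fun setT (fun t : R => H (t, x2, x3)).
    apply: measurableT_comp mH _.
    by apply: measurable_fun_pair => //; exact: measurable_fun_pair.
  apply: (period_translation_invariant p_gt0 mH1) => // t.
  by rewrite -[RHS](Hshift (true, false, false))/= /lattice_shift/= !addr0.
have t2 : forall x1 x3 : R, translation_invariant (period_measure p) (fun t : R => H (x1, t, x3)).
  move=> x1 x3.
  have mH1 : measurable_fun setT (fun t : R => H (x1, t, x3)).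
    apply: measurableT_comp mH _.
    by apply: measurable_fun_pair => //; exact: measurable_fun_pair.
  apply: (period_translation_invariant p_gt0 mH1) => // t.
  by rewrite -[RHS](Hshift (false, true, false))/= /lattice_shift/= !addr0.
have := ge0_integral_shear ma mb mH H0 t1 t2.
by [].
Qed.

(** Over a fixed position the vectors undergo a linear shear, which preserves Lebesgue measure.
    Integrating them out leaves the periodic function [H] of the position, to which the shear of the
    torus applies. *)
Lemma lshear_preserves s (G : E -> R) : measurable_fun setT G ->
  (forall z, 0 <= G z) -> invariant_fun phase_shift G ->
  (\int[phase_measure]_z (G (lshear f g h s z))%:E = \int[phase_measure]_z (G z)%:E)%E.
Proof.
move=> mG G0 iG.
have mG' : measurable_fun setT (EFin \o G) by exact/measurable_EFinP.
have G0' z : (0 <= (EFin \o G) z)%E by rewrite lee_fin.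
have mL : measurable_fun setT (lshear f g h s : E -> E).
  exact: measurableT_comp measurable_lshear (pair2_measurable s).
apply: (etrans (phase_integral (measurableT_comp mG' mL) (fun z => G0' (lshear f g h s z)))).
apply/esym; apply: (etrans (phase_integral mG' G0')); apply/esym.
have mGx (x : borelR3) : measurable_fun setT (fun v : borelR3 => (G (x, v))%:E).
  exact: measurableT_comp mG' (pair1_measurable x).
pose H (x : borelR3) := (\int[cube_measure mu]_v (G (x, v))%:E)%E.
have mH : measurable_fun setT H.
  by apply: (measurable_integral_fst (cube_measure mu) mG').
have H0 x : (0 <= H x)%E by apply: integral_ge0 => v _; rewrite lee_fin.
have Hshift k x : H (lattice_shift k x) = H x.
  by apply: eq_integral => v _; rewrite -[in RHS](iG k).
have fiber (x : R * R * R) :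
    (\int[cube_measure mu]_v (G (lshear f g h s (x, v)))%:E = H (shear f g s x))%E.
  have mGs := mGx (shear f g s x).
  have ma : measurable_fun setT (fun v3 : borelR => s * g x.2 * v3) by exact: measurable_funM.
  have mb : measurable_fun setT (fun v3 : borelR => s * h x.2 * v3) by exact: measurable_funM.
  have t1 : forall y2 y3 : R, translation_invariant mu (fun y1 : R => (G (shear f g s x, (y1, y2, y3)))%:E).
    move=> y2 y3 c.
    apply: (ge0_integral_translationT c (g := fun y1 : R => (G (shear f g s x, (y1, y2, y3)))%:E)).
      apply: measurableT_comp mGs _.
      by apply: measurable_fun_pair => //; exact: measurable_fun_pair.
    by move=> ?; exact: G0'.
  have t2 : forall y1 y3 : R, translation_invariant mu (fun y2 : R => (G (shear f g s x, (y1, y2, y3)))%:E).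
    move=> y1 y3 c.
    apply: (ge0_integral_translationT c (g := fun y2 : R => (G (shear f g s x, (y1, y2, y3)))%:E)).
      apply: measurableT_comp mGs _.
      by apply: measurable_fun_pair => //; exact: measurable_fun_pair.
    by move=> ?; exact: G0'.
  have := ge0_integral_shear ma mb mGs (fun v => G0' (shear f g s x, v)) t1 t2.
  by [].
transitivity (\int[cube_measure (period_measure p)]_x H (shear f g s x))%E.
  by apply: eq_integral => x _; exact: fiber.
exact: integral_shear.
Qed.

Definition lshear_flow : measure_preserving_flow phase_measure phase_shift :=
  MeasurePreservingFlow measurable_lshear lshearD lshear_shift lshear_preserves.

End one_shear.
End lifted_shear.

Section rotated_flow.
Context {R : realType}.
Local Notation borelR := (measurableTypeR R).
Local Notation borelR3 := (borelR * borelR * borelR)%type.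
Local Notation E := (borelR3 * borelR3)%type.
Variable p : R.
Local Notation lam := (phase_measure p).
Local Notation tr := (phase_shift p).

(** As [rotz] has order three, [rotz \o rotz] is its inverse and this is a conjugation. *)
Definition conj_rotz (Phi : R -> E -> E) (t : R) (z : E) : E := rotz (Phi t (rotz (rotz z))).

Variable Phi : measure_preserving_flow lam tr.

Let mrr : measurable_fun setT (fun z : E => rotz (rotz z) : E).
Proof. exact: measurableT_comp (@measurable_rotz R) (@measurable_rotz R). Qed.

Let conj_measurable :
  measurable_fun setT (fun q : E * R => conj_rotz Phi q.2 q.1).
Proof.
apply: measurableT_comp (@measurable_rotz R) _.
apply: (measurableT_comp (measurable_flow Phi) (g := fun q => (rotz (rotz q.1), q.2))).
apply: measurable_fun_pair; last exact: measurable_snd.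
exact: measurableT_comp mrr measurable_fst.
Qed.

Let conjD s t z : conj_rotz Phi (s + t) z = conj_rotz Phi s (conj_rotz Phi t z).
Proof. by rewrite /conj_rotz rotz3 flowD. Qed.

Let conj_shift s k z : conj_rotz Phi s (tr k z) = tr k (conj_rotz Phi s z).
Proof. by rewrite /conj_rotz !rotz_shift flow_translation rotz_shift rot3. Qed.

Let conj_preserves s (G : E -> R) : measurable_fun setT G ->
  (forall z, 0 <= G z) -> invariant_fun tr G ->
  (\int[lam]_z (G (conj_rotz Phi s z))%:E = \int[lam]_z (G z)%:E)%E.
Proof.
move=> mG G0 iG.
have mGr : measurable_fun setT (fun z : E => G (rotz z)).
  exact: measurableT_comp mG (@measurable_rotz R).
have mGP : measurable_fun setT (fun z : E => G (rotz (Phi s z))).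
  exact: measurableT_comp mGr (measurable_flow1 Phi s).
have e0 (H : E -> R) : measurable_fun setT H -> (forall z, 0 <= H z) ->
    (\int[lam]_z (H (rotz z))%:E = \int[lam]_z (H z)%:E)%E.
  move=> mH H0; apply: (integral_rotz p (g := EFin \o H)).
    exact/measurable_EFinP.
  by move=> z; rewrite lee_fin.
rewrite -[RHS]e0// -[RHS](flow_preserves Phi s)//; last by move=> k z; rewrite rotz_shift iG.
rewrite -[RHS]e0// -[RHS](e0 (fun z => G (rotz (Phi s (rotz z)))))//.
exact: measurableT_comp mGP (@measurable_rotz R).
Qed.

Definition rotated_flow : measure_preserving_flow lam tr :=
  MeasurePreservingFlow conj_measurable conjD conj_shift conj_preserves.

End rotated_flow.

(** * Cones of dominated vectors and their visiting times *)

Section cones.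
Context {R : realType}.
Local Notation borelR := (measurableTypeR R).
Local Notation borelR3 := (borelR * borelR * borelR)%type.
Local Notation E := (borelR3 * borelR3)%type.
Implicit Types (v : R * R * R) (z : (R * R * R) * (R * R * R)).

Definition third_dominant : set (R * R * R) :=
  [set v | [/\ v.2 != 0, `|v.1.1| <= `|v.2| & `|v.1.2| <= `|v.2|]].

(** [3 - i] rotations undo the [i] rotations of the conjugation: they bring the coordinate that
    drives the i-th shear to the third place. *)
Definition cone (i : 'I_3) : set E := [set z | third_dominant (iter (3 - i) (@rot R) z.2)].

(** A nonzero vector lies in the cone of any coordinate of largest absolute value; the inequalities
    in [third_dominant] are not strict, so that ties are covered. *)
Lemma cone_cover z : (forall i, ~ cone i z) <-> z.2 = 0.
Proof.
split=> [nA|z0 i]; last first.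
  rewrite /cone/= /third_dominant z0 => -[+ _ _].
  have -> : iter (3 - i) (@rot R) (0 : R * R * R) = 0.
    by elim: (3 - i)%N => //= n ->.
  by rewrite eqxx.
case: z nA => x [[v1 v2] v3] nA /=.
have := nA (@Ordinal 3 0 isT); have := nA (@Ordinal 3 1 isT); have := nA (@Ordinal 3 2 isT).
rewrite /cone /third_dominant /rot/= => n2 n1 n0.
have dominant (a b c : R) : ~ [/\ c != 0, `|a| <= `|c| & `|b| <= `|c|] ->
    [\/ `|c| = 0, `|c| < `|a| | `|c| < `|b|].
  move=> n; have [->|c0] := eqVneq c 0; first by constructor 1; rewrite normr0.
  have [ac|ac] := leP `|a| `|c|; last by constructor 2.
  have [bc|bc] := leP `|b| `|c|; last by constructor 3.
  by case: n.
have := normr_ge0 v1; have := normr_ge0 v2; have := normr_ge0 v3.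
have : `|v1| = 0 -> v1 = 0 by move/normr0P/eqP.
have : `|v2| = 0 -> v2 = 0 by move/normr0P/eqP.
have : `|v3| = 0 -> v3 = 0 by move/normr0P/eqP.
move: (dominant _ _ _ n0) (dominant _ _ _ n1) (dominant _ _ _ n2).
move: `|v1| `|v2| `|v3| => a b c.
move=> d0 d1 d2 c0 b0 a0 c_ge0 b_ge0 a_ge0.
suff [/a0 -> /b0 -> /c0 ->] : [/\ a = 0, b = 0 & c = 0] by [].
clear -d0 d1 d2 a_ge0 b_ge0 c_ge0.
have [ac|ca] := leP a c; have [bc|cb] := leP b c; have [ab|ba] := leP a b;
  by [case: d0 => ?; split; lra | case: d1 => ?; split; lra | case: d2 => ?; split; lra].
Qed.

Lemma measurable_third_dominant : measurable ([set z | third_dominant z.2] : set E).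
Proof.
have m1 : measurable_fun setT (fun z : E => z.2.1.1).
  apply: measurableT_comp measurable_fst _; apply: measurableT_comp measurable_fst _.
  exact: measurable_snd.
have m2 : measurable_fun setT (fun z : E => z.2.1.2).
  apply: measurableT_comp measurable_snd _; apply: measurableT_comp measurable_fst _.
  exact: measurable_snd.
have m3 : measurable_fun setT (fun z : E => z.2.2).
  by apply: measurableT_comp measurable_snd _; exact: measurable_snd.
have mn (pr : E -> borelR) : measurable_fun setT pr -> measurable_fun setT (fun z => `|pr z|).
  by move=> mpr; exact: measurableT_comp.
pose P (z : E) := ~~ (z.2.2 == 0) && ((`|z.2.1.1| <= `|z.2.2|) && (`|z.2.1.2| <= `|z.2.2|)).
have mP : measurable_fun setT P.
  apply: measurable_and; first by apply: measurable_neg; exact: measurable_fun_eqr.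
  by apply: measurable_and; apply: measurable_fun_ler; exact: mn.
rewrite (_ : mkset _ = setT `&` P @^-1` [set true]); first exact: mP.
rewrite setTI; apply/seteqP; split => z /=.
  by move=> [v3 l1 l2]; rewrite /P v3 l1 l2.
by move=> /and3P[? ? ?].
Qed.

Lemma iter_rotz n z : (iter n (@rotz R) z).2 = iter n (@rot R) z.2.
Proof. by elim: n => //= n ->. Qed.

Lemma measurable_cone i : measurable (cone i).
Proof.
have mr n : measurable_fun setT (iter n (@rotz R) : E -> E).
  elim: n => [|n IHn]; first exact: measurable_id.
  exact: measurableT_comp (@measurable_rotz R) IHn.
rewrite (_ : cone i = setT `&` iter (3 - i) (@rotz R) @^-1` [set z | third_dominant z.2]).
  by apply: mr => //; exact: measurable_third_dominant.
by rewrite setTI; apply/seteqP; split => z; rewrite /cone/= iter_rotz.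
Qed.

End cones.

Section shear_flows.
Context {R : realType}.
Local Notation borelR := (measurableTypeR R).
Local Notation borelR3 := (borelR * borelR * borelR)%type.
Local Notation E := (borelR3 * borelR3)%type.
Implicit Types (z : (R * R * R) * (R * R * R)).
Variables (p : R) (f g h : 'I_3 -> R -> R).
Hypothesis p_gt0 : 0 < p.
Hypotheses (mf : forall i, measurable_fun setT (f i))
  (mg : forall i, measurable_fun setT (g i)) (mh : forall i, measurable_fun setT (h i)).
Hypotheses (pf : forall i, periodic (f i) p) (pg : forall i, periodic (g i) p)
  (ph : forall i, periodic (h i) p).

Definition shear_flow (i : 'I_3) : measure_preserving_flow (phase_measure p) (phase_shift p) :=
  iter i (@rotated_flow R p)
    (lshear_flow p_gt0 (mf i) (mg i) (mh i) (pf i) (pg i) (ph i)).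

Lemma shear_flow_cone i t z : cone i (shear_flow i t z) <->
  third_dominant (dshear (g i) (h i) t (iter (3 - i) (@rotz R) z).1
    (iter (3 - i) (@rotz R) z).2).
Proof.
case: i => -[|[|[|//]]] i3; rewrite /cone/=.
- by rewrite !rot3.
- by rewrite /conj_rotz/= !rot3.
- by rewrite /conj_rotz/= !rot3.
Qed.

Lemma shear_flow_fixes0 i t z : z.2 = 0 -> (shear_flow i t z).2 = 0.
Proof.
case: z => x [[v1 v2] v3] /= [-> -> ->].
by case: i => -[|[|[|//]]] i3; rewrite /= /dshear/= !mulr0 !addr0.
Qed.

Variable c : R.
Hypotheses (c_gt0 : 0 < c) (gh_ge : forall i t, c <= `|g i t| \/ c <= `|h i t|).

Lemma shear_flow_visit i (j k : nat) z :
  cone i (shear_flow i (j%:R * (3 / c)) z) -> cone i (shear_flow i (k%:R * (3 / c)) z) ->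
  j = k.
Proof.
rewrite !shear_flow_cone; case: (iter _ _ z) => x [[v1 v2] v3] /=.
rewrite /third_dominant /dshear/= => -[v3_neq0 j1 j2] [_ k1 k2].
have v3_gt0 : 0 < `|v3| by rewrite normr_gt0.
have close (u b : R) : c <= `|b| ->
    `|u + j%:R * (3 / c) * b * v3| <= `|v3| -> `|u + k%:R * (3 / c) * b * v3| <= `|v3| ->
    `|(j%:R - k%:R : R)| < 1.
  move=> cb hj hk.
  have : `|(j%:R - k%:R) * (3 / c) * b * v3| <= 2 * `|v3|.
    rewrite (_ : _ * _ * _ * v3 = (u + j%:R * (3 / c) * b * v3) -
      (u + k%:R * (3 / c) * b * v3)); last by ring.
    by apply: le_trans (ler_normB _ _) _; rewrite [leRHS](_ : _ = `|v3| + `|v3|) ?lerD//; ring.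
  have c3 : 0 < 3 / c by rewrite divr_gt0.
  rewrite 3!normrM (gtr0_norm c3) ler_pM2r// => dle.
  have : 3 <= 3 / c * `|b| by rewrite mulrAC ler_pdivlMr// ler_pM2l.
  by have := normr_ge0 (j%:R - k%:R : R); nra.
have {close} : `|(j%:R - k%:R : R)| < 1.
  by have [cb|cb] := gh_ge i x.2; [exact: close cb j1 k1|exact: close cb j2 k2].
by rewrite (pmulrn 1 j) (pmulrn 1 k) -intrB -intr_norm -[ltRHS]/(1%:~R) ltr_int; lia.
Qed.

End shear_flows.

(** * Random compositions at exponential times *)

Section joint_law.
Local Open Scope ereal_scope.
Context d d1 d2 (Omega : measurableType d) (T1 : measurableType d1) (T2 : measurableType d2).
Context {R : realType} (P : probability Omega R).
Variables (Y : {mfun Omega >-> T1}) (X : {mfun Omega >-> T2}).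

Let mYX : measurable_fun setT (fun w => (Y w, X w)).
Proof. exact: measurable_fun_pair. Qed.

(** The product of the law of [Y] scaled by [P B] with the law of [X], and the image of [P]
    restricted to [B], agree on rectangles; uniqueness of product measures extends this to all [D].
    The event [B] carries the independence from later times through the induction of
    [orbit_independent]. *)
Lemma joint_law (B : set Omega) : measurable B ->
  (forall C A, measurable C -> measurable A ->
    P ((Y @^-1` C `&` X @^-1` A) `&` B) = P (Y @^-1` C) * P (X @^-1` A) * P B) ->
  forall D : set (T1 * T2), measurable D ->
  P ([set w | D (Y w, X w)] `&` B) = (distribution P Y \x distribution P X) D * P B.
Proof.
move=> mB indep D mD.
have PB : P B \is a fin_num by exact: fin_num_measure.
pose k : {nonneg R} := NngNum (fine_ge0 (measure_ge0 P B)).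
have kE : (k%:num)%:E = P B by rewrite /= fineK.
pose m1 := mscale k (distribution P Y).
have e1 : (m1 \x distribution P X) D = mscale k (distribution P Y \x distribution P X) D.
  apply: product_measure_unique => // C A mC mA.
  apply: (@etrans _ _ ((k%:num)%:E * (distribution P Y \x distribution P X) (C `*` A))) => //.
  by rewrite (product_measure1E (distribution P Y) (distribution P X) mC mA) muleA.
have e2 : (m1 \x distribution P X) D = pushforward (mrestr P mB) (fun w => (Y w, X w)) D.
  apply: product_measure_unique => //.
  move=> C A mC mA.
  transitivity (P ((Y @^-1` C `&` X @^-1` A) `&` B)); first by [].
  rewrite indep// muleC muleA -kE; by [].
move: e1; rewrite e2 /pushforward /mrestr /mscale/= fineK// muleC.
exact.
Qed.

End joint_law.

Section independent_step.
Local Open Scope ereal_scope.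
Context d d1 d2 (Omega : measurableType d) (T1 : measurableType d1) (T2 : measurableType d2).
Context {R : realType} (P : probability Omega R).
Variables (Y : {mfun Omega >-> T1}) (X : {mfun Omega >-> T2}) (m : probability T2 R).
Hypothesis indep : forall C A, measurable C -> measurable A ->
  P (Y @^-1` C `&` X @^-1` A) = P (Y @^-1` C) * P (X @^-1` A).
Hypothesis law : forall A, measurable A -> distribution P X A = m A.

Lemma integral_independent (f : T1 * T2 -> \bar R) : measurable_fun setT f ->
  (forall y, 0 <= f y) ->
  \int[P]_w f (Y w, X w) = \int[P]_w \int[m]_s f (Y w, s).
Proof.
move=> mf f0.
have mYX : measurable_fun setT (fun w => (Y w, X w)) by exact: measurable_fun_pair.
have e1 : \int[P]_w f (Y w, X w) = \int[pushforward P (fun w => (Y w, X w))]_y f y.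
  by rewrite (ge0_integral_pushforward mYX)//.
have e2 : \int[pushforward P (fun w => (Y w, X w))]_y f y =
    \int[distribution P Y \x distribution P X]_y f y.
  apply: eq_measure_integral => D mD _.
  have PT (x : \bar R) : x * P setT = x by rewrite [in LHS]probability_setT mule1.
  have indepT C A : measurable C -> measurable A ->
      P ((Y @^-1` C `&` X @^-1` A) `&` setT) = P (Y @^-1` C) * P (X @^-1` A) * P setT.
    by move=> mC mA; rewrite PT setIT; exact: indep.
  apply: etrans (etrans (joint_law measurableT indepT mD) (PT _)).
  by rewrite setIT.
rewrite e1 e2 (fubini_tonelli1 (m1 := distribution P Y) (m2 := distribution P X))//.
rewrite ge0_integral_distribution//; last 2 first.
- exact: measurable_fun_fubini_tonelli_F.
- by move=> y; exact: integral_ge0.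
apply: eq_integral => w _ /=; apply: eq_measure_integral => A mA _.
exact: law.
Qed.

End independent_step.

Section random_orbit.
Local Open Scope ereal_scope.
Context d d' (Omega : measurableType d) (E : measurableType d') {R : realType}.
Variables (P : probability Omega R) (tau : nat -> {RV P >-> R}).
Hypothesis tau_indep : mutually_independent tau.
Variable m : probability (R) R.
Hypothesis tau_law : forall n A, measurable A -> distribution P (tau n) A = m A.
Variable lam : {sigma_finite_measure set E -> \bar R}.
Variables (K : Type) (tr : K -> E -> E).
Variable Phi : nat -> measure_preserving_flow lam tr.

Fixpoint orbit n (w : Omega) (z : E) : E :=
  if n is n'.+1 then Phi n' (tau n' w) (orbit n' w z) else z.

Lemma measurable_orbit n : measurable_fun setT (fun q : Omega * E => orbit n q.1 q.2).
Proof.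
elim: n => [|n IHn]; first exact: measurable_snd.
apply: (measurableT_comp (measurable_flow (Phi n))
  (g := fun q : Omega * E => (orbit n q.1 q.2, tau n q.1))).
apply: measurable_fun_pair => //.
by apply: measurableT_comp measurable_fst.
Qed.

(** The arguments are reordered so that a fixed start and step number give a random variable, as
    [joint_law] expects. *)
Definition orbit_from z n (w : Omega) : E := orbit n w z.

Let measurable_orbit_from z n : measurable_fun setT (orbit_from z n).
Proof. exact: measurableT_comp (measurable_orbit n) (pair2_measurable z). Qed.

HB.instance Definition _ z n :=
  isMeasurableFun.Build _ _ _ _ (orbit_from z n) (measurable_orbit_from z n).

Let event (J : seq nat) (A : nat -> set R) : set Omega :=
  \bigcap_(j in [set` J]) tau j @^-1` A j.

Let measurable_event J A : (forall j, measurable (A j)) -> measurable (event J A).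
Proof.
move=> mA; rewrite /event; apply: bigcap_measurableType => j _.
by rewrite -[X in measurable X]setTI; exact: measurable_funP.
Qed.

Let event_cons n J A : event (n :: J) A = tau n @^-1` A n `&` event J A.
Proof.
apply/seteqP; split => w /=.
  move=> h; split; first by apply: (h n); rewrite /= inE eqxx.
  by move=> j jJ; apply: (h j); rewrite /= inE; apply/orP; right.
by move=> [hn hJ] j /=; rewrite inE => /predU1P[->//|]; exact: hJ.
Qed.

(** The first n steps involve only the times of index below n. In the inductive step the pair (n
    steps, time n) is independent of the later event on rectangles, by the induction hypothesis for
    [n :: J], and [joint_law] passes to the preimage of [C] under the next flow. *)
Lemma orbit_independent z n J A C : uniq J -> all (leq n) J ->
  (forall j, measurable (A j)) -> measurable C ->
  P (orbit_from z n @^-1` C `&` event J A) = P (orbit_from z n @^-1` C) * P (event J A).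
Proof.
elim: n J A C => [|n IHn] J A C uJ nJ mA mC.
  have [Cz|nCz] := pselect (C z).
    have -> : orbit_from z 0 @^-1` C = setT by apply/seteqP; split.
    by rewrite setTI [in RHS]probability_setT mul1e.
  have -> : orbit_from z 0 @^-1` C = set0 by apply/seteqP; split.
  by rewrite set0I measure0 mul0e.
have nJn : n \notin J by apply/negP => /(allP nJ); rewrite ltnn.
have mB := measurable_event J mA.
have splitn C' A' : measurable C' -> measurable A' ->
    P ((orbit_from z n @^-1` C' `&` tau n @^-1` A') `&` event J A) =
    P (orbit_from z n @^-1` C') * P (tau n @^-1` A') * P (event J A).
  (* Since n is not in [J], the condition at index n can be prescribed without altering the event on
     [J]. *)
  move=> mC' mA'; pose A2 j := if j == n then A' else A j.
  have mA2 j : measurable (A2 j) by rewrite /A2; case: ifP.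
  have eJ : event J A2 = event J A.
    apply: eq_bigcapr => j /= jJ; rewrite /A2 ifF//.
    by apply: contraNF nJn => /eqP <-.
  have A2n : A2 n = A' by rewrite /A2 eqxx.
  rewrite -setIA -{1}eJ -{1}A2n -event_cons IHn//=; last 2 first.
  - by rewrite nJn.
  - by rewrite leqnn/=; apply/allP => j jJ; exact: ltnW (allP nJ _ jJ).
  rewrite -muleA; congr (_ * _).
  rewrite /event tau_indep//=; last by rewrite nJn.
  by rewrite big_cons -tau_indep// -/(event _ _) eJ A2n.
have mPhi : measurable ((fun y : E * R => Phi n y.2 y.1) @^-1` C).
  by rewrite -[X in measurable X]setTI; exact: measurable_flow.
have PT (x : \bar R) : x * P setT = x by rewrite [in LHS]probability_setT mule1.
have splitT C' A' : measurable C' -> measurable A' ->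
    P ((orbit_from z n @^-1` C' `&` tau n @^-1` A') `&` setT) =
    P (orbit_from z n @^-1` C') * P (tau n @^-1` A') * P setT.
  move=> mC' mA'; have := IHn [:: n] (fun=> A') C' erefl _ (fun=> mA') mC'.
  rewrite event_cons [event [::] _](_ : _ = setT) ?setIT; last first.
    by apply/seteqP; split => // w _ j.
  by rewrite PT => ->//=; rewrite leqnn.
have law := joint_law (Y := orbit_from z n) (X := tau n) mB splitn mPhi.
have lawT := joint_law (Y := orbit_from z n) (X := tau n) measurableT splitT mPhi.
apply: etrans law _; congr (_ * _).
by apply: etrans (esym (PT _)) _; rewrite -lawT setIT.
Qed.

(** The last time is independent of the steps before it, and is integrated out with those steps
    frozen. *)
Lemma integral_orbitS n z (G : E -> R) : unit_fun tr G ->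
  \int[P]_w (G (orbit n.+1 w z))%:E = \int[P]_w (averaged m (Phi n) G (orbit n w z))%:E.
Proof.
move=> uG; have [mG G01 iG] := uG.
have indep C A : measurable C -> measurable A ->
    P (orbit_from z n @^-1` C `&` tau n @^-1` A) =
    P (orbit_from z n @^-1` C) * P (tau n @^-1` A).
  move=> mC mA; have := orbit_independent (n := n) (J := [:: n]) (A := fun=> A) z erefl _ (fun=> mA) mC.
  rewrite event_cons [event [::] _](_ : _ = setT) ?setIT; last first.
    by apply/seteqP; split => // w _ j.
  by apply; rewrite /= leqnn.
have := integral_independent (Y := orbit_from z n) (X := tau n) (m := m) indep (@tau_law n)
  (f := fun y => (G (Phi n y.2 y.1))%:E).
move=> ->; last 2 first.
- by apply/measurable_EFinP; exact: measurableT_comp mG (measurable_flow (Phi n)).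
- by move=> y; rewrite lee_fin; have /andP[] := G01 (Phi n y.2 y.1).
apply: eq_integral => w _; rewrite mean_EFin//.
exact: measurableT_comp mG (measurable_flow2 (Phi n) _).
Qed.

End random_orbit.

(** * Shifts of the exponential law *)

Section exponential_shift.
Local Open Scope ereal_scope.
Context {R : realType}.
Local Notation mu := (@lebesgue_measure R).
Variable rate : R.
Hypothesis rate_gt0 : (0 < rate)%R.
Variable m : probability R R.
Hypothesis mE : forall A, measurable A -> m A = exponential_prob rate A.

(** Equality holds for t at least s. For smaller t the shifted density vanishes, which is why the
    shift has to go forward. *)
Lemma exponential_pdf_shift_le (s t : R) : (0 <= s)%R ->
  (exponential_pdf rate (t - s) <= expR (rate * s) * exponential_pdf rate t)%R.
Proof.
move=> s0; have pdf0 x := exponential_pdf_ge0 (ltW rate_gt0) x.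
have [st|ts] := leP s t; last first.
  by rewrite lt0_exponential_pdf ?subr_lt0// mulr_ge0// expR_ge0.
rewrite !exponential_pdfE ?subr_ge0 ?(le_trans s0)// mulrCA ler_wpM2l ?(ltW rate_gt0)//.
by rewrite -expRD ler_expR le_eqVlt; apply/orP; left; apply/eqP; ring.
Qed.

(** The law of s + r has the shifted density, so that it is dominated by a multiple of the law of r,
    uniformly for s in [0, b]. *)
Lemma exponential_shift_bound (b s : R) (f : R -> \bar R) : (0 <= s <= b)%R ->
  measurable_fun setT f -> (forall r, 0 <= f r) ->
  \int[m]_r f (s + r)%R <= (expR (rate * b))%:E * \int[m]_r f r.
Proof.
move=> /andP[s0 sb] mf f0.
have ms : measurable_fun setT (fun r : R => (s + r)%R) by exact: measurable_funD.
have pdf0 x := exponential_pdf_ge0 (ltW rate_gt0) x.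
pose k : {nonneg R} := NngNum (expR_ge0 (rate * b)).
have e1 : \int[m]_r f (s + r)%R = \int[pushforward m (fun r : R => (s + r)%R)]_y f y.
  by rewrite (ge0_integral_pushforward ms).
have e2 : (expR (rate * b))%:E * \int[m]_r f r = \int[mscale k m]_r f r.
  by rewrite ge0_integral_mscale.
rewrite e1 e2; apply: ge0_le_measure_integral => // A mA.
have mAs : measurable ((fun r : R => (s + r)%R) @^-1` A).
  by rewrite -[X in measurable X]setTI; exact: ms.
apply: (@le_trans _ _ (m ((fun r : R => (s + r)%R) @^-1` A))); first by [].
rewrite mE// /exponential_prob.
have mpdf : measurable_fun setT (fun x : R => (exponential_pdf rate x)%:E).
  by apply/measurable_EFinP; exact: measurable_exponential_pdf.
have mpdfs : measurable_fun setT (fun x : R => (exponential_pdf rate (x - s))%:E).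
  by apply: (measurableT_comp mpdf (g := fun x : R => (x - s)%R)); exact: measurable_funB.
have := ge0_integral_translation s mA mpdfs _.
rewrite (_ : [set t | A (t + s)%R] = (fun r : R => (s + r)%R) @^-1` A); last first.
  by apply/seteqP; split => x /=; rewrite addrC.
under eq_integral do rewrite addrK.
move=> ->; last by move=> t; rewrite lee_fin; exact: pdf0.
have rhsE : mscale k m A = \int[mu]_(x in A) ((expR (rate * b))%:E * (exponential_pdf rate x)%:E).
  rewrite ge0_integralZl_EFin ?expR_ge0//; last 2 first.
  - by move=> x _; rewrite lee_fin; exact: pdf0.
  - exact: measurable_funTS.
  by rewrite -[X in _ = _ * X]/(exponential_prob rate A) -mE.
apply: (@le_trans _ _ (mscale k m A)); last by [].
rewrite rhsE.
apply: ge0_le_integral => //.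
- by move=> x _; rewrite lee_fin; exact: pdf0.
- exact: measurable_funTS.
- by apply: measurable_funTS; exact: measurable_funeM.
- move=> x _; rewrite -EFinM lee_fin (le_trans (exponential_pdf_shift_le x s0))//.
  by rewrite ler_wpM2r// ?pdf0// ler_expR ler_wpM2l// ltW.
Qed.

Lemma exponential_mass_gt0 (b : R) : (0 < b)%R ->
  exists2 p : R, (0 < p)%R & p%:E <= m `[0%R, b].
Proof.
move=> b0; exists (1 - expR (- rate * b))%R.
  by rewrite subr_gt0 expR_lt1 mulNr oppr_lt0 mulr_gt0.
by rewrite mE// exponential_prob_itv0c.
Qed.

End exponential_shift.

(** * Rarity of slow vectors and existence of a fast one *)

Section almost_sure_growth.
Local Open Scope ereal_scope.
Context {R : realType}.
Local Notation borelR := (measurableTypeR R).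
Local Notation borelR3 := (borelR * borelR * borelR)%type.
Local Notation E := (borelR3 * borelR3)%type.
Local Notation mu := (@lebesgue_measure R).
Variable p : R.
Hypothesis p_gt0 : (0 < p)%R.
Local Notation lam := (phase_measure p).
Local Notation tr := (phase_shift p).

Lemma cube_measure_box (m : {sigma_finite_measure set borelR -> \bar R}) (A : set borelR) (l : R) :
  measurable A -> m A = l%:E -> cube_measure m (A `*` A `*` A) = (l ^+ 3)%:E.
Proof.
move=> mA mAl.
transitivity (sfprod m m (A `*` A) * m A).
  by apply: product_measure1E => //; exact: measurableX.
transitivity (m A * m A * m A); first by congr (_ * _); exact: product_measure1E.
by rewrite mAl -!EFinM !exprS expr0 mulr1 mulrA.
Qed.

(** The zero vector is removed to make the indicator vanish outside the cones, as the contraction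
    requires. *)
Definition small_vectors (r : R) : set (R * R * R) :=
  (`[(- r)%R, r] `*` `[(- r)%R, r] `*` `[(- r)%R, r]) `\` [set 0%R].

Definition small_indic (r : R) (z : E) : R := \1_(small_vectors r) z.2.

Lemma measurable_small_vectors r : measurable (small_vectors r : set borelR3).
Proof.
apply: measurableD; first by do !apply: measurableX; exact: measurable_itv.
rewrite (_ : [set 0%R] = [set 0%R] `*` [set 0%R] `*` [set 0%R] :> set (R * R * R)).
  by do !apply: measurableX; exact: measurable_set1.
by apply/seteqP; split => [_ ->|[[a b] e] /= [[-> ->] ->]].
Qed.

Lemma small_indic_unit r : unit_fun tr (small_indic r).
Proof.
split => //.
  apply: (measurableT_comp (f := \1_(small_vectors r) : borelR3 -> R)).
    apply: measurable_indic; exact: measurable_small_vectors.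
  exact: measurable_snd.
by move=> z; rewrite /small_indic indicE; case: (_ \in _); rewrite ler01 lexx.
Qed.

Lemma small_indic_supported r : supported cone (small_indic r).
Proof.
move=> z /cone_cover z0.
by rewrite /small_indic indicE memNset// /small_vectors z0 => -[_]; apply.
Qed.

Lemma sqnorm_small r : (0 <= r)%R ->
  sqnorm lam (small_indic r) <= ((p * (r + r)) ^+ 3)%:E.
Proof.
move=> r0; pose I := `[(- r)%R, r]%classic.
pose S : set E := setT `*` (I `*` I `*` I).
have mI : measurable (I : set borelR) by exact: measurable_itv.
have mIII : measurable (I `*` I `*` I : set borelR3) by do 2!apply: measurableX => //.
have mS : measurable S by exact: measurableX.
apply: (@le_trans _ _ (\int[lam]_z (\1_S z)%:E)).
  have [m1 _ _] := small_indic_unit r.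
  apply: ge0_le_integral_EFin.
  - exact: measurable_funX.
  - exact: measurable_indic.
  - by move=> z; exact: sqr_ge0.
  - move=> z; rewrite /small_indic !indicE.
    have [zs|_] := boolP (z.2 \in small_vectors r); last by rewrite expr0n.
    by rewrite mem_set ?expr1n//; split => //; move: zs; rewrite inE => -[].
rewrite integral_indic// setIT.
rewrite [leLHS](_ : _ = lam S)// [leLHS](product_measure1E
  (cube_measure (period_measure p)) (cube_measure mu))//.
rewrite (cube_measure_box (m := mu) (A := I) (l := (r + r)%R))//; last first.
  rewrite /I /= lebesgue_measure_itv/= lte_fin.
  case: ifPn => [_|]; first by rewrite -EFinD opprK.
  by rewrite -leNgt => rN; congr (_%:E); lra.
rewrite [X in X * _](_ : _ = (p ^+ 3)%:E) ?exprMn//.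
rewrite -(cube_measure_box (m := period_measure p) (A := setT) (l := p) measurableT).
  by rewrite !setXTT.
by rewrite /= /period_measure /mrestr setTI lebesgue_measure_itv/= lte_fin p_gt0 -EFinD subr0.
Qed.

(** A box of candidate vectors: volume one, and at a distance from zero. *)
Definition unit_box : set (R * R * R) := `[1%R, 2%R] `*` `[1%R, 2%R] `*` `[1%R, 2%R].

Lemma measurable_unit_box : measurable (unit_box : set borelR3).
Proof. by do !apply: measurableX; exact: measurable_itv. Qed.

Definition box_indic (z : E) : R := \1_unit_box z.2.

Lemma measurable_box_indic : measurable_fun setT box_indic.
Proof.
apply: (measurableT_comp (f := \1_unit_box : borelR3 -> R)).
  apply: measurable_indic; exact: measurable_unit_box.
exact: measurable_snd.
Qed.

Lemma box_indic_ge0 z : (0 <= box_indic z)%R.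
Proof. by rewrite /box_indic indicE. Qed.

Lemma sqnorm_box : sqnorm lam box_indic <= ((p * (2 + 2)) ^+ 3)%:E.
Proof.
apply: (@le_trans _ _ (sqnorm lam (small_indic 2))); last exact: sqnorm_small.
have [m1 _ _] := small_indic_unit 2.
apply: ge0_le_integral_EFin.
- by apply: measurable_funX; exact: measurable_box_indic.
- exact: measurable_funX.
- by move=> z; exact: sqr_ge0.
- move=> z; rewrite /box_indic /small_indic !indicE.
  have [|_] := boolP (z.2 \in unit_box); last by rewrite expr0n/= sqr_ge0.
  rewrite inE => -[[/= z1 z2] z3].
  rewrite mem_set// /small_vectors; split; last first.
    by move=> z0; move: z3; rewrite z0 /= in_itv/= => /andP[]; rewrite leNgt ltr01.
  move: z1 z2 z3; rewrite !in_itv/= => /andP[? ?] /andP[? ?] /andP[? ?].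
  by do !split; rewrite /= in_itv/=; apply/andP; split => //; lra.
Qed.

(** The squared norm of the n-th iterate of [small_indic (rho ^+ n)] is of order at most
    [(q * rho ^+ 3) ^+ n], and must decay like [b ^+ (2 * n)]. Writing q = 1 - 8 e, the values rho =
    1 + e and b = 1 - e / 2 work because, to first order, the two sides are 1 - 5 e and 1 - e. *)
Lemma expansion_rate (q : R) : (0 <= q < 1)%R ->
  exists rho b : R, [/\ (1 < rho)%R, (0 < b < 1)%R & (q * rho ^+ 3 <= b ^+ 2)%R].
Proof.
move=> /andP[q0 q1]; pose e := ((1 - q) / 8)%R.
have e0 : (0 < e)%R by rewrite /e; lra.
have e1 : (e <= 8^-1)%R by rewrite /e; lra.
have qe : (q = 1 - 8 * e)%R by rewrite /e; field.
exists (1 + e)%R, (1 - e / 2)%R; split; [lra|by apply/andP; split; lra|].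
rewrite qe; clearbody e.
rewrite (_ : (1 - e / 2) ^+ 2 = 1 - e + e ^+ 2 / 4)%R; last by field.
rewrite (_ : (1 - 8 * e) * (1 + e) ^+ 3 =
  1 - 5 * e - e ^+ 2 * (21 + 23 * e + 8 * e ^+ 2))%R; last by ring.
have : (0 <= e ^+ 2 * (21 + 23 * e + 8 * e ^+ 2))%R.
  by rewrite mulr_ge0 ?sqr_ge0//; have := sqr_ge0 e; lra.
by have := sqr_ge0 e; lra.
Qed.

Variable Phi : 'I_3 -> measure_preserving_flow lam tr.
Hypothesis fixes0 : forall i t z, z.2 = 0%R -> (Phi i t z).2 = 0%R.

Context d (Omega : measurableType d) (P : probability Omega R).
Variables (mean : R) (tau : nat -> {RV P >-> R}).
Hypothesis tau_iid : iid_exponential mean tau.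

Let m : probability R R := distribution P (tau 0%N).

Let tau_law n A : measurable A -> distribution P (tau n) A = m A.
Proof. by move=> mA; exact: etrans (tau_iid.2 n A mA) (esym (tau_iid.2 0%N A mA)). Qed.

Let flow_cover i s z : (forall j, ~ cone j z) -> forall j, ~ cone j (Phi i s z).
Proof. by move=> /cone_cover z0; apply/cone_cover; exact: fixes0. Qed.

Definition phase_index (n : nat) : 'I_3 := Ordinal (ltn_pmod n (isT : (0 < 3)%N)).

Definition random_flow n w z := orbit tau (fun k => Phi (phase_index k)) n w z.

Let phase_indexE n (i : 'I_3) : phase_index (i + 3 * n) = i.
Proof. by apply: val_inj; rewrite /= mulnC addnC modnMDl modn_small. Qed.

(** The last three times are averaged out in decreasing order; this peels off the innermost
    [cycle_average], hence the use of [iterSr]. *)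
Lemma integral_random_flow n z G : unit_fun tr G ->
  \int[P]_w (G (random_flow (3 * n)%N w z))%:E = (iter n (cycle_average m Phi) G z)%:E.
Proof.
elim: n G => [|n IHn] G uG.
  by rewrite muln0 /= integral_probability_cst.
have step k H : unit_fun tr H -> \int[P]_w (H (random_flow k.+1 w z))%:E =
    \int[P]_w (averaged m (Phi (phase_index k)) H (random_flow k w z))%:E.
  by move=> uH; exact: (integral_orbitS tau_iid.1 tau_law).
rewrite iterSr -IHn; last exact: (cycle_average_unit m Phi uG).
have u2 := averaged_unit m (Phi o2) uG.
have u1 := averaged_unit m (Phi o1) u2.
have e2 : phase_index (3 * n).+2 = o2 := phase_indexE n o2.
have e1 : phase_index (3 * n).+1 = o1 := phase_indexE n o1.
have e0 : phase_index (3 * n) = o0 := phase_indexE n o0.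
rewrite mulnS; apply: etrans (step (3 * n).+2 _ uG) _; rewrite e2.
apply: etrans (step (3 * n).+1 _ u2) _; rewrite e1.
by apply: etrans (step (3 * n)%N _ u1) _; rewrite e0.
Qed.

Lemma measurable_random_flow n :
  measurable_fun setT (fun y : Omega * E => random_flow n y.1 y.2).
Proof. exact: measurable_orbit. Qed.

Variables (q rho b : R).
Hypotheses (q01 : (0 <= q < 1)%R) (rho1 : (1 < rho)%R) (b01 : (0 < b < 1)%R)
  (qrhob : (q * rho ^+ 3 <= b ^+ 2)%R).
Hypothesis contraction : forall G, unit_fun tr G -> supported cone G -> sqnorm lam G < +oo ->
  sqnorm lam (cycle_average m Phi G) <= q%:E * sqnorm lam G.

Definition slow n (y : Omega * E) : R :=
  (box_indic y.2 * small_indic (rho ^+ n) (random_flow (3 * n) y.1 y.2))%R.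

Lemma measurable_slow n : measurable_fun setT (slow n).
Proof.
have [ms _ _] := small_indic_unit (rho ^+ n).
apply: measurable_funM; first exact: measurableT_comp measurable_box_indic measurable_snd.
exact: measurableT_comp ms (measurable_random_flow (3 * n)).
Qed.

Lemma slow_ge0 n y : (0 <= slow n y)%R.
Proof. by rewrite /slow mulr_ge0 ?box_indic_ge0// /small_indic indicE. Qed.

(** After Tonelli the expectation turns the small-vector indicator into the iterate [H] of the cycle
    average, and what remains is the scalar product of [box_indic] with [H], two functions of norm
    of order 1 and at most [b ^+ n]. *)
Lemma expected_slow_le n :
  \int[P]_w \int[lam]_z (slow n (w, z))%:E <= (36 * p ^+ 3 * b ^+ n)%:E.
Proof.
have /andP[b0 b1] := b01; have /andP[q0 q1] := q01.
have rhon0 : (0 <= rho ^+ n)%R by rewrite exprn_ge0 ?ltW// (lt_trans _ rho1).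
have uG := small_indic_unit (rho ^+ n); have sG := @small_indic_supported (rho ^+ n).
have nG := sqnorm_small rhon0.
have fG : sqnorm lam (small_indic (rho ^+ n)) < +oo by apply: le_lt_trans nG (ltry _).
have [uH _ nH] := iter_cycle_average flow_cover n q01 contraction uG sG fG.
set H := iter n _ _ in uH nH.
have [mH H01 _] := uH.
rewrite (fubini_tonelli (m1 := P) (m2 := lam) (fun y => (slow n y)%:E)); last 2 first.
- by apply/measurable_EFinP; exact: measurable_slow.
- by move=> y; rewrite lee_fin slow_ge0.
have inner z : \int[P]_w (slow n (w, z))%:E = (box_indic z * H z)%:E.
  have mw : measurable_fun setT (fun w => small_indic (rho ^+ n) (random_flow (3 * n) w z)).
    have [ms _ _] := uG; apply: measurableT_comp ms _.
    exact: measurableT_comp (measurable_random_flow (3 * n)) (pair2_measurable z).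
  apply: etrans (ge0_integralM_EFin P mw (box_indic_ge0 z) _) _.
    by move=> w; rewrite /small_indic indicE.
  by rewrite integral_random_flow// -EFinM.
under eq_integral do rewrite inner.
have bn0 : (0 < b ^+ n)%R by rewrite exprn_gt0.
(* AM-GM: [box * H <= b^n / 2 * box^2 + H^2 / (2 b^n)] *)
apply: (@le_trans _ _ (\int[lam]_z
    (b ^+ n / 2 * box_indic z ^+ 2 + (2 * b ^+ n)^-1 * H z ^+ 2)%:E)).
  have mb := measurable_box_indic.
  apply: ge0_le_integral_EFin.
  - exact: measurable_funM.
  - apply: measurable_funD; apply: measurable_funM => //; exact: measurable_funX.
  - by move=> z; have /andP[? _] := H01 z; rewrite mulr_ge0 ?box_indic_ge0.
  - move=> z; rewrite -subr_ge0.
    rewrite (_ : _ - _ = (2 * b ^+ n)^-1 * (b ^+ n * box_indic z - H z) ^+ 2)%R.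
      by rewrite mulr_ge0 ?sqr_ge0// invr_ge0 mulr_ge0// ltW.
    by move: (b ^+ n)%R bn0 => x x0; field; rewrite gt_eqF.
have c1 : (0 <= b ^+ n / 2)%R by rewrite divr_ge0// ltW.
have c2 : (0 <= (2 * b ^+ n)^-1)%R by rewrite invr_ge0 mulr_ge0// ltW.
have mb := measurable_box_indic.
rewrite ge0_integralD_EFin; last 4 first.
- by apply: measurable_funM => //; exact: measurable_funX.
- by apply: measurable_funM => //; exact: measurable_funX.
- by move=> z; rewrite mulr_ge0 ?sqr_ge0.
- by move=> z; rewrite mulr_ge0 ?sqr_ge0.
rewrite !ge0_integralM_EFin//; try by [exact: measurable_funX | move=> z; exact: sqr_ge0].
apply: (@le_trans _ _ ((b ^+ n / 2)%:E * ((p * (2 + 2)) ^+ 3)%:E +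
    ((2 * b ^+ n)^-1)%:E * ((q ^+ n)%:E * ((p * (rho ^+ n + rho ^+ n)) ^+ 3)%:E))).
  apply: leeD; apply: lee_wpmul2l; rewrite ?lee_fin//; first exact: sqnorm_box.
  by apply: le_trans nH _; apply: lee_wpmul2l => //; rewrite lee_fin exprn_ge0.
rewrite -!EFinM -EFinD lee_fin.
(* The constant 36 is 4 from this term plus 4 ^ 3 / 2 = 32 from the norm of the box. *)
have key : ((2 * b ^+ n)^-1 * (q ^+ n * (p * (rho ^+ n + rho ^+ n)) ^+ 3) <=
    4 * p ^+ 3 * b ^+ n)%R.
  rewrite ler_pdivrMl ?mulr_gt0//.
  rewrite (_ : q ^+ n * _ = 8 * p ^+ 3 * (q * rho ^+ 3) ^+ n)%R; last first.
    have -> : ((q * rho ^+ 3) ^+ n = q ^+ n * (rho ^+ n) ^+ 3)%R.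
      by rewrite exprMn -!exprM mulnC.
    by move: (q ^+ n)%R (rho ^+ n)%R => x y; ring.
  rewrite (_ : 2 * b ^+ n * _ = 8 * p ^+ 3 * (b ^+ 2) ^+ n)%R; last first.
    rewrite -exprM mulnC exprM; by move: (b ^+ n)%R => x; ring.
  rewrite ler_wpM2l ?mulr_ge0 ?exprn_ge0 ?(ltW p_gt0)//.
  by apply: lerXn2r => //; rewrite nnegrE ?mulr_ge0 ?exprn_ge0// ltW// (lt_trans _ rho1).
rewrite (_ : 36 * p ^+ 3 * b ^+ n = b ^+ n / 2 * (p * (2 + 2)) ^+ 3 + 4 * p ^+ 3 * b ^+ n)%R.
  by rewrite lerD2l.
by move: (b ^+ n)%R => x; field.
Qed.

Lemma summable_slow : \int[P]_w \sum_(n <oo) \int[lam]_z (slow n (w, z))%:E < +oo.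
Proof.
have /andP[b0 b1] := b01.
have ms n : measurable_fun setT (fun w => \int[lam]_z (slow n (w, z))%:E).
  apply: (measurable_integral_fst lam (f := fun y => (slow n y)%:E)).
  - by apply/measurable_EFinP; exact: measurable_slow.
  - by move=> y; rewrite lee_fin slow_ge0.
have s0 n w : 0 <= \int[lam]_z (slow n (w, z))%:E.
  by apply: integral_EFin_ge0 => z; exact: slow_ge0.
rewrite integral_nneseries//.
apply: (@le_lt_trans _ _ (36 * p ^+ 3 / (1 - b))%:E); last by rewrite ltry.
apply: lime_le.
  by apply: is_cvg_nneseries => n _ _; exact: integral_ge0.
apply: nearW => n.
apply: (@le_trans _ _ (\sum_(0 <= i < n) (36 * p ^+ 3 * b ^+ i)%:E)).
  by apply: lee_sum => i _; exact: expected_slow_le.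
rewrite sumEFin lee_fin -mulr_sumr ler_wpM2l//.
  by rewrite mulr_ge0// exprn_ge0// ltW.
by apply: geometric_sum_le; rewrite b1 ltW.
Qed.

(** A series of finite expectation is almost surely finite. For such [w], Tonelli writes its sum as
    an integral over the vector; were the series over positions infinite for every vector of the
    box, which has volume one, the integral would be infinite. The vector obtained depends on
    [w]. *)
Lemma almost_sure_fast_vector : {ae P, forall w, exists2 v : R * R * R, v <> 0%R &
  \sum_(n <oo) \int[cube_measure (period_measure p)]_x
    (small_indic (rho ^+ n) (random_flow (3 * n) w (x, v)))%:E < +oo}.
Proof.
have ms n : measurable_fun setT (fun w => \int[lam]_z (slow n (w, z))%:E).
  apply: (measurable_integral_fst lam (f := fun y => (slow n y)%:E)).
  - by apply/measurable_EFinP; exact: measurable_slow.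
  - by move=> y; rewrite lee_fin slow_ge0.
have s0 n w : 0 <= \int[lam]_z (slow n (w, z))%:E.
  by apply: integral_EFin_ge0 => z; exact: slow_ge0.
have S0 w : 0 <= \sum_(n <oo) \int[lam]_z (slow n (w, z))%:E.
  by apply: nneseries_ge0.
have iS : P.-integrable setT (fun w => \sum_(n <oo) \int[lam]_z (slow n (w, z))%:E).
  apply/integrableP; split.
    by apply: ge0_emeasurable_sum => // k _; exact: ms.
  by under eq_integral do rewrite gee0_abs//; exact: summable_slow.
have := integrable_ae measurableT iS; apply: filterS => w /(_ I) fw.
have mslow n : measurable_fun setT (fun z => (slow n (w, z))%:E).
  apply/measurable_EFinP.
  exact: measurableT_comp (measurable_slow n) (pair1_measurable w).
pose F z := \sum_(n <oo) (slow n (w, z))%:E.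
have F0 z : 0 <= F z by apply: nneseries_ge0 => n _ _; rewrite lee_fin slow_ge0.
have mF : measurable_fun setT F.
  by apply: ge0_emeasurable_sum => // k z _; rewrite lee_fin slow_ge0.
have {fw} : \int[lam]_z F z < +oo.
  rewrite /F integral_nneseries//; last by move=> n z _; rewrite lee_fin slow_ge0.
  by rewrite -ge0_fin_numE.
rewrite (sfprod_tonelli2 (cube_measure (period_measure p)) (cube_measure mu) mF F0).
move=> Ffin; apply: contrapT => /forall2NP nv; move: Ffin; rewrite ltNge => /negP; apply.
have H0 (v : borelR3) : 0 <= \int[cube_measure (period_measure p)]_x F (x, v).
  exact: integral_ge0.
have mH := measurable_integral_snd (cube_measure (period_measure p)) mF F0.
have mbox := measurable_unit_box.
apply: (@le_trans _ _ (\int[cube_measure mu]_(v in unit_box) (fun=> +oo) v)).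
  have box1 : cube_measure mu unit_box = (1 ^+ 3)%:E.
    apply: cube_measure_box; first exact: measurable_itv.
    by rewrite /= lebesgue_measure_itv/= lte_fin ltr1n -EFinB; congr (_%:E); ring.
  by rewrite integral_cst// [X in _ * X]box1 expr1n mule1.
apply: (@le_trans _ _ (\int[cube_measure mu]_(v in unit_box)
    \int[cube_measure (period_measure p)]_x F (x, v))); last first.
  by apply: ge0_subset_integral.
apply: ge0_le_integral => //; first exact: measurable_funTS.
move=> v vbox; have v_neq0 : v <> 0%R.
  by move=> v0; move: vbox => [_]; rewrite v0 /= in_itv/= => /andP[]; rewrite leNgt ltr01.
have mx n : measurable_fun setT (fun x : borelR3 => (slow n (w, (x, v)))%:E).
  exact: measurableT_comp (mslow n) (pair2_measurable v).
case: (nv v) => // nS; rewrite leNgt; apply/negP => Sv.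
apply: nS; move: Sv; rewrite /F integral_nneseries//; last first.
  by move=> n x _; rewrite lee_fin slow_ge0.
congr (_ < _); apply: eq_eseriesr => n _; apply: eq_integral => x _.
by rewrite /slow /box_indic indicE/= mem_set// mul1r.
Qed.

End almost_sure_growth.

(** * Real-analytic periodic functions *)

Section analytic_functions.
Context {R : realType}.
Implicit Types (f : R -> R) (c : nat -> R).

(** Each of the n + 1 terms of the geometric sum of ratio t / s is at least the last one. *)
Lemma natSM_geometric_le (t s : R) n : 0 <= t < s ->
  n.+1%:R * t ^+ n <= (1 - t / s)^-1 * s ^+ n.
Proof.
move=> /andP[t0 ts]; have s0 : 0 < s by exact: le_lt_trans ts.
have u0 : 0 <= t / s by rewrite divr_ge0// ltW.
have u1 : t / s < 1 by rewrite ltr_pdivrMr// mul1r.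
rewrite -ler_pdivrMr ?exprn_gt0// -mulrA -expr_div_n.
have u01 : 0 <= t / s < 1 by rewrite u0.
apply: le_trans (geometric_sum_le n.+1 u01).
rewrite mulr_natl -[n.+1 in leLHS]subn0 -sumr_const_nat; apply: ler_sum_nat => i /= iln.
by rewrite ler_wiXn2l// ltW.
Qed.

(** Convergence at [K] bounds the terms of the series there. The factor n + 1 of the differentiated
    series is absorbed by enlarging the ratio |z| / |K| to [s], its midpoint with 1, and a geometric
    series dominates. *)
Lemma is_cvg_pseries_diffs c (K z : R) : cvgn (pseries c K) -> `|z| < `|K| ->
  cvgn (pseries (pseries_diffs c) z).
Proof.
move=> cK zK; have K0 : 0 < `|K| by exact: le_lt_trans zK.
have [M [Mreal Mbound]] := cvg_series_bounded cK.
have cM n : `|c n| * `|K| ^+ n <= `|M| + 1.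
  rewrite -normrX -normrM; apply: Mbound => //.
  by rewrite (le_lt_trans (ler_norm M))// ltrDl.
pose t := `|z| / `|K|; have t01 : 0 <= t < 1.
  by rewrite divr_ge0//= ltr_pdivrMr// mul1r.
pose s := (1 + t) / 2; have ts : 0 <= t < s by rewrite /s; apply/andP; split; lra.
pose C := (`|M| + 1) / `|K| * (1 - t / s)^-1.
have C0 : 0 <= C.
  have u1 : 0 <= 1 - t / s.
    have /andP[t0 ts'] := ts.
    by rewrite subr_ge0 ler_pdivrMr ?mul1r ?ltW// (le_lt_trans t0).
  by apply: mulr_ge0; [apply: divr_ge0 => //; exact: addr_ge0|rewrite invr_ge0].
apply: normed_cvg.
have s0 : 0 <= s by move/andP: ts => [t0 ts]; rewrite (le_trans t0)// ltW.
apply: (@series_le_cvg _ _ (geometric C s)) => [n|n|n|].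
- exact: normr_ge0.
- by rewrite /geometric/= mulr_ge0// exprn_ge0.
- rewrite /geometric/= /pseries_diffs !normrM normrX normr_nat.
  have -> : `|z| ^+ n = t ^+ n * `|K| ^+ n.
    by rewrite -exprMn /t divfK// gt_eqF.
  rewrite (_ : _ * _ * _ = (`|c n.+1| * `|K| ^+ n.+1) / `|K| * (n.+1%:R * t ^+ n)); last first.
    by rewrite exprS; field; rewrite gt_eqF.
  rewrite /C -[leRHS]mulrA; apply: ler_pM.
  + by rewrite divr_ge0 ?mulr_ge0 ?exprn_ge0.
  + by rewrite mulr_ge0 ?exprn_ge0 ?(proj1 (andP t01)).
  + by rewrite ler_pM2r ?invr_gt0.
  + exact: natSM_geometric_le.
- apply: is_cvg_geometric_series; rewrite ger0_norm// /s.
  by move/andP: t01 => [? ?]; lra.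
Qed.

Lemma pseries_is_derive f c (x0 r : R) : 0 < r ->
  (forall x, `|x - x0| < r -> series (fun n => c n * (x - x0) ^+ n) @ \oo --> f x) ->
  forall x, `|x - x0| < r ->
    is_derive x 1 f (limn (pseries (pseries_diffs c) (x - x0))) /\
    cvgn (pseries (pseries_diffs c) (x - x0)).
Proof.
move=> r0 cf x xr.
have cvg_in y : 0 <= y < r -> cvgn (pseries c y).
  move=> /andP[y0 yr]; apply/cvg_ex; exists (f (x0 + y)).
  have := cf (x0 + y); rewrite addrC addKr ger0_norm//; exact.
(* Termwise differentiation asks for convergence of the twice differentiated series at [K1]. Each
   differentiation costs a little radius, hence three nested radii below r. *)
pose K1 := (`|x - x0| + r) / 2; pose K2 := (K1 + r) / 2; pose K3 := (K2 + r) / 2.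
have xx0 := normr_ge0 (x - x0).
have [x1 h12 h23 h3r] : [/\ `|x - x0| < K1, K1 < K2, K2 < K3 & K3 < r].
  by rewrite /K3 /K2 /K1; split; lra.
have [K10 K20 K30] : [/\ 0 <= K1, 0 <= K2 & 0 <= K3] by split; lra.
have c3 : cvgn (pseries c K3) by apply: cvg_in; rewrite K30.
have c2 : cvgn (pseries (pseries_diffs c) K2).
  by apply: is_cvg_pseries_diffs c3 _; rewrite !ger0_norm.
have c1 : cvgn (pseries (pseries_diffs (pseries_diffs c)) K1).
  by apply: is_cvg_pseries_diffs c2 _; rewrite !ger0_norm.
have c2' : cvgn (pseries (pseries_diffs c) K1).
  by apply: is_cvg_pseries_inside c2 _; rewrite !ger0_norm.
have c3' : cvgn (pseries c K1) by apply: cvg_in; rewrite K10/= (lt_trans h12)// (lt_trans h23).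
have x1' : `|x - x0| < `|K1| by rewrite (ger0_norm K10).
split; last exact: is_cvg_pseries_inside c2' x1'.
apply: (@near_eq_is_derive _ _ _ (fun y => limn (pseries c (y - x0)))).
  have : \forall y \near x, `|y - x0| < r.
    have e0 : 0 < r - `|x - x0| by rewrite subr_gt0.
    apply/nbhs_ballP; exists (r - `|x - x0|) => //= y; rewrite /ball/= => xy.
    rewrite (_ : y - x0 = (x - x0) - (x - y)); last by ring.
    by have := ler_normB (x - x0) (x - y); lra.
  by apply: filterS => y yr; apply: cvg_lim => //; exact: cf.
have D := pseries_snd_diffs c3' c2' c1 x1'.
have Dshift : is_derive x 1 (fun y : R => y - x0) 1.
  by apply: is_derive_eq; rewrite subr0.
have := @is_derive1_comp R (fun z => limn (pseries c z)) (fun y => y - x0) x _ _ D Dshift.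
by rewrite mulr1.
Qed.

Lemma analytic_derivable f : real_analytic f -> forall x, derivable f x 1.
Proof.
move=> af x; have [c [r r0 cf]] := af x.
have xr : `|x - x| < r by rewrite subrr normr0.
have [D _] := pseries_is_derive r0 cf xr.
exact: (@ex_derive _ _ _ _ _ _ _ D).
Qed.

Lemma analytic_derive1 f : real_analytic f -> real_analytic f^`().
Proof.
move=> af x0; have [c [r r0 cf]] := af x0.
exists (pseries_diffs c), r => // x xr.
have [D Dc] := pseries_is_derive r0 cf xr.
by rewrite derive1E (@derive_val _ _ _ _ _ _ _ D); exact: Dc.
Qed.

Lemma analytic_continuous f : real_analytic f -> continuous f.
Proof.
move=> af x; apply: differentiable_continuous; apply/derivable1_diffP.
exact: analytic_derivable.
Qed.

Lemma analytic_measurable f : real_analytic f -> measurable_fun setT f.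
Proof. by move=> /analytic_continuous; exact: continuous_measurable_fun. Qed.

Lemma periodic_derive1 f p : periodic f p -> periodic f^`() p.
Proof.
move=> pf x; rewrite /derive1.
have -> // : (fun t => t^-1 *: (f (t + (x + p)) - f (x + p))) =
    (fun t => t^-1 *: (f (t + x) - f x)).
by apply/funext => t; rewrite addrA !pf.
Qed.

Lemma periodic_bounded_below f p : 0 < p -> periodic f p -> continuous f ->
  (forall x, 0 < f x) -> exists2 c, 0 < c & forall x, c <= f x.
Proof.
move=> p0 pf cf f0.
have [x0 _ x0min] := @EVT_min R f 0 p (ltW p0) (continuous_subspaceT cf).
exists (f x0) => // x.
have := floor_itv (x / p); set k := Num.floor _ => /andP[].
rewrite ler_pdivlMr// ltr_pdivrMr// intrD mulrDl mul1r => kx xk.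
rewrite -(subrK (k%:~R * p) x) (periodic_int pf); apply: x0min.
by rewrite in_itv/=; apply/andP; split; lra.
Qed.

(** The sum |f'| + |f''| is continuous, periodic and, f' and f'' having no common zero, positive; so
    it is bounded below, and one summand is at least half of the bound. *)
Lemma H1_bound f p : 0 < p -> periodic f p -> real_analytic f -> H1 f ->
  exists2 c, 0 < c & forall x, c <= `|f^`() x| \/ c <= `|f^`(2) x|.
Proof.
move=> p0 pf af [_ H].
have f2E : f^`(2) = f^`()^`() by [].
have a1 := analytic_derive1 af; have a2 := analytic_derive1 a1.
pose F x := `|f^`() x| + `|f^`()^`() x|.
have cF : continuous F.
  by move=> x; apply: cvgD; apply: cvg_norm; exact: analytic_continuous.
have pF : periodic F p.
  by move=> x; rewrite /F !periodic_derive1//; exact: periodic_derive1.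
have F0 x : 0 < F x.
  rewrite lt_neqAle addr_ge0// andbT eq_sym paddr_eq0// !normr_eq0.
  apply/negP => /andP[/eqP z1 /eqP z2].
  by have : (zeros f^`() `&` zeros f^`(2)) x by []; rewrite H.
have [c c0 cF'] := periodic_bounded_below p0 pF cF F0.
exists (c / 2); first by rewrite divr_gt0.
move=> x; rewrite f2E; have := cF' x; rewrite /F => cx.
have [h|h] := leP (c / 2) `|f^`() x|; first by left.
by right; lra.
Qed.

End analytic_functions.

(** * The flow of the velocity field and its differential *)

Lemma integrable_setU_disjoint d (T : measurableType d) (R : realType)
    (mu : {measure set T -> \bar R}) (A B : set T) (f : T -> \bar R) :
  measurable A -> measurable B -> [disjoint A & B] ->
  mu.-integrable A f -> mu.-integrable B f -> mu.-integrable (A `|` B) f.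
Proof.
move=> mA mB AB /integrableP[mfA iA] /integrableP[mfB iB].
have mf : measurable_fun (A `|` B) f by exact/measurable_funU.
apply/integrableP; split => //; rewrite ge0_integral_setU//.
  by rewrite lte_add_pinfty.
exact: measurableT_comp.
Qed.

Section piecewise_shear_flow.
Context {R : realType}.
Local Notation R3 := (R * R * R)%type.
Local Notation mu := (@lebesgue_measure R).
Variables (f1 f2 f3 : R -> R) (tau : nat -> R).
Local Notation u := (velocity f1 f2 f3 tau).

Definition shear_field (k : nat) : R3 -> R3 :=
  match (k %% 3)%N with 0 => X1 f1 | 1 => X2 f2 | _ => X3 f3 end.

Lemma shear_field_invariant k s (x : R3) :
  shear_field k (x + s *: shear_field k x) = shear_field k x.
Proof.
rewrite /shear_field; case: (k %% 3)%N => [|[|n]];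
  rewrite /X1 /X2 /X3 /= ?scaler0 ?addr0//; by rewrite /GRing.scale/= mulr0 addr0.
Qed.

(** The coordinate [j] drives the field and is not moved by it. This yields uniqueness of integral
    curves with no Lipschitz estimate. *)
Lemma shear_field_coord k : exists j : 'I_3, (forall x : R3, component j (shear_field k x) = 0) /\
  forall x y : R3, component j x = component j y -> shear_field k x = shear_field k y.
Proof.
rewrite /shear_field; case: (k %% 3)%N => [|[|n]].
- by exists (@Ordinal 3 2 isT); split => // -[[? ?] ?] [[? ?] ?]; rewrite /component/X1/= => ->.
- by exists (@Ordinal 3 0 isT); split => // -[[? ?] ?] [[? ?] ?]; rewrite /component/X2/= => ->.
- by exists (@Ordinal 3 1 isT); split => // -[[? ?] ?] [[? ?] ?]; rewrite /component/X3/= => ->.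
Qed.

Lemma velocity_on k t (x : R3) : k%:R < t <= k.+1%:R -> u t x = tau k *: shear_field k x.
Proof.
move=> kt.
have ind (a : nat) : \1_(`]a%:R, a.+1%:R]) t = (a == k)%:R :> R.
  rewrite indicE; congr (nat_of_bool _)%:R.
  case: eqVneq => [->|ak]; first by rewrite mem_set//= in_itv.
  rewrite memNset//= in_itv/= => /andP[at_ ta]; move: kt => /andP[kt tk].
  have : (a < k.+1)%N by rewrite -(ltr_nat R); exact: lt_le_trans at_ tk.
  have : (k < a.+1)%N by rewrite -(ltr_nat R); exact: lt_le_trans kt ta.
  by rewrite !ltnS => ka ak'; move: ak; rewrite eqn_leq ka ak'.
rewrite /velocity -(@fsbig_widen _ _ _ _ [set (k %/ 3)%N])//; last first.
  move=> n /= [_ nk]; rewrite addn1 addn2 addn3 !ind.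
  have [e0 e1 e2] : [/\ (3 * n == k)%N = false, ((3 * n).+1 == k)%N = false &
      ((3 * n).+2 == k)%N = false].
    by split; apply/negbTE/eqP => e; apply: nk; lia.
  by rewrite e0 e1 e2 !mulr0 !scale0r !addr0.
rewrite fsbig_set1 addn1 addn2 addn3 !ind /shear_field.
have := divn_eq k 3; have := ltn_pmod k (isT : (0 < 3)%N).
set r := (k %% 3)%N; set n := (k %/ 3)%N => r3 kE.
have [e0 e1 e2] : [/\ (3 * n == k)%N = (r == 0)%N, ((3 * n).+1 == k)%N = (r == 1)%N &
    ((3 * n).+2 == k)%N = (r == 2)%N].
  by split; apply/eqP/eqP; lia.
rewrite e0 e1 e2; case: r r3 kE e0 e1 e2 => [|[|[|//]]] _ kE _ _ _ /=;
  rewrite ?mulr0 ?mulr1 ?scale0r ?addr0 ?add0r; congr (tau _ *: _); lia.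
Qed.

Fixpoint traj (n : nat) (y : R3) : R3 :=
  if n is k.+1 then traj k y + tau k *: shear_field k (traj k y) else y.

Lemma componentD i (x y : R3) : component i (x + y) = component i x + component i y.
Proof. by case: i => -[|[|[|//]]]. Qed.

Lemma componentZ i (a : R) (x : R3) : component i (a *: x) = a * component i x.
Proof. by case: i => -[|[|[|//]]]. Qed.

Lemma componentP (x y : R3) : (forall i, component i x = component i y) -> x = y.
Proof.
move: x y => [[? ?] ?] [[? ?] ?] h.
have := h (@Ordinal 3 0 isT); have := h (@Ordinal 3 1 isT); have := h (@Ordinal 3 2 isT).
by rewrite /component/= => -> -> ->.
Qed.

Let natSB k : k.+1%:R - k%:R = 1 :> R.
Proof. by rewrite -natr1 addrAC subrr add0r. Qed.

Section constant_piece.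
Variables (g : R -> R) (a b c : R).
Hypotheses (a0 : 0 <= a) (gc : forall s, a < s <= b -> g s = c).

Lemma integrable_extend t : a <= t <= b -> mu.-integrable `[0, a] (EFin \o g) ->
  mu.-integrable `[0, t] (EFin \o g) /\
  \int[mu]_(s in `[0, t]) g s = \int[mu]_(s in `[0, a]) g s + c * (t - a).
Proof.
move=> /andP[at_ tb] ig.
have eqU : `[0, t]%classic = `[0, a]%classic `|` `]a, t]%classic :> set R.
  by rewrite -itv_bndbnd_setU// bnd_simp.
have dis : [disjoint `[0, a]%classic & `]a, t]%classic].
  apply/disj_set2P; rewrite -subset0 => s [] /=; rewrite !in_itv/=.
  by move=> /andP[_ sa] /andP[as_ _]; move: as_; rewrite ltNge sa.
have it2 : mu.-integrable `]a, t] (EFin \o g).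
  have icst : mu.-integrable `]a, t] (EFin \o cst c).
    apply: measurable_bounded_integrable => //.
      by rewrite /= lebesgue_measure_itv/=; case: ifP => // _; rewrite -EFinB ltry.
    by exists `|c|; split => // M cM s _ /=; exact: ltW.
  apply: eq_integrable icst => // s; rewrite inE/= in_itv/= => /andP[s1 s2].
  by rewrite gc// s1 (le_trans s2).
have it : mu.-integrable `[0, t] (EFin \o g) by rewrite eqU; exact: integrable_setU_disjoint.
split => //; rewrite eqU in it *; rewrite Rintegral_setU//.
congr (_ + _); transitivity (\int[mu]_(s in `]a, t]) c).
  apply: eq_Rintegral => s; rewrite inE/= in_itv/= => /andP[s1 s2].
  by apply: gc; rewrite s1 (le_trans s2).
rewrite Rintegral_cst//= lebesgue_measure_itv/= lte_fin.
case: ltgtP at_ => [at_|//|<-] _; first by [].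
by rewrite subrr mulr0.
Qed.

End constant_piece.

Section integral_curves.
Variables (y : R3) (X : R -> R3).
Hypothesis Xcurve : integral_curve u y X.

Let speed i s := component i (u s (X s)).

Lemma integral_curve_at0 : X 0 = y.
Proof.
apply: componentP => i; have [_ ->] := Xcurve i (lexx 0).
by rewrite set_itv1 Rintegral_set1 addr0.
Qed.

(** On ]k, k + 1] the driving coordinate of the curve is constant, hence so is its velocity, and the
    curve is a straight line there. *)
Lemma integral_curve_nat n : X n%:R = traj n y.
Proof.
elim: n => [|k IHk]; first exact: integral_curve_at0.
have k0 : 0 <= k%:R :> R by [].
have piece i c : (forall s, k%:R < s <= k.+1%:R -> speed i s = c) ->
    forall t, k%:R <= t <= k.+1%:R -> component i (X t) = component i (X k%:R) + c * (t - k%:R).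
  move=> sc t kt; have t0 : 0 <= t by have /andP[kt' _] := kt; exact: le_trans kt'.
  have [ik eqk] := Xcurve i k0; have [_ eqt] := Xcurve i t0.
  have [_ e] := integrable_extend k0 sc kt ik.
  by rewrite eqt e eqk addrA.
have [j [j0 jdep]] := shear_field_coord k.
have Xj t : k%:R <= t <= k.+1%:R -> component j (X t) = component j (X k%:R).
  move=> kt; rewrite (piece j 0 _ t kt) ?mul0r ?addr0// => s ks.
  by rewrite /speed (velocity_on _ ks) componentZ j0 mulr0.
have XE t : k%:R < t <= k.+1%:R -> shear_field k (X t) = shear_field k (traj k y).
  by move=> /andP[kt tk]; rewrite -IHk; apply: jdep; apply: Xj; rewrite tk ltW.
apply: componentP => i /=.
rewrite (piece i (tau k * component i (shear_field k (traj k y)))).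
- by rewrite natSB mulr1 componentD componentZ IHk.
- by move=> s ks; rewrite /speed (velocity_on _ ks) XE// componentZ.
- by rewrite lexx andbT ler_nat.
Qed.

End integral_curves.

Section existence.
Variable y : R3.

(* For k < t <= k + 1, [piece_index t] is k. *)
Let piece_index (t : R) : nat := `|Num.ceil t|.-1.

Let curve (t : R) : R3 :=
  traj (piece_index t) y +
    (t - (piece_index t)%:R) *: (tau (piece_index t) *: shear_field (piece_index t) (traj (piece_index t) y)).

Let piece_indexE k t : k%:R < t <= k.+1%:R -> piece_index t = k.
Proof.
move=> /andP[kt tk]; rewrite /piece_index (_ : Num.ceil t = k.+1)//.
by apply: ceil_def; rewrite intrB -!pmulrn tk andbT -natr1 addrK.
Qed.

Let curve_at k t : k%:R < t <= k.+1%:R ->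
  curve t = traj k y + (t - k%:R) *: (tau k *: shear_field k (traj k y)).
Proof. by move=> kt; rewrite /curve (piece_indexE kt). Qed.

Let curve_nat n : curve n%:R = traj n y.
Proof.
case: n => [|n].
  by rewrite /curve /piece_index ceil0/= subrr scale0r addr0.
rewrite (@curve_at n) ?ltr_nat ?ltnS ?leqnn ?lexx//.
by rewrite natSB scale1r.
Qed.

(** Each piece of the polygonal curve follows a line of its shear field, along which that field is
    constant. *)
Lemma integral_curve_exists : integral_curve u y curve.
Proof.
move=> i.
pose speed s := component i (u s (curve s)).
have sc k s : k%:R < s <= k.+1%:R -> speed s = tau k * component i (shear_field k (traj k y)).
  move=> ks; rewrite /speed (velocity_on _ ks) (curve_at ks) componentZ.
  by rewrite scalerA shear_field_invariant.
have nat_case n : mu.-integrable `[0, n%:R] (EFin \o speed) /\ component i (curve n%:R) = component i y + \int[mu]_(s in `[0, n%:R]) speed s.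
  elim: n => [|k [ik ek]].
    rewrite set_itv1 Rintegral_set1 addr0 curve_nat; split => //.
    apply: null_set_integrable => //; try exact: measurable_fun_set1.
    by rewrite /= lebesgue_measure_set1.
  have kk : ((k%:R : R) <= k.+1%:R) && ((k.+1%:R : R) <= k.+1%:R) by rewrite lexx andbT ler_nat.
  have [it e] := integrable_extend (ler0n _ k) (@sc k) kk ik; split => //.
  rewrite e addrA -ek !curve_nat/= componentD componentZ.
  by rewrite natSB mulr1.
move=> t t0; have [->|t_neq0] := eqVneq t 0; first exact: (nat_case 0%N).
have t_gt0 : 0 < t by rewrite lt_neqAle eq_sym t_neq0.
pose k := piece_index t.
have kt : k%:R < t <= k.+1%:R.
  have := ceil_itv t; have : 0 < Num.ceil t by rewrite ceil_gt0.
  rewrite /k /piece_index; case: (Num.ceil t) => // -[//|n] _ /=.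
  by rewrite intrB -!pmulrn -natr1 addrK.
have [ik ek] := nat_case k.
have kt' : k%:R <= t <= k.+1%:R by have /andP[/ltW-> ->] := kt.
have [it e] := integrable_extend (ler0n _ k) (@sc k) kt' ik; split => //.
rewrite e addrA -ek curve_nat (curve_at kt) componentD !componentZ; congr (_ + _).
by rewrite mulrC.
Qed.

End existence.

(** [flow] selects a point by [xget], with default 0; existence and uniqueness make the set of
    candidates a singleton. *)
Lemma flow_nat n (y : R3) : flow u n%:R y = traj n y.
Proof.
rewrite /flow; apply: xget_subset1.
  have [X cX] : exists X, integral_curve u y X by eexists; exact: integral_curve_exists.
  by exists X => //; exact: (integral_curve_nat cX).
by move=> _ _ [X cX <-] [Y cY <-]; rewrite (integral_curve_nat cX) (integral_curve_nat cY).
Qed.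

End piecewise_shear_flow.

(** * Differential and inverse of the flow at integer times *)

Section differential_of_flow.
Context {R : realType}.
Local Notation R3 := (R * R * R)%type.

Lemma is_diff_linear (V W : normedModType R) (f : {linear V -> W}) (x : V) :
  continuous f -> is_diff x f f.
Proof. by move=> cf; apply: DiffDef; [exact: linear_differentiable|exact: diff_lin]. Qed.

Lemma is_diff_fst (V W : normedModType R) (x : V * W) : is_diff x fst fst.
Proof. by apply: is_diff_linear => y; exact: cvg_fst. Qed.

Lemma is_diff_snd (V W : normedModType R) (x : V * W) : is_diff x snd snd.
Proof. by apply: is_diff_linear => y; exact: cvg_snd. Qed.

Lemma is_diff_coord1 (x : R3) : is_diff x (fun y : R3 => y.1.1) (fun v : R3 => v.1.1).
Proof. exact: is_diff_comp (is_diff_fst x) (is_diff_fst x.1). Qed.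

Lemma is_diff_coord2 (x : R3) : is_diff x (fun y : R3 => y.1.2) (fun v : R3 => v.1.2).
Proof. exact: is_diff_comp (is_diff_fst x) (is_diff_snd x.1). Qed.

Lemma is_diff_rot (x : R3) : is_diff x (@rot R) (@rot R).
Proof.
apply: is_diff_pair; last exact: is_diff_coord2.
by apply: is_diff_pair; [exact: is_diff_snd|exact: is_diff_coord1].
Qed.

Lemma is_diff_shear (f : R -> R) (t : R) (x : R3) :
  (forall s, derivable f s 1) -> (forall s, derivable f^`() s 1) ->
  is_diff x (shear f f^`() t) (dshear f^`() f^`(2) t x).
Proof.
move=> df df'.
have is1 (h : R -> R) : (forall s, derivable h s 1) ->
    is_diff x (fun y : R3 => t * h y.2) (fun v : R3 => t * derive1 h x.2 * v.2).
  move=> dh.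
  have dhx : is_diff (x.2) h ( *:%R^~ (derive1 h x.2)).
    by apply: DiffDef; [exact/derivable1_diffP|apply: diff1E; exact/derivable1_diffP].
  have c := is_diff_comp (is_diff_snd x) dhx.
  rewrite (_ : (fun y : R3 => t * h y.2) = t *: (h \o snd))//.
  apply: (is_diff_eq (is_diffZ t c)); apply/funext => v.
  by rewrite !fctE /GRing.scale/= -mulrA; congr (_ * _); rewrite mulrC.
apply: is_diff_pair; last exact: is_diff_snd.
apply: is_diff_pair.
- by have := is_diffD (is_diff_coord1 x) (is1 _ df).
- by have := is_diffD (is_diff_coord2 x) (is1 _ df').
Qed.

Section flow_differential.
Variables f1 f2 f3 : R -> R.

Definition profile (i : 'I_3) : R -> R := nth f1 [:: f1; f2; f3] i.

Let f i := profile i.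
Let g i := (profile i)^`().
Let h i := (profile i)^`(2).

(** The bare map underlying [shear_flow], free of the proofs of measurability and periodicity, so
    that differentiation can be treated apart. *)
Definition lifted_shear (i : 'I_3) (t : R) : R3 * R3 -> R3 * R3 :=
  iter i conj_rotz (lshear (f i) (g i) (h i)) t.

Definition base_shear (i : 'I_3) (t : R) : R3 -> R3 :=
  iter i (fun S x => rot (S (rot (rot x)))) (shear (f i) (g i) t).

Lemma lifted_shear_fst i t x v : (lifted_shear i t (x, v)).1 = base_shear i t x.
Proof. by case: i => -[|[|[|//]]] i3. Qed.

Lemma base_shearE k t x : base_shear (phase_index k) t x = x + t *: shear_field f1 f2 f3 k x.
Proof.
rewrite /base_shear /shear_field /phase_index /f /g /profile/=.
have := ltn_pmod k (isT : (0 < 3)%N).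
case: (k %% 3)%N => [|[|[|//]]] _; apply: componentP => -[[|[|[|//]]] i3];
  by rewrite componentD componentZ /component/= ?mulr0 ?addr0.
Qed.

Hypotheses (df : forall i s, derivable (f i) s 1) (dg : forall i s, derivable (g i) s 1).

(** [rot] is linear, hence its own differential, and conjugating a map by it conjugates the
    differential in the same way. *)
Lemma is_diff_base_shear i t x :
  is_diff x (base_shear i t) (fun v => (lifted_shear i t (x, v)).2).
Proof.
have conj (S dS : R3 -> R3) (y : R3) : is_diff (rot (rot y)) S dS ->
    is_diff y (fun z => rot (S (rot (rot z)))) (fun v => rot (dS (rot (rot v)))).
  move=> dSy.
  have r2 := is_diff_comp (is_diff_rot y) (is_diff_rot (rot y)).
  have r3 := is_diff_comp r2 dSy.
  exact: is_diff_comp r3 (is_diff_rot (S (rot (rot y)))).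
case: i => -[|[|[|//]]] i3; rewrite /base_shear/=.
- exact: is_diff_shear _ _ (@df _) (@dg _).
- by apply: conj; exact: is_diff_shear _ _ (@df _) (@dg _).
- have D := @is_diff_shear (f (Ordinal i3)) t (rot (rot (rot (rot x)))) (@df _) (@dg _).
  exact: (conj _ _ _ (conj _ _ _ D)).
Qed.

Variable tau : nat -> R.

Fixpoint lifted_traj n (z : R3 * R3) : R3 * R3 :=
  if n is k.+1 then lifted_shear (phase_index k) (tau k) (lifted_traj k z) else z.

Lemma lifted_traj_fst n x v : (lifted_traj n (x, v)).1 = traj f1 f2 f3 tau n x.
Proof.
elim: n => //= n IHn; rewrite -IHn -base_shearE.
by case: (lifted_traj n (x, v)) => y w; exact: lifted_shear_fst.
Qed.

Lemma is_diff_traj n x :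
  is_diff x (traj f1 f2 f3 tau n) (fun v => (lifted_traj n (x, v)).2).
Proof.
elim: n => [|n IHn]; first exact: is_diff_id.
have -> : traj f1 f2 f3 tau n.+1 = base_shear (phase_index n) (tau n) \o traj f1 f2 f3 tau n.
  by apply/funext => y; rewrite /= base_shearE.
have -> : (fun v => (lifted_traj n.+1 (x, v)).2) =
    (fun w => (lifted_shear (phase_index n) (tau n) (traj f1 f2 f3 tau n x, w)).2) \o
    (fun v => (lifted_traj n (x, v)).2).
  apply/funext => v /=; rewrite -(lifted_traj_fst n x v).
  by case: (lifted_traj n (x, v)).
exact: is_diff_comp IHn (is_diff_base_shear _ _ _).
Qed.

Fixpoint inv_traj n (x : R3) : R3 :=
  if n is k.+1 then inv_traj k (base_shear (phase_index k) (- tau k) x) else x.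

Lemma base_shearNK k t x : base_shear (phase_index k) (- t) (base_shear (phase_index k) t x) = x.
Proof. by rewrite !base_shearE shear_field_invariant scaleNr addrK. Qed.

Lemma trajK n : cancel (traj f1 f2 f3 tau n) (inv_traj n).
Proof. by elim: n => //= n IHn x; rewrite -base_shearE base_shearNK. Qed.

Lemma inv_trajK n : cancel (inv_traj n) (traj f1 f2 f3 tau n).
Proof.
elim: n => //= n IHn x; rewrite IHn -base_shearE.
by rewrite -{1}[tau n]opprK base_shearNK.
Qed.

(** The flow map is a bijection of the covering space, so that the default of the partial inverse is
    never reached. *)
Lemma pinv_traj n : 'pinv_(fun=> 0) setT (traj f1 f2 f3 tau n) = inv_traj n.
Proof.
apply/funext => x; rewrite -{1}[x](inv_trajK n).
by rewrite pinvKV ?inE// => y z _ _; exact: (can_inj (trajK n)).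
Qed.

End flow_differential.
End differential_of_flow.

(** * Integrals over the torus and change of variables *)

Section torus_integral.
Local Open Scope ereal_scope.
Context {R : realType}.
Local Notation borelR := (measurableTypeR R).
Local Notation borelR3 := (borelR * borelR * borelR)%type.
Local Notation mu := (@lebesgue_measure R).
Variable p : R.

Let I : set borelR := `[0%R, p[.
Let mI : measurable I. Proof. exact: measurable_itv. Qed.
Let mII : measurable (I `*` I). Proof. exact: measurableX. Qed.
Let mIII : measurable (I `*` I `*` I). Proof. exact: measurableX. Qed.

(** Restriction commutes with products because it does on rectangles. This links the measures of the
    averaging argument with [volume] on [torus]. *)
Lemma cube_period_measureE (A : set borelR3) : measurable A ->
  cube_measure (period_measure p) A = mrestr (cube_measure mu) mIII A.
Proof.
have e2 (B : set (borelR * borelR)) : measurable B ->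
    sfprod (period_measure p) (period_measure p) B = mrestr (sfprod mu mu) mII B.
  move=> mB; apply: (product_measure_unique (m1 := period_measure p) (m2 := period_measure p)
    (m' := mrestr (sfprod mu mu) mII)) => // X Y mX mY.
  transitivity (sfprod mu mu ((X `&` I) `*` (Y `&` I))); first by rewrite setXI.
  by apply: (product_measure1E mu mu); exact: measurableI.
move=> mA; apply: (product_measure_unique (m1 := sfprod (period_measure p) (period_measure p))
  (m2 := period_measure p) (m' := mrestr (cube_measure mu) mIII)) => // X Y mX mY.
transitivity (cube_measure mu ((X `&` (I `*` I)) `*` (Y `&` I))); first by rewrite setXI.
transitivity (sfprod mu mu (X `&` (I `*` I)) * mu (Y `&` I)).
  by apply: (product_measure1E (sfprod mu mu) mu); exact: measurableI.
by congr (_ * _); exact: esym (e2 X mX).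
Qed.

Lemma integral_cube_period (g : borelR3 -> \bar R) : measurable_fun setT g ->
  (forall x, 0 <= g x) ->
  \int[cube_measure (period_measure p)]_x g x =
  \int[cube_measure mu]_(x in I `*` I `*` I) g x.
Proof.
move=> mg g0; apply: etrans _ (ge0_integral_mrestr (cube_measure mu) mIII mg g0).
by apply: eq_measure_integral => A mA _; exact: cube_period_measureE.
Qed.

End torus_integral.

Lemma integral_torus (R : realType)
    (g : (measurableTypeR R * measurableTypeR R * measurableTypeR R)%type -> \bar R) :
  measurable_fun setT g -> (forall x, (0 <= g x)%E) ->
  (\int[@volume R]_(x in torus) g x = \int[cube_measure (period_measure (pi *+ 2))]_x g x)%E.
Proof. by move=> mg g0; exact: esym (integral_cube_period (pi *+ 2) mg g0). Qed.

Section inverse_change_of_variables.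
Context {R : realType}.
Local Notation borelR := (measurableTypeR R).
Local Notation borelR3 := (borelR * borelR * borelR)%type.
Local Notation E := (borelR3 * borelR3)%type.
Variables (p : R) (f1 f2 f3 : R -> R).
Hypothesis p_gt0 : 0 < p.
Local Notation f := (profile f1 f2 f3).
Local Notation f' := (fun i => derive1 (profile f1 f2 f3 i)).
Hypotheses (mf : forall i, measurable_fun setT (f i))
  (mf' : forall i, measurable_fun setT (f' i)).
Hypotheses (pf : forall i, periodic (f i) p) (pf' : forall i, periodic (f' i) p).
Local Notation base := (base_shear f1 f2 f3).

Lemma measurable_shear i t : measurable_fun setT (shear (f i) (f' i) t : borelR3 -> borelR3).
Proof.
have m3 (k : R -> R) : measurable_fun setT k ->
    measurable_fun setT (fun x : borelR3 => t * k x.2).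
  by move=> mk; apply: measurable_funM => //; exact: measurableT_comp mk measurable_snd.
apply: measurable_fun_pair; last exact: measurable_snd.
apply: measurable_fun_pair; apply: measurable_funD; [|exact: m3| |exact: m3].
- exact: measurableT_comp measurable_fst measurable_fst.
- exact: measurableT_comp measurable_snd measurable_fst.
Qed.

Lemma measurable_base_shear i t : measurable_fun setT (base i t : borelR3 -> borelR3).
Proof.
have mr := @measurable_rot R.
have conj (S : borelR3 -> borelR3) : measurable_fun setT S ->
    measurable_fun setT (fun x => rot (S (rot (rot x)))).
  move=> mS; exact: measurableT_comp mr (measurableT_comp mS (measurableT_comp mr mr)).
have ms := measurable_shear i t.
by case: i ms => -[|[|[|//]]] i3 ms; [exact: ms|exact: conj ms|exact: conj (conj _ ms)].
Qed.

Lemma base_shear_shift i t k x : base i t (lattice_shift p k x) = lattice_shift p k (base i t x).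
Proof.
have rs k' y : rot (lattice_shift p k' y) = lattice_shift p (rot k') (rot y) by [].
have ss k' y : shear (f i) (f' i) t (lattice_shift p k' y) =
    lattice_shift p k' (shear (f i) (f' i) t y).
  by rewrite /lattice_shift /shear/= !periodic_shift//; congr (_, _, _); rewrite addrAC.
case: i ss => -[|[|[|//]]] i3 ss; rewrite /base_shear/=.
- exact: ss.
- by rewrite !rs ss rs rot3.
- by rewrite !rs ss !rs !rot3.
Qed.

Lemma integral_base_shear i t (H : borelR3 -> \bar R) : measurable_fun setT H ->
  (forall x, (0 <= H x)%E) -> invariant_fun (lattice_shift p) H ->
  (\int[cube_measure (period_measure p)]_x H (base i t x) =
   \int[cube_measure (period_measure p)]_x H x)%E.
Proof.
have mr := @measurable_rot R.
(* [rot] permutes the lattice shifts, so that this property, quantified over all periodic [H],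
   passes from a map to its conjugate and can be applied once or twice. *)
pose P (S : borelR3 -> borelR3) := forall H : borelR3 -> \bar R, measurable_fun setT H ->
  (forall x, (0 <= H x)%E) -> invariant_fun (lattice_shift p) H ->
  (\int[cube_measure (period_measure p)]_x H (S x) =
   \int[cube_measure (period_measure p)]_x H x)%E.
have conj (S : borelR3 -> borelR3) : measurable_fun setT S -> P S ->
    P (fun x => rot (S (rot (rot x)))).
  move=> mS PS K mK K0 iK.
  have mKr := measurableT_comp mK mr.
  have mKS := measurableT_comp mKr mS.
  apply: etrans (ge0_integral_rot (period_measure p) (g := fun x => K (rot (S (rot x)))) _ _) _.
  - exact: measurableT_comp mKS mr.
  - by move=> x; exact: K0.
  apply: etrans (ge0_integral_rot (period_measure p) (g := fun x => K (rot (S x))) _ _) _.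
  - exact: mKS.
  - by move=> x; exact: K0.
  apply: etrans (PS (fun x => K (rot x)) mKr _ _) _.
  - by move=> x; exact: K0.
  - by move=> k x; exact: (iK (rot k) (rot x)).
  exact: (ge0_integral_rot (period_measure p) mK K0).
have P0 j : P (shear (f j) (f' j) t).
  move=> K mK K0 iK; exact: (integral_shear p_gt0 (mf j) (mf' j) t mK K0 iK).
move: H; case: i => -[|[|[|//]]] i3.
- exact: P0.
- exact: (conj _ (measurable_shear _ t) (P0 _)).
- have m1 : measurable_fun setT
      (fun x : borelR3 => rot (shear (f (Ordinal i3)) (f' (Ordinal i3)) t (rot (rot x)))).
    exact: measurableT_comp mr (measurableT_comp (measurable_shear _ t) (measurableT_comp mr mr)).
  exact: (conj _ m1 (conj _ (measurable_shear _ t) (P0 _))).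
Qed.

Variable tau : nat -> R.
Local Notation inv := (inv_traj f1 f2 f3 tau).

Lemma measurable_inv_traj n : measurable_fun setT (inv n : borelR3 -> borelR3).
Proof.
elim: n => [|n IHn]; first exact: measurable_id.
exact: measurableT_comp IHn (measurable_base_shear (phase_index n) (- tau n)).
Qed.

Lemma inv_traj_shift n k x : inv n (lattice_shift p k x) = lattice_shift p k (inv n x).
Proof. by elim: n x => //= n IHn x; rewrite base_shear_shift IHn. Qed.

Lemma integral_inv_traj n (H : borelR3 -> \bar R) : measurable_fun setT H ->
  (forall x, (0 <= H x)%E) -> invariant_fun (lattice_shift p) H ->
  (\int[cube_measure (period_measure p)]_x H (inv n x) =
   \int[cube_measure (period_measure p)]_x H x)%E.
Proof.
move=> mH H0 iH; elim: n => // n <-.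
apply: (integral_base_shear _ _ (H := fun x => H (inv n x))).
- exact: measurableT_comp mH (measurable_inv_traj n).
- by move=> x; exact: H0.
- by move=> k x; rewrite inv_traj_shift iH.
Qed.

End inverse_change_of_variables.

(** * Constant fields are divergence-free *)

(** An open set is the union of the countably many cubes of rational centre and radius that it
    contains, and these are rectangles of the product sigma-algebra. *)
Lemma open_measurable_cube (R : realType) (U : set (R * R * R)) : open U ->
  @measurable _ (measurableTypeR R * measurableTypeR R * measurableTypeR R)%type U.
Proof.
move=> oU.
pose box (q : rat * rat * rat * rat) : set (R * R * R) :=
  ball (ratr q.1.1.1 : R) (ratr q.2 : R) `*` ball (ratr q.1.1.2 : R) (ratr q.2 : R)
  `*` ball (ratr q.1.2 : R) (ratr q.2 : R).
pose F q : set (R * R * R) := if `[< box q `<=` U >] then box q else set0.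
rewrite (_ : U = \bigcup_q F q).
  apply: countable_bigcupT_measurable => //.
  move=> q; rewrite /F; case: ifP => // _.
  by apply: measurableX; first apply: measurableX; exact: measurable_ball.
apply/seteqP; split => [x Ux|x [q _]]; last first.
  by rewrite /F; case: ifPn => // /asboolP; apply.
have /nbhs_ballP[e /= e0 xeU] : nbhs x U by exact: open_nbhs_nbhs.
have e20 : 0 < e / 2 by rewrite divr_gt0.
have [r] := rat_in_itvoo e20; rewrite in_itv/= => /andP[r0 re].
have near_rat (y : R) : exists q : rat, `|ratr q - y| < ratr r.
  have [|q] := @rat_in_itvoo R (y - ratr r) (y + ratr r); first by lra.
  by rewrite in_itv/= => /andP[q1 q2]; exists q; rewrite ltr_norml; apply/andP; split; lra.
have [q1 h1] := near_rat x.1.1; have [q2 h2] := near_rat x.1.2.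
have [q3 h3] := near_rat x.2.
have xb : box (q1, q2, q3, r) x by [].
exists (q1, q2, q3, r) => //; rewrite /F ifT//; apply/asboolP => y yb.
apply: xeU.
have tri (a b c : R) : `|c - a| < ratr r -> `|c - b| < ratr r -> `|a - b| < e.
  move=> ca cb; rewrite (_ : a - b = (c - b) - (c - a)); last by ring.
  by apply: le_lt_trans (ler_normB _ _) _; lra.
case: yb => -[y1 y2] y3; split; [split|].
- exact: tri h1 y1.
- exact: tri h2 y2.
- exact: tri h3 y3.
Qed.

Lemma continuous_measurable_cube (R : realType) (g : R * R * R -> R) : continuous g ->
  measurable_fun setT
    (g : (measurableTypeR R * measurableTypeR R * measurableTypeR R)%type -> R).
Proof.
move=> cg; apply: (measurability _ (RGenOInfty.measurableE R)).
move=> _ [_ [a ->] <-]; rewrite setTI; apply: open_measurable_cube.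
by move/continuousP: cg; apply; exact: interval_open.
Qed.

Lemma add3 (R : realType) (x y : R * R * R) :
  x + y = (x.1.1 + y.1.1, x.1.2 + y.1.2, x.2 + y.2).
Proof. by []. Qed.

Lemma periodic3_bounded (R : realType) (g : R * R * R -> R) : continuous g -> periodic3 g ->
  exists2 M, 0 <= M & forall x, `|g x| <= M.
Proof.
move=> cg [p1 p2 p3].
pose p : R := pi *+ 2.
have p0 : 0 < p by rewrite mulrn_wgt0// pi_gt0.
pose K : set (R * R * R) := `[0, p] `*` `[0, p] `*` `[0, p].
have cK : compact K by do 2?apply: compact_setX; exact: segment_compact.
have [M [_ Mg]] := compact_bounded (continuous_compact (continuous_subspaceT cg) cK).
exists (`|M| + 1) => // x.
have red (t : R) : exists2 s, `[0, p]%classic s & exists k : int, t = s + k%:~R * p.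
  exists (t - (Num.floor (t / p))%:~R * p); last by exists (Num.floor (t / p)); ring.
  have := floor_itv (t / p); set k := Num.floor _ => /andP[].
  rewrite ler_pdivlMr// ltr_pdivrMr// intrD mulrDl mul1r => kx xk.
  by rewrite /= in_itv/=; apply/andP; split; lra.
case: x => -[x1 x2] x3.
have [s1 s1K [k1 ->]] := red x1; have [s2 s2K [k2 ->]] := red x2.
have [s3 s3K [k3 ->]] := red x3.
have e1 (t : R) : forall u v, g (t + k1%:~R * p, u, v) = g (t, u, v).
  move=> u v; apply: (@periodic_int _ _ _ (fun t => g (t, u, v))) => t'.
  by rewrite -[RHS]p1; congr g; rewrite add3/= !addr0.
have e2 (t : R) : forall u v, g (u, t + k2%:~R * p, v) = g (u, t, v).
  move=> u v; apply: (@periodic_int _ _ _ (fun t => g (u, t, v))) => t'.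
  by rewrite -[RHS]p2; congr g; rewrite add3/= !addr0.
have e3 (t : R) : forall u v, g (u, v, t + k3%:~R * p) = g (u, v, t).
  move=> u v; apply: (@periodic_int _ _ _ (fun t => g (u, v, t))) => t'.
  by rewrite -[RHS]p3; congr g; rewrite add3/= !addr0.
rewrite e1 e2 e3; apply: (Mg (`|M| + 1)); first by rewrite ltr_pwDr// ler_norm.
by exists (s1, s2, s3).
Qed.

Section directional_derivative.
Context {R : realType}.
Local Notation mu := (@lebesgue_measure R).
Variables (phi : R * R * R -> R) (v : R * R * R).
Hypothesis sphi : smooth phi.
Local Notation D := ('D_v phi).

Let dphi x : differentiable phi x := sphi [::] x.

Lemma smooth_continuous : continuous phi.
Proof. by move=> x; exact: differentiable_continuous. Qed.

Lemma smooth_derive_continuous : continuous D.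
Proof. by move=> x; apply: differentiable_continuous; exact: (sphi [:: v] x). Qed.

Let line (x : R * R * R) (t : R) : R * R * R := x + t *: v.

Let continuous_line x : continuous (line x).
Proof.
by move=> t; apply: cvgD; [exact: cvg_cst|apply: cvgZr_tmp; exact: cvg_id].
Qed.

Let quotient_line x t : (fun h : R => h^-1 *: ((phi \o line x \o shift t) h%:A - (phi \o line x) t))
  = (fun h : R => h^-1 *: ((phi \o shift (line x t)) (h *: v) - phi (line x t))).
Proof.
apply/funext => h /=; congr (_ *: (phi _ - _)).
by rewrite /line /shift/= [_%:A]mulr1 scalerDl addrCA.
Qed.

Lemma integral_derive_line x :
  (\int[mu]_(t in `[0%R, 1%R]) (D (x + t *: v)%R)%:E = (phi (x + v))%:E - (phi x)%:E)%E.
Proof.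
have -> : phi (x + v) = (phi \o line x) 1 by rewrite /line/= scale1r.
have -> : phi x = (phi \o line x) 0 by rewrite /line/= scale0r addr0.
have dline t : derivable (phi \o line x) t 1.
  by rewrite /derivable quotient_line; exact: diff_derivable.
have cpl : continuous (phi \o line x).
  by move=> t; apply: differentiable_continuous; exact/derivable1_diffP.
have cD : {within `[0, 1], continuous (fun t => D (line x t))}.
  apply: continuous_subspaceT => t.
  exact: (continuous_comp (@continuous_line x t) (@smooth_derive_continuous (line x t))).
have LR : derivable_oo_LRcontinuous (phi \o line x) 0 1.
  by split => //; [apply: cvg_at_right_filter|apply: cvg_at_left_filter]; exact: cpl.
have dE : {in `]0, 1[%R, (phi \o line x)^`() =1 (fun t => D (line x t))}.
  by move=> t _; rewrite derive1E /derive quotient_line.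
exact: continuous_FTC2 ltr01 cD LR dE.
Qed.

End directional_derivative.

Lemma periodic3_lattice (R : realType) (V : zmodType) (g : R * R * R -> V) : periodic3 g ->
  forall k x, g (lattice_shift (pi *+ 2) k x) = g x.
Proof.
move=> [p1 p2 p3]; pose p : R := pi *+ 2.
have q1 a b c : g (a + p, b, c) = g (a, b, c).
  by rewrite -[RHS]p1 add3/= !addr0.
have q2 a b c : g (a, b + p, c) = g (a, b, c).
  by rewrite -[RHS]p2 add3/= !addr0.
have q3 a b c : g (a, b, c + p) = g (a, b, c).
  by rewrite -[RHS]p3 add3/= !addr0.
by move=> [[[] []] []] [[x1 x2] x3];
  rewrite /lattice_shift/= ?mulr0n ?mulr1n ?addr0 ?q1 ?q2 ?q3.
Qed.

Section translation.
Context {R : realType} (p : R).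
Hypothesis p_gt0 : (0 < p)%R.
Local Notation borelR := (measurableTypeR R).
Local Notation borelR3 := (borelR * borelR * borelR)%type.
Local Notation nu := (cube_measure (period_measure p)).
Local Open Scope ereal_scope.

(** A translation of the first two coordinates is a shear with constant profiles at time 1; the
    third coordinate is reached by a rotation. *)
Lemma integral_cube_translation (H : borelR3 -> \bar R) (c : R * R * R) :
  measurable_fun setT H -> (forall x, 0 <= H x) -> invariant_fun (lattice_shift p) H ->
  \int[nu]_x H ((x : (R * R * R)%type) + c)%R = \int[nu]_x H x.
Proof.
move: c => -[[c1 c2] c3] mH H0 iH.
have mr := @measurable_rot R.
have plane (K : borelR3 -> \bar R) (a b : R) : measurable_fun setT K -> (forall x, 0 <= K x) ->
    invariant_fun (lattice_shift p) K ->
    \int[nu]_x K (x.1.1 + a, x.1.2 + b, x.2)%R = \int[nu]_x K x.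
  move=> mK K0 iK.
  apply: etrans (integral_shear (f := cst a) (g := cst b) p_gt0 _ _ 1 mK K0 iK) => //.
  by apply: eq_integral => x _; rewrite /shear/= !mul1r.
pose K (x : borelR3) := H (x.1.1, x.1.2, x.2 + c3)%R.
have mK : measurable_fun setT K.
  apply: measurableT_comp mH _; apply: measurable_fun_pair; first apply: measurable_fun_pair.
  - exact: measurableT_comp measurable_fst measurable_fst.
  - exact: measurableT_comp measurable_snd measurable_fst.
  - by apply: measurable_funD => //; exact: measurable_snd.
have K0 x : 0 <= K x by exact: H0.
have iK : invariant_fun (lattice_shift p) K.
  by move=> k x; rewrite /K -[RHS](iH k) /lattice_shift/= addrAC.
apply: etrans (plane K c1 c2 mK K0 iK) _.
apply: etrans (esym (ge0_integral_rot (period_measure p) mK K0)) _.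
transitivity (\int[nu]_x H (rot (x.1.1 + 0, x.1.2 + c3, x.2)%R)).
  by apply: eq_integral => x _; rewrite addr0.
have mHr := measurableT_comp mH mr.
have iHr : invariant_fun (lattice_shift p) (fun x => H (rot x)).
  by move=> k x; exact: (iH (rot k) (rot x)).
apply: etrans (plane (fun x => H (rot x)) 0%R c3 mHr (fun x => H0 (rot x)) iHr) _.
exact: (ge0_integral_rot (period_measure p) mH H0).
Qed.

End translation.

Section constant_field.
Context {R : realType}.
Local Notation borelR := (measurableTypeR R).
Local Notation borelR3 := (borelR * borelR * borelR)%type.
Local Notation mu := (@lebesgue_measure R).
Local Notation p := (pi *+ 2 : R).
Local Notation nu := (cube_measure (period_measure p)).
Local Open Scope ereal_scope.

Let p_gt0 : (0 < p)%R. Proof. by rewrite mulrn_wgt0// pi_gt0. Qed.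

Lemma cube_period_measureT : nu setT = (p ^+ 3)%:E.
Proof.
have e : [set: borelR3] = setT `*` setT `*` setT by rewrite !setXTT.
rewrite e; apply: cube_measure_box; first exact: measurableT.
rewrite /= /period_measure /mrestr setTI lebesgue_measure_itv/= lte_fin p_gt0.
by rewrite -EFinD subr0.
Qed.

Lemma cube_period_measure_lty : nu setT < +oo.
Proof. by rewrite [ltLHS]cube_period_measureT ltry. Qed.

Lemma volume_torus_lty : @volume R torus < +oo.
Proof.
have mtorus : measurable (torus : set borelR3).
  by apply: measurableX; [apply: measurableX|]; exact: measurable_itv.
rewrite -(mul1e (volume _)) -integral_cst//.
by rewrite integral_torus// integral_cst// mul1e cube_period_measure_lty.
Qed.

Let measurable_torus : measurable (torus : set borelR3).
Proof. by apply: measurableX; [apply: measurableX|]; exact: measurable_itv. Qed.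

Lemma continuous_periodic_integrable_torus (g : R * R * R -> R) :
  continuous g -> periodic3 g -> (volume).-integrable torus (EFin \o g).
Proof.
move=> cg pg; have [M _ gM] := periodic3_bounded cg pg.
apply: measurable_bounded_integrable => //.
- exact: volume_torus_lty.
- by apply: measurable_funTS; exact: continuous_measurable_cube.
- exists M; split; first exact: num_real.
  by move=> M' MM' x _ /=; rewrite (le_trans (gM x))// ltW.
Qed.

Section divergence.
Variables (phi : R * R * R -> R) (v : R * R * R).
Hypotheses (sphi : smooth phi) (pphi : periodic3 phi).
Local Notation D := ('D_v phi).

Lemma periodic3_derive : periodic3 D.
Proof.
have per e : periodic phi e -> periodic D e.
  move=> pe x; rewrite /derive.
  have -> // : (fun h : R => h^-1 *: ((phi \o shift (x + e)) (h *: v) - phi (x + e)))%R =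
      (fun h : R => h^-1 *: ((phi \o shift x) (h *: v) - phi x))%R.
  by apply/funext => h /=; rewrite /shift/= addrA !pe.
by case: pphi => p1 p2 p3; split; exact: per.
Qed.

Let cphi : continuous phi. Proof. exact: (smooth_continuous sphi). Qed.
Let cD : continuous D. Proof. exact: (smooth_derive_continuous (v := v) sphi). Qed.
Let mD : measurable_fun setT (D : borelR3 -> R).
Proof. exact: continuous_measurable_cube. Qed.
Let mphi : measurable_fun setT (phi : borelR3 -> R).
Proof. exact: continuous_measurable_cube. Qed.

(** Integrate D over the segment from x to x + v, which gives phi (x + v) - phi x, and then over x:
    translation invariance makes both orders of integration explicit. The constants [M] and [C] keep
    all integrands nonnegative, so that Tonelli suffices, and the finite integral of [F] cancels at
    the end. *)
Lemma integral_shifted_derive (M : R) : (forall x, `|D x| <= M)%R ->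
  \int[nu]_x (D x + M)%:E = M%:E * nu setT.
Proof.
move=> DM.
have [C C0 phiC] := periodic3_bounded cphi pphi.
have M0 : (0 <= M)%R by exact: le_trans (normr_ge0 _) (DM 0%R).
have DM0 x : (0 <= D x + M)%R by have := DM x; rewrite ler_norml => /andP[? _]; lra.
have phiC0 x : (0 <= phi x + C)%R by have := phiC x; rewrite ler_norml => /andP[? _]; lra.
pose G (x : borelR3) := (D x + M)%:E.
pose F (x : borelR3) := (phi x + C)%:E.
have mG : measurable_fun setT G by apply/measurable_EFinP; exact: measurable_funD.
have mF : measurable_fun setT F by apply/measurable_EFinP; exact: measurable_funD.
have G0 x : 0 <= G x by rewrite lee_fin.
have F0 x : 0 <= F x by rewrite lee_fin.
have iG : invariant_fun (lattice_shift p) G.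
  by move=> k x; rewrite /G (periodic3_lattice periodic3_derive).
have iF : invariant_fun (lattice_shift p) F.
  by move=> k x; rewrite /F (periodic3_lattice pphi).
pose S (q : borelR3 * borelR) : borelR3 :=
  (q.1.1.1 + q.2 * v.1.1, q.1.1.2 + q.2 * v.1.2, q.1.2 + q.2 * v.2)%R.
have mS : measurable_fun setT S.
  have m11 : measurable_fun setT (fun q : borelR3 * borelR => q.1.1).
    exact: measurableT_comp measurable_fst measurable_fst.
  have mtv (c : R) : measurable_fun setT (fun q : borelR3 * borelR => q.2 * c)%R.
    by apply: measurable_funM => //; exact: measurable_snd.
  apply: measurable_fun_pair; first apply: measurable_fun_pair; apply: measurable_funD => //.
  - exact: measurableT_comp measurable_fst m11.
  - exact: measurableT_comp measurable_snd m11.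
  - exact: measurableT_comp measurable_snd measurable_fst.
have SE x t : S (x, t) = ((x : (R * R * R)%type) + t *: v)%R by [].
have cDl (x : R * R * R) : continuous (fun t : R => D (x + t *: v)%R).
  move=> t.
  have cl : {for t, continuous (fun t : R => x + t *: v)%R}.
    by apply: cvgD; [exact: cvg_cst|apply: cvgZr_tmp; exact: cvg_id].
  exact: (continuous_comp cl (@cD _)).
have line x : \int[period_measure 1]_t G (S (x, t)) + F x =
    F ((x : (R * R * R)%type) + v)%R + M%:E.
  have mGS : measurable_fun setT (fun t : borelR => G (S (x, t))).
    exact: measurableT_comp mG (measurableT_comp mS (pair1_measurable x)).
  have -> : \int[period_measure 1]_t G (S (x, t)) = \int[mu]_(t in `[0%R, 1%R[) G (S (x, t)).
    exact: (ge0_integral_mrestr mu (measurable_itv `[0%R, 1%R[%R) mGS (fun t => G0 (S (x, t)))).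
  have iDl : mu.-integrable `[0%R, 1%R] (EFin \o (fun t : R => D (x + t *: v)%R)).
    apply: continuous_compact_integrable; first exact: segment_compact.
    exact: continuous_subspaceT.
  have iM : mu.-integrable `[0%R, 1%R] (EFin \o cst M).
    by apply: continuous_compact_integrable; [exact: segment_compact|exact: cst_continuous].
  have -> : \int[mu]_(t in `[0%R, 1%R[) G (S (x, t)) =
      \int[mu]_(t in `[0%R, 1%R]) ((D (x + t *: v)%R)%:E + M%:E).
    apply: etrans (integral_itv_bndo_bndc _) _ => //.
    exact: measurable_funTS.
  have IM : \int[mu]_(t in `[0%R, 1%R]) (M%:E) = M%:E.
    by rewrite integral_cst//= lebesgue_measure_itv/= lte_fin ltr01 oppr0 adde0 mule1.
  rewrite [X in X + _](integralD_EFin _ iDl iM)// integral_derive_line// IM /F.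
  by rewrite -!EFinD; congr (_%:E); lra.
have mGS : measurable_fun setT (fun q => G (S q)) by exact: measurableT_comp mG mS.
have unit_mass : period_measure (1 : R) setT = 1.
  apply: etrans (_ : mu `[0%R, 1%R[ = 1); first by rewrite /period_measure/mrestr setTI.
  by rewrite lebesgue_measure_itv/= lte_fin ltr01 oppr0 adde0.
have IG : \int[nu]_x \int[period_measure 1]_t G (S (x, t)) = \int[nu]_x G x.
  apply: etrans (esym (sfprod_tonelli1 nu (period_measure 1) mGS (fun q => G0 (S q)))) _.
  apply: etrans (sfprod_tonelli2 nu (period_measure 1) mGS (fun q => G0 (S q))) _.
  transitivity (\int[period_measure (1 : R)]_t \int[nu]_x G x).
    by apply: eq_integral => t _; exact: (integral_cube_translation p_gt0 (t *: v) mG G0 iG).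
  by rewrite integral_cst// [X in _ * X]unit_mass mule1.
have mI : measurable_fun setT (fun x => \int[period_measure 1]_t G (S (x, t))).
  exact: (measurable_integral_fst (period_measure 1) mGS (fun q => G0 (S q))).
have mFv : measurable_fun setT (fun x : borelR3 => F ((x : (R * R * R)%type) + v)%R).
  have mS1 := measurableT_comp mF (measurableT_comp mS (@pair2_measurable _ _ borelR3 borelR 1%R)).
  by apply: eq_measurable_fun mS1 => x _ /=; rewrite SE scale1r.
have Ffin : \int[nu]_x F x \is a fin_num.
  rewrite ge0_fin_numE ?integral_ge0//.
  apply: (@le_lt_trans _ _ (\int[nu]_x (C + C)%:E)).
    apply: ge0_le_integral => //.
    by move=> x _; rewrite lee_fin lerD2r; apply: le_trans (ler_norm _) (phiC x).
  by rewrite integral_cst// lte_mul_pinfty ?lee_fin ?addr_ge0// cube_period_measure_lty.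
have : \int[nu]_x (\int[period_measure 1]_t G (S (x, t)) + F x) =
    \int[nu]_x (F ((x : (R * R * R)%type) + v)%R + M%:E).
  by apply: eq_integral => x _; exact: line.
rewrite ge0_integralD//; last by move=> x _; exact: integral_ge0.
rewrite [RHS]ge0_integralD// IG (integral_cube_translation p_gt0 v mF F0 iF).
rewrite integral_cst// [RHS]addeC => E.
by rewrite -(addeK (\int[nu]_x G x) Ffin) E addeK.
Qed.

Lemma integral_torus_derive : \int[volume]_(x in torus) (D x)%:E = 0.
Proof.
have [M M0 DM] := periodic3_bounded cD periodic3_derive.
have DM0 x : (0 <= D x + M)%R by have := DM x; rewrite ler_norml => /andP[? _]; lra.
have mDM : measurable_fun setT (fun x : borelR3 => (D x + M)%:E).
  by apply/measurable_EFinP; exact: measurable_funD.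
have nuT : nu setT = volume torus.
  rewrite -(mul1e (volume _)) -integral_cst//.
  by rewrite integral_torus// integral_cst// mul1e.
have nuTfin : nu setT \is a fin_num.
  exact: etrans (ge0_fin_numE (measure_ge0 nu setT)) cube_period_measure_lty.
have fin : M%:E * nu setT \is a fin_num by exact: fin_numM.
have iD := continuous_periodic_integrable_torus cD periodic3_derive.
have pM : periodic3 (cst M : R * R * R -> R) by split.
have iM := continuous_periodic_integrable_torus (@cst_continuous _ _ M) pM.
have DMpos x : 0 <= (D x + M)%:E by rewrite lee_fin.
have E : \int[volume]_(x in torus) ((D x)%:E + M%:E) = M%:E * nu setT.
  exact: etrans (integral_torus mDM DMpos) (integral_shifted_derive DM).
have cM : \int[volume]_(x in torus) M%:E = M%:E * nu setT.
  by rewrite nuT; exact: (integral_cst volume measurable_torus M%:E).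
have split_int : \int[volume]_(x in torus) ((D x)%:E + M%:E) =
    \int[volume]_(x in torus) (D x)%:E + \int[volume]_(x in torus) M%:E.
  exact: (integralD_EFin measurable_torus iD iM).
rewrite split_int cM in E.
by rewrite -[LHS](addeK _ fin) E subee.
Qed.

End divergence.

(** Tested against phi, the divergence of [cst v] is the integral of the derivative of phi along
    [v], which vanishes by periodicity. *)
Lemma initial_field_cst (v : R * R * R) : initial_field (cst v).
Proof.
split; first by split.
- split; first by move=> i; exact: (@measurable_cst _ _ borelR3 R setT (component i v)).
  pose s := (\sum_(i < 3) component i v ^+ 2)%R.
  have -> : L2norm (cst v) = sqrte (s%:E * volume torus).
    by congr sqrte; exact: (integral_cst volume measurable_torus s%:E).
  have volfin : @volume R torus \is a fin_num.
    by apply/fin_numPlt; rewrite volume_torus_lty andbT; exact: lt_le_trans (measure_ge0 _ _).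
  rewrite -ge0_fin_numE ?sqrte_ge0// sqrte_fin_num ?fin_numM// mule_ge0//.
  by rewrite lee_fin; apply: sumr_ge0 => i _; exact: sqr_ge0.
- move=> phi sphi pphi; rewrite -[RHS](integral_torus_derive v sphi pphi).
  by apply: eq_integral => x _; rewrite deriveE//; exact: (sphi [::] x).
Qed.

End constant_field.

(** * Growth of the magnetic energy *)

Section pigeonhole.
Context {R : realType}.
Local Open Scope ereal_scope.

Lemma nneseries_frequently_le (b : nat -> \bar R) (e : R) (N : nat) : (0 < e)%R ->
  (forall n, 0 <= b n) -> \sum_(n <oo) b n < +oo -> exists2 n, (N <= n)%N & b n <= e%:E.
Proof.
move=> e0 b0 bfin; apply: contrapT => /forall2NP nb.
have large n : (N <= n)%N -> e%:E <= b n.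
  by move=> Nn; case: (nb n) => // /negP; rewrite -ltNge => /ltW.
set S := \sum_(n <oo) b n in bfin.
have Sfin : S \is a fin_num by rewrite ge0_fin_numE ?nneseries_ge0.
(* This many terms above [e] already exceed the sum. *)
pose k := (Num.truncn (fine S / e)).+1.
have kS : (fine S < k%:R * e)%R by rewrite -ltr_pdivrMr// truncnS_gt.
have : (k%:R * e)%:E <= S.
  apply: (@le_trans _ _ (\sum_(0 <= i < N + k) b i)); last exact: nneseries_lim_ge.
  rewrite (big_cat_nat (n := N))//= ?leq_addr//.
  apply: (@le_trans _ _ (\sum_(N <= i < N + k) e%:E)).
    by rewrite sumEFin lee_fin sumr_const_nat addKn mulr_natl.
  rewrite -[leLHS]add0e; apply: leeD; first by rewrite sume_ge0.
  by rewrite 2!big_nat; apply: lee_sum => i /andP[Ni _]; exact: large.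
by rewrite -(fineK Sfin) lee_fin leNgt kS.
Qed.

End pigeonhole.

Section growth.
Context {R : realType}.
Local Notation borelR := (measurableTypeR R).
Local Notation borelR3 := (borelR * borelR * borelR)%type.
Local Notation E := (borelR3 * borelR3)%type.
Variables (f1 f2 f3 : R -> R).
Local Notation p := (pi *+ 2 : R).
Local Notation nu := (cube_measure (period_measure p)).
Hypothesis p_gt0 : 0 < p.
Local Notation f := (profile f1 f2 f3).
Local Notation f' := (fun i => derive1 (profile f1 f2 f3 i)).
Local Notation f'' := (fun i => derive1n 2 (profile f1 f2 f3 i)).
Hypotheses (df : forall i s, derivable (f i) s 1) (df' : forall i s, derivable (f' i) s 1).
Hypotheses (mf : forall i, measurable_fun setT (f i))
  (mf' : forall i, measurable_fun setT (f' i)) (mf'' : forall i, measurable_fun setT (f'' i)).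
Hypotheses (pf : forall i, periodic (f i) p) (pf' : forall i, periodic (f' i) p)
  (pf'' : forall i, periodic (f'' i) p).

Definition profile_flow := shear_flow p_gt0 mf mf' mf'' pf pf' pf''.

Lemma profile_flowE i t z : profile_flow i t z = lifted_shear f1 f2 f3 i t z.
Proof. by rewrite /profile_flow /lifted_shear; case: i => -[|[|[|//]]] i3. Qed.

Section deterministic_times.
Variable tau : nat -> R.
Local Notation lifted := (lifted_traj f1 f2 f3 tau).
Local Notation inv := (inv_traj f1 f2 f3 tau).
Local Notation u := (velocity f1 f2 f3 tau).

Lemma lifted_trajS n z :
  lifted n.+1 z = profile_flow (phase_index n) (tau n) (lifted n z).
Proof. by rewrite profile_flowE. Qed.

Lemma measurable_lifted_traj n : measurable_fun setT (lifted n : E -> E).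
Proof.
elim: n => [|n IHn]; first exact: measurable_id.
have := measurableT_comp (measurable_flow1 (profile_flow (phase_index n)) (tau n)) IHn.
by apply: eq_measurable_fun => z _ /=; rewrite profile_flowE.
Qed.

Lemma lifted_traj_shift n k z : lifted n (phase_shift p k z) = phase_shift p k (lifted n z).
Proof. by elim: n => // n IHn; rewrite !lifted_trajS IHn flow_translation. Qed.

(** The differential is injective: a shear keeps the driving component, and once this is zero it
    keeps the others. It is needed because [small_vectors] excludes 0, which must not count as a
    large vector. *)
Lemma lifted_traj_neq0 n z : z.2 <> 0 -> (lifted n z).2 <> 0.
Proof.
move=> z0; elim: n => //= n IHn e; apply: IHn; move: e.
have dshear0 g h t x w : dshear g h t x w = 0 -> w = 0 :> R * R * R.
  case: w => [[w1 w2] w3] /= -[+ + w30]; rewrite /= in w30.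
  by rewrite /= w30 !mulr0 !addr0 => -> ->.
have rot0 (w : R * R * R) : rot w = 0 -> w = 0 by case: w => [[w1 w2] w3] [-> -> ->].
rewrite /lifted_shear; case: (phase_index n) => -[|[|[|//]]] i3; rewrite /conj_rotz/=.
- exact: dshear0.
- by move=> /rot0 /dshear0 /rot0 /rot0.
- by move=> /rot0 /rot0 /dshear0 /rot0 /rot0 /rot0 /rot0.
Qed.

Variable v : R * R * R.

Definition energy (n : nat) (y : R * R * R) : R :=
  \sum_(i < 3) component i (lifted n (y, v)).2 ^+ 2.

Lemma measurable_energy n : measurable_fun setT (energy n : borelR3 -> R).
Proof.
have ml : measurable_fun setT (fun y : borelR3 => (lifted n (y, v)).2 : borelR3).
  apply: measurableT_comp measurable_snd _.
  exact: measurableT_comp (measurable_lifted_traj n) (pair2_measurable _).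
apply: measurable_sum => i; apply: measurable_funX.
case: i => -[|[|[|//]]] i3; rewrite /component/=.
- exact: measurableT_comp measurable_fst (measurableT_comp measurable_fst ml).
- exact: measurableT_comp measurable_snd (measurableT_comp measurable_fst ml).
- exact: measurableT_comp measurable_snd ml.
Qed.

Lemma energy_ge0 n y : 0 <= energy n y.
Proof. by apply: sumr_ge0 => i _; exact: sqr_ge0. Qed.

Lemma energy_shift n k y : energy n (lattice_shift p k y) = energy n y.
Proof. by rewrite /energy -[(_, v)]/(phase_shift p k (y, v)) lifted_traj_shift. Qed.

Lemma induction_solution_cst n x :
  induction_solution u (cst v) n%:R x = (lifted n (inv n x, v)).2.
Proof.
have fE : flow u n%:R = traj f1 f2 f3 tau n by apply/funext => y; exact: flow_nat.
rewrite /induction_solution fE pinv_traj.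
have [_ dE] := is_diff_traj df df' tau n (inv n x).
by rewrite dE.
Qed.

(** Change of variables y = [inv n x], which preserves the volume of the torus for the periodic
    function [energy n]. *)
Lemma L2norm_induction_solution_cst n :
  L2norm (induction_solution u (cst v) n%:R) = sqrte (\int[nu]_y (energy n y)%:E)%E.
Proof.
have me : measurable_fun setT (fun y : borelR3 => (energy n y)%:E).
  by apply/measurable_EFinP; exact: measurable_energy.
have e0 y : (0 <= (energy n y)%:E)%E by rewrite lee_fin; exact: energy_ge0.
have minv := measurable_inv_traj mf mf' tau n.
apply: (congr1 (@sqrte R)).
transitivity (\int[@volume R]_(x in torus) (energy n (inv n x))%:E)%E.
  by apply: eq_integral => x _; rewrite induction_solution_cst.
apply: etrans (integral_torus (measurableT_comp me minv) (fun x => e0 (inv n x))) _.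
by apply: integral_inv_traj => // k y; rewrite energy_shift.
Qed.

(** Pointwise Chebyshev inequality: a nonzero vector that is not small has a component larger than r
    in absolute value. *)
Lemma energy_lower_bound n (r : R) y : 0 <= r -> v <> 0 ->
  r ^+ 2 <= energy n y + r ^+ 2 * small_indic r (lifted n (y, v)).
Proof.
move=> r0 v0; have := @lifted_traj_neq0 n (y, v) v0.
rewrite /energy /small_indic indicE; move: (lifted n (y, v)).2 => w w0.
have [ws|ws] := pselect (small_vectors r w).
  by rewrite mem_set// mulr1 lerDr sumr_ge0// => i _; exact: sqr_ge0.
rewrite memNset// mulr0 addr0 !big_ord_recl big_ord0 /component/= addr0.
have big (t : R) : ~ (- r <= t <= r) -> r ^+ 2 <= t ^+ 2.
  move=> /negP; rewrite -ler_norml -ltNge => rt.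
  by rewrite -[t ^+ 2]real_normK ?num_real// lerXn2r ?nnegrE// ltW.
have [w1|w1] := pselect (- r <= w.1.1 <= r); last first.
  by apply: le_trans (big _ w1) _; rewrite lerDl addr_ge0 ?sqr_ge0.
have [w2|w2] := pselect (- r <= w.1.2 <= r); last first.
  by apply: le_trans (big _ w2) _; rewrite addrCA lerDl addr_ge0 ?sqr_ge0.
have [w3|w3] := pselect (- r <= w.2 <= r); last first.
  by apply: le_trans (big _ w3) _; rewrite addrA lerDr addr_ge0 ?sqr_ge0.
by exfalso; apply: ws; split => //=; rewrite !in_itv.
Qed.

(** The bound on the small vectors is half of the volume [p ^+ 3] of the torus; the other half
    contributes at least [r ^+ 2] per unit of volume. *)
Lemma L2norm_lower_bound n (r : R) : 0 <= r -> v <> 0 ->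
  (\int[nu]_x (small_indic r (lifted n (x, v)))%:E <= (p ^+ 3 / 2)%:E)%E ->
  ((r * Num.sqrt (p ^+ 3 / 2))%:E <= L2norm (induction_solution u (cst v) n%:R))%E.
Proof.
move=> r0 v0 small.
have p3 : 0 <= p ^+ 3 / 2 by rewrite divr_ge0// exprn_ge0// ltW.
have [ms s01 _] := small_indic_unit p r.
have msl : measurable_fun setT (fun y : borelR3 => small_indic r (lifted n (y, v))).
  exact: measurableT_comp ms (measurableT_comp (measurable_lifted_traj n) (pair2_measurable v)).
have mrs : measurable_fun setT (fun y : borelR3 => r ^+ 2 * small_indic r (lifted n (y, v))).
  exact: measurable_funM.
have s0 z : 0 <= small_indic r z by case/andP: (s01 z).
have rs0 z : 0 <= r ^+ 2 * small_indic r z by rewrite mulr_ge0// sqr_ge0.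
have me := measurable_energy n.
have e0 := energy_ge0 n.
rewrite L2norm_induction_solution_cst.
have -> : (r * Num.sqrt (p ^+ 3 / 2))%:E = sqrte (r ^+ 2 * (p ^+ 3 / 2))%:E.
  by rewrite /= (sqrtrM _ (sqr_ge0 r)) sqrtr_sqr ger0_norm.
rewrite lee_sqrt; last by apply: integral_EFin_ge0 => y; exact: e0.
have : (\int[nu]_y (r ^+ 2)%:E <=
    \int[nu]_y (energy n y + r ^+ 2 * small_indic r (lifted n (y, v)))%:E)%E.
  apply: ge0_le_integral_EFin.
  - exact: measurable_cst.
  - exact: measurable_funD.
  - by move=> y; exact: sqr_ge0.
  - by move=> y; exact: energy_lower_bound.
rewrite integral_cst// [X in (_ * X)%E]cube_period_measureT.
rewrite (ge0_integralD_EFin nu me mrs e0 (fun y => rs0 (lifted n (y, v)))).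
rewrite (ge0_integralM_EFin nu msl (sqr_ge0 r) (fun y => s0 (lifted n (y, v)))).
set I := (\int[nu]_y (energy n y)%:E)%E; set J := (\int[nu]_y _)%E in small *.
move=> le1; have le2 : ((r ^+ 2)%:E * J <= (r ^+ 2)%:E * (p ^+ 3 / 2)%:E)%E.
  by rewrite lee_wpmul2l// lee_fin sqr_ge0.
have := le_trans le1 (leeD (lexx I) le2).
rewrite -leeBlDr// -!EFinM -EFinB; apply: le_trans.
by rewrite lee_fin le_eqVlt; apply/orP; left; apply/eqP; field.
Qed.

(** Summability gives arbitrarily large n with norm at least [c * rho ^+ n] at time 3n. The rate
    [ln rho / 3] is halved in order to absorb the constant [c]. *)
Lemma growth_rate_lower_bound (rho : R) : 1 < rho -> v <> 0 ->
  (\sum_(n <oo) \int[nu]_x (small_indic (rho ^+ n) (lifted (3 * n) (x, v)))%:E < +oo)%E ->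
  ((ln rho / 6)%:E <= growth_rate u (cst v))%E.
Proof.
move=> rho1 v0 summable.
have rho0 : 0 < rho by exact: lt_trans rho1.
have lrho : 0 < ln rho by rewrite ln_gt0.
have p3 : 0 < p ^+ 3 / 2 by rewrite divr_gt0// exprn_gt0.
pose c := Num.sqrt (p ^+ 3 / 2); have c0 : 0 < c by rewrite sqrtr_gt0.
rewrite /growth_rate limf_esupE; apply: le_ereal_inf_tmp => _ [A [M [_ MA]] <-].
(* Any n above [B] lies beyond [M] and satisfies [- ln c <= n * ln rho / 2]. *)
pose B := `|M| + 2 * `|ln c| / ln rho.
have B0 : 0 <= B by rewrite addr_ge0// divr_ge0 ?mulr_ge0// ltW.
have J0 n : (0 <= \int[nu]_x (small_indic (rho ^+ n) (lifted (3 * n) (x, v)))%:E)%E.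
  apply: integral_EFin_ge0 => x.
  by have [_ s01 _] := small_indic_unit p (rho ^+ n); case/andP: (s01 (lifted (3 * n) (x, v))).
have [n Bn small] := nneseries_frequently_le (Num.truncn B).+1 p3 J0 summable.
have {}Bn : B < n%:R by apply: lt_le_trans (truncnS_gt _) _; rewrite ler_nat.
have n0 : 0 < n%:R :> R by exact: le_lt_trans Bn.
have Mn : M < n%:R.
  apply: le_lt_trans (ler_norm M) (le_lt_trans _ Bn).
  by rewrite /B lerDl divr_ge0 ?mulr_ge0// ltW.
have lcn : - ln c <= n%:R * ln rho / 2.
  have : 2 * `|ln c| / ln rho < n%:R.
    by apply: le_lt_trans Bn; rewrite /B lerDr.
  rewrite ltr_pdivrMr// => H; have := ler_norm (- ln c); rewrite normrN; lra.
apply: (le_trans _ (ereal_sup_ubound _)); last first.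
  by exists (3 * n)%:R => //; apply: MA; apply: lt_le_trans Mn _; rewrite ler_nat leq_pmull.
have rn0 : 0 < rho ^+ n by rewrite exprn_gt0.
have := L2norm_lower_bound (ltW rn0) v0 small; rewrite -/c.
set N := L2norm _ => lower.
have lnlower : ((ln (rho ^+ n * c))%:E <= lne N)%E.
  rewrite -lne_EFin ?mulr_gt0// lee_lne// in_itv/= leey andbT.
    by rewrite lee_fin mulr_ge0// ltW.
  by apply: le_trans lower; rewrite lee_fin mulr_ge0// ltW.
have t0 : 0 < (3 * n)%:R :> R by rewrite natrM mulr_gt0.
apply: (@le_trans _ _ (((3 * n)%:R^-1)%:E * (ln (rho ^+ n * c))%:E)%E); last first.
  by rewrite lee_wpmul2l// lee_fin invr_ge0 ltW.
rewrite -EFinM lee_fin lnM ?posrE// lnXn// [_^-1 * _]mulrC ler_pdivlMr// natrM -mulr_natl.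
lra.
Qed.

End deterministic_times.
End growth.

(** * Uniform constants for the three profiles, and positivity of the growth rate *)

Lemma profile_ind (R : realType) (Q : (R -> R) -> Prop) (f1 f2 f3 : R -> R) :
  Q f1 -> Q f2 -> Q f3 -> forall i, Q (profile f1 f2 f3 i).
Proof. by move=> Q1 Q2 Q3 [[|[|[|//]]] i3]. Qed.

Theorem corollary2p4 (R : realType) (d : measure_display)
  (Omega : measurableType d) (P : probability Omega R)
  (h : R) (tau : nat -> {RV P >-> R}) (f1 f2 f3 : R -> R) :
  0 < h -> iid_exponential h tau ->
  analytic_on_circle f1 -> analytic_on_circle f2 -> analytic_on_circle f3 ->
  nonconstant f1 -> nonconstant f2 -> nonconstant f3 ->
  H1 f1 -> H1 f2 -> H1 f3 ->
  {ae P, forall w : Omega,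
    ideal_dynamo (velocity f1 f2 f3 (fun n => tau n w))}.
Proof.
move=> h0 tau_iid [an1 per1] [an2 per2] [an3 per3] _ _ _ H1f1 H1f2 H1f3.
have p_gt0 : 0 < (pi *+ 2 : R) by rewrite mulrn_wgt0// pi_gt0.
have an : forall i, real_analytic (profile f1 f2 f3 i) by exact: profile_ind.
have per : forall i, periodic (profile f1 f2 f3 i) (pi *+ 2).
  by apply: (profile_ind (Q := fun f => periodic f (pi *+ 2))).
have an' i : real_analytic (derive1 (profile f1 f2 f3 i)) := analytic_derive1 (an i).
have an'' i : real_analytic (derive1n 2 (profile f1 f2 f3 i)) := analytic_derive1 (an' i).
have per' i : periodic (derive1 (profile f1 f2 f3 i)) (pi *+ 2) := periodic_derive1 (per i).
have per'' i : periodic (derive1n 2 (profile f1 f2 f3 i)) (pi *+ 2) := periodic_derive1 (per' i).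
have mf i := analytic_measurable (an i).
have mf' i := analytic_measurable (an' i).
have mf'' i := analytic_measurable (an'' i).
have df i s : derivable (profile f1 f2 f3 i) s 1 :=
  @analytic_derivable _ _ (an i) s.
have df' i s : derivable (derive1 (profile f1 f2 f3 i)) s 1 :=
  @analytic_derivable _ _ (an' i) s.
have [c c0 bound] : exists2 c, 0 < c & forall i t,
    c <= `|derive1 (profile f1 f2 f3 i) t| \/ c <= `|derive1n 2 (profile f1 f2 f3 i) t|.
  have [c1 c10 b1] := H1_bound p_gt0 per1 an1 H1f1.
  have [c2 c20 b2] := H1_bound p_gt0 per2 an2 H1f2.
  have [c3 c30 b3] := H1_bound p_gt0 per3 an3 H1f3.
  have mono (f : R -> R) (e e' : R) : e <= e' ->
      (forall t, e' <= `|derive1 f t| \/ e' <= `|derive1n 2 f t|) ->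
      forall t, e <= `|derive1 f t| \/ e <= `|derive1n 2 f t|.
    by move=> ee be t; have [/(le_trans ee)|/(le_trans ee)] := be t; [left|right].
  exists (Num.min c1 (Num.min c2 c3)); first by rewrite !lt_min c10 c20.
  apply: (profile_ind (Q := fun f => forall t, Num.min c1 (Num.min c2 c3) <= `|derive1 f t| \/
    Num.min c1 (Num.min c2 c3) <= `|derive1n 2 f t|)).
  - by apply: mono b1; rewrite ge_min lexx.
  - by apply: mono b2; rewrite !ge_min lexx orbT.
  - by apply: mono b3; rewrite !ge_min lexx !orbT.
pose Phi := profile_flow p_gt0 mf mf' mf'' per per' per''.
have fixes0 i t z : z.2 = 0 -> (Phi i t z).2 = 0 by exact: shear_flow_fixes0.
have visit i (j k : nat) z : cone i (Phi i (j%:R * (3 / c)) z) ->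
  cone i (Phi i (k%:R * (3 / c)) z) -> j = k.
  exact: (shear_flow_visit c0 bound).
have hV : 0 < h^-1 by rewrite invr_gt0.
have law := tau_iid.2 0%N.
have a0 : 0 < 3 / c by rewrite divr_gt0.
have [mass mass0 massE] := exponential_mass_gt0 hV law (mulr_gt0 (ltr0Sn R 19) a0).
(* The 20 visiting times, [3 / c] apart, fit in [0, 20 (3 / c)], and the exponential rate [h^-1] on
   this interval gives [Kb]. The cones ignore the position, whence [erefl] for their lattice
   invariance. *)
have [q q01 contraction] := sqnorm_averaged3_le (Phi := Phi) (A := @cone R)
  (m := distribution P (tau 0%N)) (ltW a0) (@measurable_cone R)
  (fun i k z => erefl) visit (expR_ge0 (h^-1 * (20 * (3 / c))))
  (fun s f => @exponential_shift_bound _ _ hV _ law _ s f) mass0 massE.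
have [rho [b [rho1 b01 qrhob]]] := expansion_rate q01.
have := almost_sure_fast_vector p_gt0 fixes0 tau_iid q01 rho1 b01 qrhob contraction.
apply: filterS => w [v v0 summable].
have lifted n x : random_flow Phi tau n w (x, v) = lifted_traj f1 f2 f3 (fun k => tau k w) n (x, v).
  elim: n => //= n IHn; rewrite -IHn; exact: profile_flowE.
have rate : ((ln rho / 6)%:E <= growth_rate (velocity f1 f2 f3 (fun n => tau n w)) (cst v))%E.
  apply: (growth_rate_lower_bound p_gt0 df df' mf mf' mf'' per per' per'' rho1 v0).
  apply: le_lt_trans summable; rewrite le_eqVlt; apply/orP; left; apply/eqP.
  apply: eq_eseriesr => n _; apply: eq_integral => x _.
  by rewrite -lifted.
apply: lt_le_trans (le_trans rate _); first by rewrite lte_fin divr_gt0// ln_gt0.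
by apply: ereal_sup_ubound; exists (cst v) => //; exact: initial_field_cst.
Qed.
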